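(* Let $\mu$ be the normalized volume measure on the torus $\mathbb T^n$. For arbitrary $k,\ell\in\mathbb Z^n$ with $k\ne\ell$, $$-\Big(\frac32\Big)^n\le\mathsf{Sec}_\mu(e_k,e_\ell)\le\frac32\,4^n\,\big(|k|^2+|\ell|^2\big).$$
   Context: $M=\mathbb T^n=(\mathbb R/2\pi\mathbb Z)^n$ with the flat metric and distance $d$, $d\mu=(2\pi)^{-n}dx$. Fourier basis: $e_k(x)=\prod_{p=1}^n e_{k_p}(x_p)$ for $k\in\mathbb Z^n$, where for $j\in\mathbb Z$: $e_j(y)=\sqrt2\cos(jy)$ if $j>0$, $\sqrt2\sin(jy)$ if $j<0$, $1$ if $j=0$. $|k|$ is the Euclidean norm. $\mathcal M_0(M)$ is the set of finite Borel measures on $M$. Cone: $C=(M\times[0,\infty))/\!\sim$, where $(x,r)\sim(x',r')$ iff they are equal or $r=r'=0$, with metric $d_C((x,r),(x',r'))^2=r^2+r'^2-2rr'\cos(\min(d(x,x'),\pi))$. $\mathcal M_2(C)$ (resp. $\mathcal M_2(C\times C)$) is the set of Borel measures integrating $1+$ squared distance to a fixed point. For $\nu\in\mathcal M_2(C)$: $\Pr(\nu)(A)=\int_{A\times[0,\infty)}r^2\,d\nu(x,r)$. With $\pi_0,\pi_1$ the projections of $C\times C$, $\mathsf{HK}(\mu_0,\mu_1)=\inf\{\int d_C^2\,dq: q\in\mathcal M_2(C\times C),\ \Pr((\pi_i)_*q)=\mu_i,\ i=0,1\}^{1/2}$. For $r>0$, $s>-r$, $|v|<(1+s/r)\pi/2$: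 $\exp^C_{(x,r)}(v,s)=\big(\exp^M_x(\arctan(\tfrac{r|v|}{r+s})\tfrac{v}{|v|}),\sqrt{(r+s)^2+r^2|v|^2}\big)$ (first component $x$ if $v=0$). $r_\mu=\sqrt{\mu(M)}$, $\hat\mu=\frac1{r_\mu^2}\mu\otimes\delta_{r_\mu}$, $\exp_\mu(\varphi)=\Pr(\exp^C((\nabla\varphi,2r\varphi))_*\hat\mu)$. $\|\varphi\|^2_{H^1(\mu)}=\int(|\nabla\varphi|^2+4\varphi^2)d\mu$ with corresponding inner product; $\Lambda=\|\varphi\|^2_{H^1(\mu)}\|\psi\|^2_{H^1(\mu)}-\langle\varphi,\psi\rangle^2_{H^1(\mu)}$. $\lim^{*}_{s,t\to0}G(s,t)=L$ means $G(s_j,t_j)\to L$ whenever $s_j,t_j\to0$ in $(0,\infty)$ with $\sup_j(s_j/t_j+t_j/s_j)<\infty$. $$\mathsf{Sec}_\mu(\varphi,\psi)=\lim^{*}_{s,t\to0}\tfrac{3}{\Lambda s^2t^2}\big[\|s\varphi-t\psi\|^2_{H^1(\mu)}-\mathsf{HK}^2(\exp_\mu(s\varphi),\exp_\mu(t\psi))\big].$$ *)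

(* Defs.v *)
From HB Require Import structures.
From mathcomp Require Import all_boot all_order all_algebra generic_quotient ring_quotient.
From mathcomp Require Import all_classical all_reals all_analysis.

Set Implicit Arguments.
Unset Strict Implicit.
Unset Printing Implicit Defensive.
Import Order.TTheory GRing.Theory Num.Theory.
Import numFieldNormedType.Exports.
Local Open Scope classical_set_scope.
Local Open Scope quotient_scope.
Local Open Scope ring_scope.

(* Open sets of a (pseudo)metric; they generate the Borel sigma-algebra. *)
Definition metric_open (R : realType) (T : Type) (d : T -> T -> R) : set (set T) :=
  [set A | forall x, A x ->
    exists2 e : R, 0 < e & forall y, d x y < e -> A y].

(* 'rV[R]_n is used for tangent vectors; the library norm on it is the sup norm. *)
Definition edot (R : realType) n (u v : 'rV[R]_n) : R := \sum_i u 0 i * v 0 i.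
Definition enorm (R : realType) n (v : 'rV[R]_n) : R := Num.sqrt (edot v v).

Section Circle.
Context (R : realType).

Definition period_lattice (x : R) : bool := x / (2 * pi) \is a Num.int.

Fact period_lattice_zmod : zmod_closed period_lattice.
Proof.
split => [|x y]; rewrite /period_lattice unfold_in /= ?mul0r ?rpred0 //.
by move=> ? ?; rewrite unfold_in /= mulrBl rpredB.
Qed.

HB.instance Definition _ :=
  GRing.isZmodClosed.Build R period_lattice period_lattice_zmod.

Definition circle : Type := {ideal_quot (GRing.ZmodClosed.clone R period_lattice _)}.
HB.instance Definition _ := Quotient.on circle.
HB.instance Definition _ := GRing.Zmodule.on circle.
HB.instance Definition _ := isPointed.Build circle 0.

Definition circle_pi (t : R) : circle := \pi_(circle) t.

Definition circle_dist (a b : circle) : R :=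
  inf [set `|h| | h in [set h : R | a + circle_pi h = b]].

HB.instance Definition _ :=
  Measurable.copy circle (g_sigma_algebraType (metric_open circle_dist)).

Lemma circle_dist_pi (x y : R) :
  circle_dist (circle_pi x) (circle_pi y) <= `|y - x|.
Proof.
apply: ge_inf; first by exists 0 => _ [h _ <-].
by exists (y - x) => //=; rewrite /circle_pi -raddfD addrC subrK.
Qed.

Lemma measurable_circle_pi :
  @measurable_fun _ _ (measurableTypeR R) circle setT circle_pi.
Proof.
apply: (measurability (metric_open circle_dist)) => //.
move=> _ [A Aopen <-]; rewrite setTI.
apply: (@measurable_realfun.open_measurable R); rewrite openE => x /= /Aopen[e e0 eA].
apply/nbhs_ballP; exists e => //= y xy; apply: eA.
by apply: le_lt_trans (circle_dist_pi _ _) _; rewrite distrC.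
Qed.

Definition circle_pi_mfun : {mfun measurableTypeR R >-> circle} :=
  @mfun_Sub _ _ (measurableTypeR R) circle circle_pi
    (mem_set measurable_circle_pi).

Fact two_pi_gt0 : 0 < 2 * pi :> R.
Proof. by rewrite mulr_gt0 // pi_gt0. Qed.

(* dy / (2 pi) on R / 2 pi Z *)
Definition circle_volume : probability circle R :=
  distribution (uniform_prob two_pi_gt0) circle_pi_mfun.

(* e_j; the value does not depend on the representative of y *)
Definition circle_fourier (j : int) (y : circle) : R :=
  if (0 < j)%R then Num.sqrt 2 * cos (j%:~R * repr y)
  else if (j < 0)%R then Num.sqrt 2 * sin (j%:~R * repr y)
  else 1.

End Circle.

Section Torus.
Context (R : realType).

Definition torus (n : nat) : Type := n.-tuple (circle R).
HB.instance Definition _ n := Measurable.on (torus n).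

Definition torus_cons n (p : circle R * torus n) : torus n.+1 :=
  [tuple of p.1 :: p.2].

Lemma measurable_torus_cons n : measurable_fun setT (@torus_cons n).
Proof. exact: measurable_cons. Qed.

HB.instance Definition _ n :=
  isMeasurableFun.Build _ _ _ _ (@torus_cons n) (@measurable_torus_cons n).

(* (2 pi)^-n dx *)
Fixpoint torus_volume n : probability (torus n) R :=
  match n with
  | 0 => \d_([tuple] : torus 0)
  | n'.+1 => distribution (circle_volume R \x torus_volume n')%E (@torus_cons n')
  end.

Definition torus_dist n (x y : torus n) : R :=
  Num.sqrt (\sum_(i < n) circle_dist (tnth x i) (tnth y i) ^+ 2).

Definition torus_exp n (x : torus n) (v : 'rV[R]_n) : torus n :=
  [tuple tnth x i + circle_pi (v 0 i) | i < n].

Definition fourier n (k : 'rV[int]_n) (x : torus n) : R :=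
  \prod_(p < n) circle_fourier (k 0 p) (tnth x p).

Definition grad n (phi : torus n -> R) (x : torus n) : 'rV[R]_n :=
  \row_i derive1 (fun h : R => phi (torus_exp x (h *: delta_mx 0 i))) 0.

End Torus.

Section HalfLine.
Context (R : realType).

Definition half_line : Type := {nonneg R}.
HB.instance Definition _ := Choice.on half_line.
HB.instance Definition _ := isPointed.Build half_line (0%:nng : {nonneg R}).
HB.instance Definition _ := Measurable.copy half_line
  (g_sigma_algebraType
    (metric_open (fun r r' : half_line => `|r%:num - r'%:num|))).

Definition sqrt_nng (a : R) : half_line := (Num.sqrt a)%:nng.

End HalfLine.

Section Cone.
Context (R : realType) (n : nat).

Definition cone_rel (p q : torus R n * half_line R) : bool :=
  (p == q) || (p.2%:num == 0) && (q.2%:num == 0).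

Fact cone_rel_equiv : equiv_class_of cone_rel.
Proof.
split=> [p|p q|q p r]; rewrite /cone_rel ?eqxx //.
  by rewrite eq_sym andbC.
case/orP=> [/eqP-> //|/andP[-> q0]] /orP[/eqP<-|/andP[_ ->]]; last by rewrite orbT.
by rewrite q0 orbT.
Qed.

Canonical cone_equiv := EquivRelPack cone_rel_equiv.

Definition cone : Type := {eq_quot cone_equiv}.
HB.instance Definition _ := EqQuotient.on cone.
HB.instance Definition _ := Choice.on cone.

Definition cone_pi (p : torus R n * half_line R) : cone := \pi_(cone) p.
Definition cone_base (c : cone) : torus R n := (repr c).1.
Definition cone_radius (c : cone) : R := (repr c).2%:num.

HB.instance Definition _ := isPointed.Build cone (cone_pi point).

(* At the apex cone_base is an arbitrary point, but it is multiplied by 0. *)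
Definition cone_dist (p q : cone) : R :=
  Num.sqrt (cone_radius p ^+ 2 + cone_radius q ^+ 2
            - 2 * cone_radius p * cone_radius q
              * cos (Num.min (torus_dist (cone_base p) (cone_base q)) pi)).

HB.instance Definition _ :=
  Measurable.copy cone (g_sigma_algebraType (metric_open cone_dist)).

Definition cone2_dist (p q : cone * cone) : R :=
  Num.sqrt (cone_dist p.1 q.1 ^+ 2 + cone_dist p.2 q.2 ^+ 2).

(* exp^C_{(x,r)}(v,s).  If v = 0 the first component is x, since then
   the vector below is a multiple of 0. *)
Definition cone_exp (p : cone) (v : 'rV[R]_n) (s : R) : cone :=
  let x := cone_base p in let r := cone_radius p in
  cone_pi (torus_exp x ((atan (r * enorm v / (r + s)) / enorm v) *: v),
           sqrt_nng ((r + s) ^+ 2 + r ^+ 2 * enorm v ^+ 2)).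

(* Pr; set functions rather than packaged measures, so that it applies to
   pushforwards with no measurability proof. *)
Definition Pr (nu : set cone -> \bar R) : set (torus R n) -> \bar R :=
  fun A => (\int[nu]_(c in cone_pi @` (A `*` setT))
              (cone_radius c ^+ 2)%:E)%E.

End Cone.

Section HellingerKantorovich.
Context (R : realType) (n : nat).
(* M_2(X) *)
Definition finite_second_moment d (T : measurableType d) (dist : T -> T -> R)
    (nu : {measure set T -> \bar R}) : Prop :=
  exists o : T, (\int[nu]_x (1 + dist o x ^+ 2)%:E < +oo)%E.

Definition HK_coupling (mu0 mu1 : set (torus R n) -> \bar R)
    (q : {measure set (cone R n * cone R n) -> \bar R}) : Prop :=
  [/\ finite_second_moment (@cone2_dist R n) q,
      forall A, measurable A -> Pr (pushforward q fst) A = mu0 A &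
      forall A, measurable A -> Pr (pushforward q snd) A = mu1 A].

Definition HK (mu0 mu1 : set (torus R n) -> \bar R) : \bar R :=
  sqrte (ereal_inf [set (\int[q]_p (cone_dist p.1 p.2 ^+ 2)%:E)%E |
                    q in HK_coupling mu0 mu1]).

End HellingerKantorovich.

Section Curvature.
Context (R : realType) (n : nat).
Variable mu : {finite_measure set (torus R n) -> \bar R}.
Implicit Types phi psi : torus R n -> R.

Definition mass_radius : half_line R := sqrt_nng (fine (mu setT)).

Definition mu_hat : set (cone R n) -> \bar R := fun A =>
  ((mass_radius%:num ^- 2)%:E *
   pushforward (mu \x \d_mass_radius) (@cone_pi R n) A)%E.

Definition exp_mu phi : set (torus R n) -> \bar R :=
  Pr (pushforward mu_hat (fun c : cone R n =>
        cone_exp c (grad phi (cone_base c))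
                   (2 * cone_radius c * phi (cone_base c)))).

Definition H1_dot phi psi : R :=
  \int[mu]_x (edot (grad phi x) (grad psi x) + 4 * phi x * psi x).

Definition H1_norm phi : R := Num.sqrt (H1_dot phi phi).

Definition Lambda phi psi : R :=
  H1_norm phi ^+ 2 * H1_norm psi ^+ 2 - H1_dot phi psi ^+ 2.

Definition starlim (G : R -> R -> \bar R) (L : \bar R) : Prop :=
  forall s t : nat -> R,
    (forall j, 0 < s j) -> (forall j, 0 < t j) ->
    s j @[j --> \oo] --> (0 : R) -> t j @[j --> \oo] --> (0 : R) ->
    (exists M : R, forall j, s j / t j + t j / s j <= M) ->
    G (s j) (t j) @[j --> \oo] --> L.

Definition sec_quotient phi psi (s t : R) : \bar R :=
  ((3 / (Lambda phi psi * s ^+ 2 * t ^+ 2))%:E *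
   ((H1_norm (fun x => s * phi x - t * psi x) ^+ 2)%:E
    - HK (exp_mu (fun x => (s * phi x)%R)) (exp_mu (fun x => (t * psi x)%R)) ^+ 2))%E.

(* Sec_mu(phi, psi) = L, including the existence of the limit *)
Definition has_Sec phi psi (L : R) : Prop :=
  starlim (sec_quotient phi psi) L%:E.

End Curvature.

(* Main.v *)
(* Write chi = s phi - t psi and tau = s + t.  For trigonometric polynomials phi and psi,
     HK^2 (exp_mu (s phi), exp_mu (t psi)) = ||chi||^2 - s^2 t^2 kappa + O (tau^5),
     kappa = E [|w|^2 + K^2] - E [|grad phi|^2 |grad psi|^2 - <grad phi, grad psi>^2] / 3,
   where Z = (Hess psi) grad phi - (Hess phi) grad psi, K = - (4 - Laplacian)^-1 div Z and
   w = (Z - grad K) / 2, so that div w = - 2 K.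
   The upper bound couples exp_mu (s phi), read at x, with exp_mu (t psi), read at eta x, where
   eta moves x by s t w to leading order and has an explicit Jacobian.  The lower bound is weak
   duality with the potentials exp (- alpha) and exp (- beta), beta being a conjugate of alpha
   for the cost r^2 + r^4 / 6 (note cos r <= exp (- (r^2 + r^4 / 6) / 2)); alpha is
   2 s phi - 2 t psi plus a second-order correction that makes the duality gap along the
   coupling O (tau^5).  Hence Sec = 3 kappa / Lambda.
   For phi = e_k and psi = e_l, Lambda = (|k|^2 + 4) (|l|^2 + 4).  The upper bound follows from
   E [|w|^2 + K^2] <= E |Z|^2 / 4 and sup bounds on the derivatives, the lower bound from
   E [(d_p e_k)^2 (d_q e_l)^2] <= (3/2)^n k_p^2 l_q^2, a product of one-dimensional means. *)

(* The bracket in Sec is divided by s^2 t^2, so HK^2 is needed up to O (tau^5) although no optimal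
   coupling is explicit: a coupling and a pair of potentials must agree to that order. The pair (w,
   K) comes from the coupling. For any field w, integration by parts turns the s^2 t^2 terms that
   the shift by s t w adds to minus half of the cost into E
   [<Z, w> / 2 - |w|^2 / 2 - (div w)^2 / 8], the last term being due to the square root of the
   Jacobian. The maximizer solves w = Z / 2 + grad (div w) / 4; with K = - (div w) / 2 this becomes
   the two formulas for w and K, and the maximum is E [|w|^2 + K^2] / 2. The potentials can match
   because they are nearly stationary along the coupling: third-order errors in the displacement and
   in the balance of masses enter the gap only through products with other small quantities, so
   second-order potentials suffice. All functions involved are trigonometric polynomials, a class
   closed under products, derivatives and the inverse of 4 - Laplacian, so remainders are uniform in
   x and no regularity theory enters. *)
From HB Require Import structures.
Require Import Defs.
From mathcomp Require Import all_boot all_order all_algebra generic_quotient ring_quotient.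
From mathcomp Require Import all_classical all_reals all_analysis measurable_realfun.
From mathcomp Require Import zify ring lra.
Set Implicit Arguments.
Unset Strict Implicit.
Unset Printing Implicit Defensive.
Import Order.TTheory GRing.Theory Num.Theory.
Import numFieldNormedType.Exports HBSimple HBNNSimple.
Local Open Scope classical_set_scope.
Local Open Scope quotient_scope.
Local Open Scope ring_scope.

(** * Elementary inequalities *)

Section Scalar.
Context {R : realType}.
Implicit Types x y u : R.

(** Most Taylor bounds below arise by integration: the derivative of the difference of the two sides
    is a difference handled one step before. *)
Lemma le_from0 (f df : R -> R) x : 0 <= x ->
  (forall y, is_derive y 1 f (df y)) /\
  (forall y, 0 <= y -> y <= x -> 0 <= df y) -> f 0 <= f x.
Proof.
move=> x0 [fd df0].
have [|y] := @MVT_segment _ f df 0 x x0.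
  by apply: derivable_within_continuous => y _; have [] := fd y.
rewrite in_itv /= subr0 => /andP[y0 yx] e.
by rewrite -subr_ge0 e mulr_ge0 // df0.
Qed.

Lemma sin_le_id x : 0 <= x -> sin x <= x.
Proof.
move=> x0; have := @le_from0 (fun y => y - sin y) (fun y => 1 - cos y) x x0.
rewrite sin0 subr0 subr_ge0; apply; split => [y|y _ _]; last by rewrite subr_ge0 cos_le1.
by apply: is_derive_eq; rewrite ?scaler1.
Qed.

Lemma cos_ge2 x : 0 <= x -> 1 - x ^+ 2 / 2 <= cos x.
Proof.
move=> x0; have := @le_from0 (fun y => cos y - (1 - y ^+ 2 / 2)) (fun y => y - sin y) x x0.
rewrite cos0 expr0n /= mul0r subr0 subrr subr_ge0.
apply; split => [y|y y0 _]; last by rewrite subr_ge0 sin_le_id.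
by apply: is_derive_eq; rewrite /= /GRing.scale /=; field.
Qed.

Lemma sin_ge3 x : 0 <= x -> x - x ^+ 3 / 6 <= sin x.
Proof.
move=> x0; have := @le_from0 (fun y => sin y - (y - y ^+ 3 / 6))
  (fun y => cos y - (1 - y ^+ 2 / 2)) x x0.
rewrite sin0 expr0n /= mul0r !subr0 subr_ge0.
apply; split => [y|y y0 _]; last by rewrite subr_ge0 cos_ge2.
by apply: is_derive_eq; rewrite /= /GRing.scale /=; field.
Qed.

Lemma cos_le4 x : 0 <= x -> cos x <= 1 - x ^+ 2 / 2 + x ^+ 4 / 24.
Proof.
move=> x0; have := @le_from0 (fun y => 1 - y ^+ 2 / 2 + y ^+ 4 / 24 - cos y)
  (fun y => sin y - (y - y ^+ 3 / 6)) x x0.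
rewrite cos0 !expr0n /= !mul0r !subr0 addr0 subrr subr_ge0.
apply; split => [y|y y0 _]; last by rewrite subr_ge0 sin_ge3.
by apply: is_derive_eq; rewrite /= /GRing.scale /=; field.
Qed.

(** The last coefficient is deliberately crude, since only the order of the remainder matters
    later. *)
Lemma sin_le5 x : 0 <= x -> sin x <= x - x ^+ 3 / 6 + x ^+ 5 / 5.
Proof.
move=> x0; have := @le_from0 (fun y => y - y ^+ 3 / 6 + y ^+ 5 / 5 - sin y)
  (fun y => 1 - y ^+ 2 / 2 + y ^+ 4 - cos y) x x0.
rewrite sin0 !expr0n /= !mul0r !subr0 addr0 subr_ge0.
apply; split => [y|y y0 _].
  by apply: is_derive_eq; rewrite /= /GRing.scale /=; field.
have p : 0 <= y ^+ 4 by rewrite exprn_ge0.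
by have := cos_le4 y0; lra.
Qed.

Lemma cos_ge6 x : 0 <= x -> 1 - x ^+ 2 / 2 + x ^+ 4 / 24 - x ^+ 6 / 6 <= cos x.
Proof.
move=> x0; have := @le_from0
  (fun y => cos y - (1 - y ^+ 2 / 2 + y ^+ 4 / 24 - y ^+ 6 / 6))
  (fun y => y - y ^+ 3 / 6 + y ^+ 5 - sin y) x x0.
rewrite cos0 !expr0n /= !mul0r !subr0 addr0 subrr subr_ge0.
apply; split => [y|y y0 _].
  by apply: is_derive_eq; rewrite /= /GRing.scale /=; field.
have p : 0 <= y ^+ 5 by rewrite exprn_ge0.
by have := sin_le5 y0; lra.
Qed.

Lemma cos_sqrt_taylor u : 0 <= u ->
  `|cos (Num.sqrt u) - (1 - u / 2 + u ^+ 2 / 24)| <= u ^+ 3.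
Proof.
move=> u0; have s0 := sqrtr_ge0 u.
have := cos_le4 s0; have := cos_ge6 s0.
have -> : Num.sqrt u ^+ 4 = u ^+ 2 by rewrite (exprM _ 2 2) sqr_sqrtr.
have -> : Num.sqrt u ^+ 6 = u ^+ 3 by rewrite (exprM _ 2 3) sqr_sqrtr.
rewrite sqr_sqrtr // => h1 h2; rewrite ler_norml.
have h3 : 0 <= u ^+ 3 by rewrite exprn_ge0.
by apply/andP; split; lra.
Qed.

(** The exponent is the Taylor polynomial of log cos to order 4. The quotient of the two sides is
    non-increasing on [0, pi] because sin r >= (r + r^3 / 3) cos r, the form of tan r >= r + r^3 / 3
    that survives beyond pi / 2. *)
Lemma cos_le_exp (r : R) : 0 <= r <= pi -> cos r <= expR (- (r ^+ 2 / 2 + r ^+ 4 / 12)).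
Proof.
move=> /andP[r0 rpi].
have h1 y : 0 <= y -> y <= pi -> 0 <= sin y - y * cos y.
  move=> y0 ypi; have := @le_from0 (fun z => sin z - z * cos z) (fun z => z * sin z) y y0.
  rewrite sin0 mul0r subrr; apply; split => [z|z z0 zy].
    by apply: is_derive_eq; rewrite /= /GRing.scale /=; ring.
  by rewrite mulr_ge0 // sin_ge0_pi // z0 (le_trans zy).
have h2 y : 0 <= y -> y <= pi -> 0 <= sin y - (y + y ^+ 3 / 3) * cos y.
  move=> y0 ypi; have := @le_from0 (fun z => sin z - (z + z ^+ 3 / 3) * cos z)
    (fun z => z * (sin z - z * cos z) + z ^+ 3 / 3 * sin z) y y0.
  rewrite sin0 expr0n /= !mul0r addr0 mul0r subrr; apply; split => [z|z z0 zy].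
    by apply: is_derive_eq; rewrite /= /GRing.scale /=; field.
  have zpi : z <= pi by rewrite (le_trans zy).
  by rewrite addr_ge0 ?mulr_ge0 ?exprn_ge0 ?invr_ge0 ?h1 ?sin_ge0_pi ?z0 ?zpi.
have := @le_from0 (fun z => - (cos z * expR (z ^+ 2 / 2 + z ^+ 4 / 12)))
  (fun z => expR (z ^+ 2 / 2 + z ^+ 4 / 12) * (sin z - (z + z ^+ 3 / 3) * cos z)) r r0.
rewrite cos0 !expr0n /= !mul0r addr0 expR0 mulr1 lerN2 expRN => h.
rewrite -[leRHS]mul1r ler_pdivlMr ?expR_gt0 //; apply: h; split => [z|z z0 zr].
  by apply: is_derive_eq; rewrite /= /GRing.scale /=; field.
by rewrite mulr_ge0 ?expR_ge0 // h2 // (le_trans zr).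
Qed.

Lemma atan_taylor x : 0 <= x -> `|atan x - (x - x ^+ 3 / 3)| <= x ^+ 5.
Proof.
move=> x0.
have d1 y : 1 + y ^+ 2 != 0 :> R by rewrite gt_eqF // ltr_wpDr ?sqr_ge0.
have dd y : (1 + y ^+ 2) * (1 + y ^+ 2)^-1 = 1 :> R by rewrite mulfV.
have p1 y : 0 <= (1 + y ^+ 2)^-1 :> R by rewrite invr_ge0 addr_ge0 ?sqr_ge0.
have h1 := @le_from0 (fun y => atan y - (y - y ^+ 3 / 3))
  (fun y => (1 + y ^+ 2)^-1 - (1 - y ^+ 2)) x x0.
have h2 := @le_from0 (fun y => y - y ^+ 3 / 3 + y ^+ 5 / 5 - atan y)
  (fun y => 1 - y ^+ 2 + y ^+ 4 - (1 + y ^+ 2)^-1) x x0.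
have {}h1 : x - x ^+ 3 / 3 <= atan x.
  move: h1; rewrite atan0 expr0n /= mul0r !subr0 subr_ge0; apply; split => [y|y y0 yx].
    by apply: is_derive_eq; rewrite /= /GRing.scale /=; field; exact: d1.
  have -> : (1 + y ^+ 2)^-1 - (1 - y ^+ 2) = y ^+ 4 * (1 + y ^+ 2)^-1 by field; exact: d1.
  by rewrite mulr_ge0 // exprn_ge0.
have {}h2 : atan x <= x - x ^+ 3 / 3 + x ^+ 5 / 5.
  move: h2; rewrite atan0 !expr0n /= !mul0r !subr0 addr0 subr_ge0; apply; split => [y|y y0 yx].
    by apply: is_derive_eq; rewrite /= /GRing.scale /=; field; exact: d1.
  have -> : 1 - y ^+ 2 + y ^+ 4 - (1 + y ^+ 2)^-1 = y ^+ 6 * (1 + y ^+ 2)^-1 by field; exact: d1.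
  by rewrite mulr_ge0 // exprn_ge0.
have h3 : 0 <= x ^+ 5 by rewrite exprn_ge0.
by rewrite ler_norml; apply/andP; split; lra.
Qed.

(** The square of v differs from 1 + u by u^3 (1 / 8 - u / 64) exactly; dividing by s + v isolates s
    - v. *)
Lemma sqrt1D_taylor u : `|u| <= 1 / 2 ->
  `|Num.sqrt (1 + u) - (1 + u / 2 - u ^+ 2 / 8)| <= `|u| ^+ 3.
Proof.
rewrite ler_norml => /andP[u1 u2].
set v := 1 + u / 2 - u ^+ 2 / 8; set s := Num.sqrt (1 + u).
have s0 : 0 <= s by exact: sqrtr_ge0.
have s2 : s ^+ 2 = 1 + u by rewrite sqr_sqrtr //; lra.
have v0 : 1 / 2 <= v by rewrite /v; nra.
have e : (s - v) * (s + v) = u ^+ 3 * (1 / 8 - u / 64) by rewrite -subr_sqr s2 /v; field.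
have sv : 1 / 2 <= s + v by lra.
have ne : s + v != 0 by rewrite gt_eqF //; lra.
have -> : s - v = u ^+ 3 * ((1 / 8 - u / 64) / (s + v)) by rewrite mulrA -e mulfK.
rewrite normrM normrX ler_piMr // ?exprn_ge0 // normf_div ler_pdivrMr ?normr_gt0 // mul1r.
by rewrite !ger0_norm; lra.
Qed.

Lemma exp_taylor u : `|u| <= 1 -> `|expR u - (1 + u + u ^+ 2 / 2)| <= `|u| ^+ 3.
Proof.
have d (a b c e : R) (y : R) :
    is_derive y 1 (fun z => a + b * z + c * z ^+ 2 + e * z ^+ 3) (b + 2 * c * y + 3 * e * y ^+ 2).
  by apply: is_derive_eq; rewrite /= /GRing.scale /=; ring.
have n1 x : 0 <= x -> 1 - x <= expR (- x) by move=> x0; exact: expR_ge1Dx.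
have n2 x : 0 <= x -> expR (- x) <= 1 - x + x ^+ 2 / 2.
  move=> x0; have := @le_from0 (fun y => 1 - y + y ^+ 2 / 2 - expR (- y))
    (fun y => expR (- y) - (1 - y)) x x0.
  rewrite oppr0 expR0 !expr0n /= !mul0r ?oppr0 !addr0 subrr subr_ge0; apply; split => [y|y y0 _].
    by apply: is_derive_eq; rewrite /= /GRing.scale /=; field.
  by rewrite subr_ge0 n1.
have n3 x : 0 <= x -> 1 - x + x ^+ 2 / 2 - x ^+ 3 / 6 <= expR (- x).
  move=> x0; have := @le_from0 (fun y => expR (- y) - (1 - y + y ^+ 2 / 2 - y ^+ 3 / 6))
    (fun y => 1 - y + y ^+ 2 / 2 - expR (- y)) x x0.
  rewrite oppr0 expR0 !expr0n /= !mul0r ?oppr0 !addr0 subrr subr_ge0; apply; split => [y|y y0 _].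
    by apply: is_derive_eq; rewrite /= /GRing.scale /=; field.
  by rewrite subr_ge0 n2.
(* By [n3] at 1, exp (-1) >= 1/3. This crude bound on [0, 1] seeds [p1], [p2] and [p3], each
   integrated from the one before. *)
have p0 x : 0 <= x -> x <= 1 -> expR x <= 4.
  move=> x0 x1; have h : expR x <= expR 1 by rewrite ler_expR.
  apply: (le_trans h); have := n3 1 ler01; rewrite expRN !expr1n => h1.
  have e0 := expR_gt0 (1 : R); have ee : expR 1 * (expR 1)^-1 = 1 :> R by rewrite mulfV ?gt_eqF.
  by nra.
have p1 x : 0 <= x -> x <= 1 -> expR x <= 1 + 4 * x.
  move=> x0 x1; have := @le_from0 (fun y => 1 + 4 * y - expR y) (fun y => 4 - expR y) x x0.
  rewrite expR0 mulr0 addr0 subrr subr_ge0; apply; split => [y|y y0 yx].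
    by apply: is_derive_eq; rewrite /= /GRing.scale /=; ring.
  by rewrite subr_ge0 p0 // (le_trans yx).
have p2 x : 0 <= x -> x <= 1 -> expR x <= 1 + x + 2 * x ^+ 2.
  move=> x0 x1; have := @le_from0 (fun y => 1 + y + 2 * y ^+ 2 - expR y)
    (fun y => 1 + 4 * y - expR y) x x0.
  rewrite expR0 expr0n /= mulr0 !addr0 subrr subr_ge0; apply; split => [y|y y0 yx].
    by apply: is_derive_eq; rewrite /= /GRing.scale /=; ring.
  by rewrite subr_ge0 p1 // (le_trans yx).
have p3 x : 0 <= x -> x <= 1 -> expR x <= 1 + x + x ^+ 2 / 2 + x ^+ 3 * (2 / 3).
  move=> x0 x1; have := @le_from0 (fun y => 1 + y + y ^+ 2 / 2 + y ^+ 3 * (2 / 3) - expR y)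
    (fun y => 1 + y + 2 * y ^+ 2 - expR y) x x0.
  rewrite expR0 !expr0n /= !mul0r !addr0 subrr subr_ge0; apply; split => [y|y y0 yx].
    by apply: is_derive_eq; rewrite /= /GRing.scale /=; field.
  by rewrite subr_ge0 p2 // (le_trans yx).
have q2 x : 0 <= x -> 1 + x + x ^+ 2 / 2 <= expR x.
  move=> x0; have := @le_from0 (fun y => expR y - (1 + y + y ^+ 2 / 2))
    (fun y => expR y - (1 + y)) x x0.
  rewrite expR0 !expr0n /= !mul0r !addr0 subrr subr_ge0; apply; split => [y|y y0 _].
    by apply: is_derive_eq; rewrite /= /GRing.scale /=; field.
  by rewrite subr_ge0 expR_ge1Dx.
move=> u1; have [u0|u0] := leP 0 u.
  move: u1; rewrite (ger0_norm u0) => u1; have := p3 _ u0 u1; have := q2 _ u0.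
  have u3 : 0 <= u ^+ 3 by rewrite exprn_ge0.
  by rewrite ler_norml => *; apply/andP; split; lra.
have u0' : 0 <= - u by lra.
have u3 : 0 <= (- u) ^+ 3 by rewrite exprn_ge0.
have := n2 _ u0'; have := n3 _ u0'; rewrite opprK (ltr0_norm u0).
have -> : (- u) ^+ 2 = u ^+ 2 by ring.
by rewrite ler_norml => *; apply/andP; split; lra.
Qed.

Lemma norm_sin_le x : `|sin x| <= `|x|.
Proof.
wlog x0 : x / 0 <= x.
  move=> h; have [/h//|x0] := leP 0 x.
  by have := h (- x); rewrite sinN !normrN; apply; lra.
rewrite (ger0_norm x0) ler_norml sin_le_id // andbT.
have h := @le_from0 (fun y => sin y + y) (fun y => cos y + 1) x x0.
rewrite -subr_ge0 opprK; move: h; rewrite sin0 add0r; apply; split => [y|y _ _].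
  by apply: is_derive_eq.
by have := cos_geN1 y; lra.
Qed.

Lemma cos_lip1 x h : `|cos (x + h) - cos x| <= `|h|.
Proof.
have -> : cos (x + h) - cos x = - 2 * sin (x + h / 2) * sin (h / 2).
  have e1 : x + h = (x + h / 2) + h / 2 by field.
  have e2 : cos x = cos ((x + h / 2) - h / 2) by congr cos; ring.
  by rewrite e1 e2 cosD cosB; ring.
rewrite !normrM normrN (@ger0_norm _ 2) //.
have a := sin_max (x + h / 2); have b := norm_sin_le (h / 2).
have c : `|h / 2| = `|h| / 2 by rewrite normrM (@ger0_norm _ (2^-1)) // invr_ge0.
rewrite c in b.
by have := ler_pM (normr_ge0 _) (normr_ge0 _) a b => H; lra.
Qed.

Lemma cos_taylor1 x h : `|cos (x + h) - cos x + sin x * h| <= h ^+ 2.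
Proof.
have e : cos (x + h) - cos x + sin x * h = cos x * (cos h - 1) - sin x * (sin h - h).
  by rewrite cosD; ring.
have a : `|cos h - 1| <= h ^+ 2 / 2.
  wlog h0 : h {e} / 0 <= h.
    move=> H; have [/H//|h0] := leP 0 h.
    by have := H (- h); rewrite cosN sqrrN; apply; lra.
  have := cos_ge2 h0; have := cos_le1 h; rewrite ler_norml => *; apply/andP; split; nra.
have b : `|sin h - h| <= h ^+ 2 / 2.
  wlog h0 : h {e a} / 0 <= h.
    move=> H; have [/H//|h0] := leP 0 h.
    by have := H (- h); rewrite sinN sqrrN -opprD normrN; apply; lra.
  (* For h > 3 the cubic bound is too weak, but then h - sin h <= h + 1 <= h^2 / 2. *)
  have [h1|h1] := leP h 3.
    by have := sin_ge3 h0; have := sin_le_id h0; rewrite ler_norml => *; apply/andP; split; nra.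
  by have := sin_geN1 h; have := sin_le_id h0; rewrite ler_norml => *; apply/andP; split; nra.
rewrite e (le_trans (ler_normB _ _)) // !normrM.
have := ler_pM (normr_ge0 _) (normr_ge0 _) (cos_max x) a.
by have := ler_pM (normr_ge0 _) (normr_ge0 _) (sin_max x) b; lra.
Qed.

End Scalar.

(** * Asymptotic calculus in two small parameters *)

Section BigO.
Context {R : realType} {X : Type}.
Implicit Types (f g u : R * R * X -> R) (P Q : R * R * X -> Prop) (i : R * R * X).

Definition stsize i : R := i.1.1 + i.1.2.

(* The last component of i is a parameter: all asymptotic statements are uniform in it. *)
Definition ev P : Prop := exists2 e : R, 0 < e &
  forall i, 0 < i.1.1 -> 0 < i.1.2 -> stsize i <= e -> P i.

(** A class, so that instance resolution adds orders over products, takes minima over sums, and uses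
    expansions found in the context as leaves. *)
Class isO (k : nat) f : Prop :=
  isO_ev : exists2 C : R, 0 <= C & ev (fun i => `|f i| <= C * stsize i ^+ k).

Lemma ev_stsize (e : R) : 0 < e ->
  ev (fun i => [/\ 0 < i.1.1, 0 < i.1.2, 0 <= stsize i & stsize i <= e]).
Proof. by move=> e0; exists e => // i s0 t0 ie; split=> //; rewrite addr_ge0 ?ltW. Qed.

Lemma ev_imp P Q : (forall i, P i -> Q i) -> ev P -> ev Q.
Proof. by move=> PQ [e e0 H]; exists e => // i s0 t0 ie; apply/PQ/H. Qed.

Lemma ev_and P Q : ev P -> ev Q -> ev (fun i => P i /\ Q i).
Proof.
move=> [e e0 H] [e' e0' H']; exists (Num.min e e'); first by rewrite lt_min e0.
by move=> i s0 t0; rewrite le_min => /andP[? ?]; split; [apply: H|apply: H'].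
Qed.

Lemma ev_all (T : finType) (P : T -> R * R * X -> Prop) :
  (forall p, ev (P p)) -> ev (fun i => forall p, P p i).
Proof.
move=> H; suff [e e0 He] : ev (fun i => forall p, p \in enum T -> P p i).
  by exists e => // i s0 t0 ie p; apply: He => //; rewrite mem_enum.
elim: (enum T) => [|p r IH]; first by exists 1.
apply: ev_imp (ev_and (H p) IH) => i [h1 h2] q; rewrite inE => /predU1P[->//|].
exact: h2.
Qed.

Lemma isO_near k f g : ev (fun i => f i = g i) -> isO k g -> isO k f.
Proof.
move=> fg [C C0 H]; exists C => //.
by apply: ev_imp (ev_and fg H) => i [->].
Qed.

Lemma isO_eq k f g : (forall i, f i = g i) -> isO k g -> isO k f.
Proof. by move=> fg; apply: isO_near; exists 1. Qed.

Lemma isO_le k f g : (forall i, `|f i| <= `|g i|) -> isO k g -> isO k f.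
Proof.
move=> fg [C C0 H]; exists C => //.
by apply: ev_imp H => i; apply: le_trans.
Qed.

Lemma isO_near_le k f g : ev (fun i => `|f i| <= `|g i|) -> isO k g -> isO k f.
Proof.
move=> fg [C C0 H]; exists C => //.
by apply: ev_imp (ev_and fg H) => i []; apply: le_trans.
Qed.

Lemma isO_weak k j f : isO k f -> (j <= k)%N -> isO j f.
Proof.
move=> [C C0 H] jk; exists C => //.
apply: ev_imp (ev_and (ev_stsize ltr01) H) => i [[s0 t0 i0 i1] /le_trans]; apply.
by rewrite ler_wpM2l // ler_wiXn2l.
Qed.

Global Instance isO_cst (c : R) : isO 0 (fun=> c) | 3.
Proof. by exists `|c| => //; exists 1 => // i _ _ _; rewrite mulr1. Qed.

Lemma isO_zero k : isO k (fun=> 0).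
Proof. by exists 0 => //; exists 1 => // i _ _ _; rewrite normr0 mul0r. Qed.

Lemma isO_ub c f : (forall i, `|f i| <= c) -> isO 0 f.
Proof.
move=> H; exists (Num.max 0 c); first by rewrite le_max lexx.
by exists 1 => // i _ _ _; rewrite mulr1 (le_trans (H i)) // le_max lexx orbT.
Qed.

Global Instance isO_s : isO 1 (fun i => i.1.1) | 2.
Proof.
exists 1 => //; exists 1 => // i s0 t0 _.
by rewrite mul1r expr1 gtr0_norm // lerDl ltW.
Qed.

Global Instance isO_t : isO 1 (fun i => i.1.2) | 2.
Proof.
exists 1 => //; exists 1 => // i s0 t0 _.
by rewrite mul1r expr1 gtr0_norm // lerDr ltW.
Qed.

Global Instance isO_opp k f : isO k f -> isO k (fun i => - f i) | 1.
Proof. by apply: isO_le => i; rewrite normrN. Qed.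

Global Instance isO_add j k f g : isO j f -> isO k g -> isO (minn j k) (fun i => f i + g i) | 1.
Proof.
move=> /isO_weak/(_ (geq_minl j k)) [C C0 H] /isO_weak/(_ (geq_minr j k)) [D D0 K].
exists (C + D); first by rewrite addr_ge0.
apply: ev_imp (ev_and H K) => i [h h'].
by rewrite mulrDl (le_trans (ler_normD _ _)) // lerD.
Qed.

Global Instance isO_mul j k f g : isO j f -> isO k g -> isO (j + k)%N (fun i => f i * g i) | 1.
Proof.
move=> [C C0 H] [D D0 K]; exists (C * D); first by rewrite mulr_ge0.
apply: ev_imp (ev_and H K) => i [h h'].
by rewrite normrM exprD mulrACA ler_pM.
Qed.

Global Instance isO_X k m f : isO k f -> isO (m * k)%N (fun i => f i ^+ m) | 1.
Proof.
move=> [C C0 H]; exists (C ^+ m); first by rewrite exprn_ge0.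
apply: ev_imp H => i h.
by rewrite normrX mulnC exprM -exprMn lerXn2r // nnegrE (le_trans _ h).
Qed.

Global Instance isO_sum k (T : finType) (F : T -> R * R * X -> R) :
  (forall p, isO k (F p)) -> isO k (fun i => \sum_p F p i) | 1.
Proof.
move=> H; elim: (index_enum T) => [|p r IH].
  by exists 0 => //; exists 1 => // i _ _ _; rewrite big_nil normr0 mul0r.
apply: (isO_eq (g := fun i => F p i + \sum_(q <- r) F q i)) => [i|].
  by rewrite big_cons.
by rewrite -(minnn k); apply: isO_add.
Qed.

Lemma isO_small k f e : (0 < k)%N -> 0 < e -> isO k f -> ev (fun i => `|f i| <= e).
Proof.
move=> k0 e0 /isO_weak/(_ k0) [C C0 H].
have C1 : 0 < C + 1 by rewrite ltr_wpDl.
apply: ev_imp (ev_and (ev_stsize (divr_gt0 e0 C1)) H) => i [[s0 t0 i0 ie] /le_trans]; apply.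
rewrite expr1; have : (C + 1) * stsize i <= e by rewrite mulrC -ler_pdivlMr.
by apply: le_trans; rewrite ler_wpM2r // lerDl.
Qed.

Lemma isO_inv k f : (0 < k)%N -> isO k f -> isO 0 (fun i => (1 + f i)^-1).
Proof.
move=> k0 H; exists 2 => //.
have h : 0 < 1 / 2 :> R by lra.
apply: ev_imp (isO_small k0 h H) => i; rewrite ler_norml => /andP[a b].
by rewrite mulr1 ger0_norm ?invr_ge0; [rewrite invf_ple ?posrE; lra|lra].
Qed.

Lemma isO_sqrt1D k u : (0 < k)%N -> isO k u ->
  isO (3 * k)%N (fun i => Num.sqrt (1 + u i) - (1 + u i / 2 - u i ^+ 2 / 8)).
Proof.
move=> k0 H; apply: isO_near_le (isO_X 3 H).
have h : 0 < 1 / 2 :> R by lra.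
by apply: ev_imp (isO_small k0 h H) => i /sqrt1D_taylor; rewrite normrX.
Qed.

Lemma isO_exp k u : (0 < k)%N -> isO k u ->
  isO (3 * k)%N (fun i => expR (u i) - (1 + u i + u i ^+ 2 / 2)).
Proof.
move=> k0 H; apply: isO_near_le (isO_X 3 H).
by apply: ev_imp (isO_small k0 ltr01 H) => i /exp_taylor; rewrite normrX.
Qed.

Lemma isO_cos_sqrt k u : (forall i, 0 <= u i) -> isO k u ->
  isO (3 * k)%N (fun i => cos (Num.sqrt (u i)) - (1 - u i / 2 + u i ^+ 2 / 24)).
Proof.
move=> u0 H; apply: isO_le (isO_X 3 H) => i.
by rewrite normrX (ger0_norm (u0 i)) cos_sqrt_taylor.
Qed.

(** Uniformity in the parameter allows it to be replaced by any function of i, for instance by an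
    end point of the coupling. *)
Lemma isO_comp k f (h : R * R * X -> X) :
  isO k f -> isO k (fun i => f (i.1, h i)).
Proof.
move=> [C C0 [e e0 H]]; exists C => //; exists e => // i s0 t0 ie.
exact: (H (i.1, h i)).
Qed.

(* Not a class, so that instance resolution does not fire before [bigO] is called. *)
Definition bigOh := isO.

Lemma isO_by k g f : (forall i, f i = g i) -> bigOh k g -> isO k f.
Proof. exact: isO_eq. Qed.

End BigO.

(** Resolution finds some order for the expression, and [reflexivity] checks by computation that it
    is large enough. Expansions already proved must be hypotheses, which is why they are named
    before each call. *)
Ltac bigO := unfold bigOh; eapply isO_weak; [typeclasses eauto | reflexivity].

(** Here [e] regroups the function into quantities of known order; the goal left over is that
    algebraic identity. *)
Ltac asO e := refine (isO_by (g := e) _ _); [ | bigO].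

(** * Trigonometric polynomials *)

(** Lagrange's identity: the double sum of squares is twice the difference of the two sides. *)
Lemma cauchy_schwarz_sum (R : realDomainType) (I : finType) (a b : I -> R) :
  (\sum_p a p * b p) ^+ 2 <= (\sum_p a p ^+ 2) * (\sum_p b p ^+ 2).
Proof.
have h : 0 <= \sum_p \sum_q (a p * b q - a q * b p) ^+ 2.
  by apply: sumr_ge0 => p _; apply: sumr_ge0 => q _; exact: sqr_ge0.
suff e : \sum_p \sum_q (a p * b q - a q * b p) ^+ 2 =
    2 * ((\sum_p a p ^+ 2) * (\sum_p b p ^+ 2)) - 2 * (\sum_p a p * b p) ^+ 2.
  by move: h; rewrite e; lra.
under eq_bigr => p _.
  under eq_bigr => q _.
    rewrite (_ : _ ^+ 2 = a p ^+ 2 * b q ^+ 2 + b p ^+ 2 * a q ^+ 2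
      - 2 * (a p * b p) * (a q * b q)); last by ring.
  over.
  rewrite sumrB big_split /= -!mulr_sumr; over.
rewrite sumrB big_split /= -!mulr_suml -mulr_sumr; ring.
Qed.

Section TrigPoly.
Context {R : realType} {n : nat}.
Implicit Types (m : 'rV[int]_n) (x y h : 'rV[R]_n) (T : seq (R * 'rV[int]_n * R)).

Definition phase m x : R := \sum_p (m 0 p)%:~R * x 0 p.

(* The list of triples (a, m, c) stands for the sum of the a cos (m . x + c). *)
Definition teval T x : R := \sum_(c <- T) c.1.1 * cos (phase c.1.2 x + c.2).

(* The derivative turns cos into - sin = cos (. + pi / 2). *)
Definition tD (p : 'I_n) T : seq (R * 'rV[int]_n * R) :=
  [seq (c.1.1 * ((c.1.2 : 'rV[int]_n) 0 p)%:~R, c.1.2, c.2 + pi / 2) | c <- T].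
Definition tscale (a : R) T : seq (R * 'rV[int]_n * R) :=
  [seq (a * c.1.1, c.1.2, c.2) | c <- T].
Definition tmul1 (c d : R * 'rV[int]_n * R) : seq (R * 'rV[int]_n * R) :=
  [:: (c.1.1 * d.1.1 / 2, c.1.2 + d.1.2, c.2 + d.2);
      (c.1.1 * d.1.1 / 2, c.1.2 - d.1.2, c.2 - d.2)].
Definition tmul T T' : seq (R * 'rV[int]_n * R) :=
  flatten [seq flatten [seq tmul1 c d | d <- T'] | c <- T].
Definition tsum (F : 'I_n -> seq (R * 'rV[int]_n * R)) : seq (R * 'rV[int]_n * R) :=
  flatten [seq F p | p <- index_enum 'I_n].
Definition fnorm2 m : R := \sum_p (m 0 p)%:~R ^+ 2.
(* (4 - Laplacian)^-1 *)
Definition tresolvent T : seq (R * 'rV[int]_n * R) :=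
  [seq (c.1.1 / (4 + fnorm2 c.1.2), c.1.2, c.2) | c <- T].

Lemma phaseD m x y : phase m (x + y) = phase m x + phase m y.
Proof. by rewrite -big_split /=; apply: eq_bigr => p _; rewrite mxE mulrDr. Qed.

Lemma phaseDl m m' x : phase (m + m') x = phase m x + phase m' x.
Proof. by rewrite -big_split /=; apply: eq_bigr => p _; rewrite mxE intrD mulrDl. Qed.

Lemma phaseNl m x : phase (- m) x = - phase m x.
Proof. by rewrite -sumrN; apply: eq_bigr => p _; rewrite mxE intrN mulNr. Qed.

Lemma phase0l x : phase 0 x = 0.
Proof. by apply: big1 => p _; rewrite mxE mul0r. Qed.

Lemma phase_delta m p (a : R) : phase m (a *: delta_mx 0 p) = (m 0 p)%:~R * a.
Proof.
rewrite /phase (bigD1 p) //= big1 ?addr0; first by rewrite !mxE !eqxx mulr1.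
by move=> q qp; rewrite !mxE /= (negPf qp) !mulr0.
Qed.

Lemma teval_nil x : teval [::] x = 0. Proof. exact: big_nil. Qed.

Lemma teval_cons c T x : teval (c :: T) x = c.1.1 * cos (phase c.1.2 x + c.2) + teval T x.
Proof. exact: big_cons. Qed.

Lemma teval_cat T T' x : teval (T ++ T') x = teval T x + teval T' x.
Proof. exact: big_cat. Qed.

Lemma teval_scale a T x : teval (tscale a T) x = a * teval T x.
Proof. by rewrite /teval big_map mulr_sumr; apply: eq_bigr => c _; rewrite /= mulrA. Qed.

Lemma teval_flatten (I : Type) (s : seq I) (F : I -> seq (R * 'rV[int]_n * R)) x :
  teval (flatten [seq F i | i <- s]) x = \sum_(i <- s) teval (F i) x.
Proof. by rewrite /teval big_flatten big_map. Qed.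

Lemma teval_sum (F : 'I_n -> seq (R * 'rV[int]_n * R)) x : teval (tsum F) x = \sum_p teval (F p) x.
Proof. exact: teval_flatten. Qed.

Lemma tmul1E (c d : R * 'rV[int]_n * R) x : teval (tmul1 c d) x =
  c.1.1 * cos (phase c.1.2 x + c.2) * (d.1.1 * cos (phase d.1.2 x + d.2)).
Proof.
rewrite !teval_cons teval_nil /= !phaseDl phaseNl.
rewrite (_ : _ + _ + (_ + _) = (phase c.1.2 x + c.2) + (phase d.1.2 x + d.2)); last by ring.
rewrite (_ : _ - _ + (_ - _) = (phase c.1.2 x + c.2) - (phase d.1.2 x + d.2)); last by ring.
by rewrite cosD cosB; field.
Qed.

Lemma teval_mul T T' x : teval (tmul T T') x = teval T x * teval T' x.
Proof.
rewrite teval_flatten {2}/teval mulr_suml; apply: eq_bigr => c _.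
rewrite teval_flatten mulr_sumr; apply: eq_bigr => d _.
exact: tmul1E.
Qed.

Lemma tD_cat p T T' : tD p (T ++ T') = tD p T ++ tD p T'.
Proof. exact: map_cat. Qed.

Lemma tD_flatten p (I : Type) (s : seq I) (F : I -> seq (R * 'rV[int]_n * R)) :
  tD p (flatten [seq F i | i <- s]) = flatten [seq tD p (F i) | i <- s].
Proof. by rewrite /tD map_flatten -map_comp. Qed.

Lemma tevalD_sum p (F : 'I_n -> seq (R * 'rV[int]_n * R)) x :
  teval (tD p (tsum F)) x = \sum_q teval (tD p (F q)) x.
Proof. by rewrite tD_flatten teval_flatten. Qed.

Lemma tevalD p T x :
  teval (tD p T) x = \sum_(c <- T) - (c.1.1 * (c.1.2 0 p)%:~R * sin (phase c.1.2 x + c.2)).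
Proof.
rewrite /teval big_map; apply: eq_bigr => c _ /=.
by rewrite addrA cosDpihalf mulrN.
Qed.

Lemma tevalD_scale p a T x : teval (tD p (tscale a T)) x = a * teval (tD p T) x.
Proof.
rewrite !tevalD big_map mulr_sumr; apply: eq_bigr => c _ /=; ring.
Qed.

Lemma tevalD_mul p T T' x :
  teval (tD p (tmul T T')) x =
  teval (tD p T) x * teval T' x + teval T x * teval (tD p T') x.
Proof.
have E S : teval S x = \sum_(c <- S) c.1.1 * cos (phase c.1.2 x + c.2) by [].
rewrite tD_flatten teval_flatten (tevalD p T) (E T) !mulr_suml -big_split /=.
apply: eq_bigr => c _.
rewrite tD_flatten teval_flatten (tevalD p T') (E T') !mulr_sumr -big_split /=.
apply: eq_bigr => d _.
rewrite -[[:: _; _]]/(tD p (tmul1 c d)) tevalD !big_cons big_nil /= !phaseDl phaseNl.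
rewrite (_ : _ + _ + (_ + _) = (phase c.1.2 x + c.2) + (phase d.1.2 x + d.2)); last by ring.
rewrite (_ : _ - _ + (_ - _) = (phase c.1.2 x + c.2) - (phase d.1.2 x + d.2)); last by ring.
by rewrite !mxE intrD intrB sinD sinB; field.
Qed.

Lemma tevalDC p q T x : teval (tD p (tD q T)) x = teval (tD q (tD p T)) x.
Proof.
rewrite !tevalD !big_map; apply: eq_bigr => c _ /=; ring.
Qed.

Lemma tevalDD p T x : teval (tD p (tD p T)) x =
  \sum_(c <- T) - ((c.1.2 0 p)%:~R ^+ 2 * (c.1.1 * cos (phase c.1.2 x + c.2))).
Proof.
rewrite tevalD big_map; apply: eq_bigr => c _ /=.
by rewrite addrA sinDpihalf; ring.
Qed.

Lemma fnorm2_ge0 m : 0 <= fnorm2 m.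
Proof. by apply: sumr_ge0 => p _; exact: sqr_ge0. Qed.

(** Each mode is an eigenfunction of 4 - Laplacian, with eigenvalue 4 + |m|^2 > 0; the zero
    frequency needs no exception. *)
Lemma tresolventE T x :
  4 * teval (tresolvent T) x - \sum_p teval (tD p (tD p (tresolvent T))) x = teval T x.
Proof.
have -> : \sum_p teval (tD p (tD p (tresolvent T))) x =
   \sum_(c <- T) - (fnorm2 c.1.2 * (c.1.1 / (4 + fnorm2 c.1.2) * cos (phase c.1.2 x + c.2))).
  under eq_bigr => p _ do rewrite tevalDD big_map.
  by rewrite exchange_big /=; apply: eq_bigr => c _; rewrite sumrN -mulr_suml.
rewrite /teval big_map mulr_sumr -sumrB; apply: eq_bigr => c _ /=.
field; rewrite gt_eqF //; have := fnorm2_ge0 c.1.2; lra.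
Qed.

Definition tbound T : R := \sum_(c <- T) `|c.1.1|.

Lemma teval_le T x : `|teval T x| <= tbound T.
Proof.
rewrite (le_trans (ler_norm_sum _ _ _)) // ler_sum // => c _.
by rewrite normrM ler_piMr // cos_max.
Qed.

Definition tbound2 T : R := \sum_(c <- T) `|c.1.1| * fnorm2 c.1.2.

(** A cosine contributes at most (m . h)^2 to the remainder, and Cauchy-Schwarz bounds this by |m|^2
    |h|^2, the weight in [tbound2]. There is no restriction on the size of h. *)
Lemma teval_taylor T x h :
  `|teval T (x + h) - teval T x - \sum_p teval (tD p T) x * h 0 p|
  <= tbound2 T * \sum_p h 0 p ^+ 2.
Proof.
have -> : \sum_p teval (tD p T) x * h 0 p =
    \sum_(c <- T) - (c.1.1 * (sin (phase c.1.2 x + c.2) * phase c.1.2 h)).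
  under eq_bigr => p _ do rewrite tevalD mulr_suml.
  rewrite exchange_big /=; apply: eq_bigr => c _.
  by rewrite !mulr_sumr -sumrN; apply: eq_bigr => p _; ring.
rewrite /teval -!sumrB (le_trans (ler_norm_sum _ _ _)) // mulr_suml ler_sum // => c _.
rewrite phaseD (addrAC (phase _ x)) opprK -mulrBr -mulrDr normrM -mulrA ler_wpM2l //.
rewrite (le_trans (cos_taylor1 _ _)) //.
exact: cauchy_schwarz_sum.
Qed.

(** Frequencies are integers, so a lattice shift moves every phase by a multiple of 2 pi. Hence
    [tev] does not depend on representatives. *)
Lemma teval_periodic T x y : (forall p, period_lattice (x 0 p - y 0 p)) -> teval T x = teval T y.
Proof.
move=> H; apply: eq_bigr => c _; congr (_ * _).
have /choice[z zE] : forall p, exists z : int, x 0 p - y 0 p = z%:~R * (2 * pi).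
  move=> p; have /intrP[z e] := H p; exists z; rewrite -e divfK //.
  by rewrite mulf_neq0 // gt_eqF // pi_gt0.
have -> : phase c.1.2 x = phase c.1.2 y + (\sum_p c.1.2 0 p * z p)%:~R * (2 * pi).
  rewrite -[x](subrK y) addrC phaseD; congr (_ + _).
  rewrite /phase rmorph_sum /= mulr_suml; apply: eq_bigr => p _.
  by rewrite !mxE zE intrM mulrA.
rewrite addrAC; move: (\sum_p _) => N.
have cosnat (a : R) (k : nat) : cos (a + k%:R * (2 * pi)) = cos a.
  have -> : k%:R * (2 * pi) = (pi *+ 2) *+ k :> R by rewrite mulr_natl (mulr_natl pi 2).
  by rewrite (periodicn (@cosD2pi R)).
case: N => k; first exact: cosnat.
rewrite NegzE intrN mulNr -[LHS](cosnat _ k.+1); congr cos.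
by rewrite subrK.
Qed.

Lemma is_derive_teval T x p (b : R) :
  is_derive b 1 (fun a : R => teval T (x + a *: delta_mx 0 p))
    (teval (tD p T) (x + b *: delta_mx 0 p)).
Proof.
have -> : (fun a : R => teval T (x + a *: delta_mx 0 p)) =
  (fun a : R => \sum_(c <- T) c.1.1 * cos (phase c.1.2 x + c.2 + (c.1.2 0 p)%:~R * a)).
  apply/funext => a; apply: eq_bigr => c _.
  by rewrite phaseD phase_delta addrAC.
rewrite tevalD; elim: T => [|c T IH].
  rewrite big_nil; under [X in is_derive _ _ X]eq_fun do rewrite big_nil.
  exact: is_derive_cst.
rewrite big_cons; under [X in is_derive _ _ X]eq_fun do rewrite big_cons.
apply: is_deriveD => //; rewrite phaseD phase_delta addrAC.
by apply: is_derive_eq; rewrite /= /GRing.scale /=; ring.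
Qed.

End TrigPoly.

(** * Geometry and measurability of the torus *)

Section CircleGeometry.
Context {R : realType}.
Implicit Types (a b c : circle R) (x y u h : R).

Lemma circle_piD x y : circle_pi (x + y) = circle_pi x + circle_pi y.
Proof. by rewrite /circle_pi raddfD. Qed.

Lemma circle_pi0 : circle_pi (0 : R) = 0.
Proof. by rewrite /circle_pi raddf0. Qed.

Lemma circle_piN x : circle_pi (- x) = - circle_pi x.
Proof. by rewrite /circle_pi raddfN. Qed.

Lemma circle_pi_repr a : circle_pi (repr a) = a.
Proof. exact: reprK. Qed.

Lemma circle_pi_eq x y : circle_pi x = circle_pi y <-> period_lattice (x - y).
Proof.
have E := @Quotient.idealrBE R (GRing.ZmodClosed.clone R (@period_lattice R) _) x y.
by split => [e|H]; [exact: etrans E (introT eqP e)|apply/eqP; exact: etrans (esym E) H].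
Qed.

Lemma repr_circle_pi x : period_lattice (repr (circle_pi x) - x).
Proof. by apply/circle_pi_eq; rewrite circle_pi_repr. Qed.

(** The lift of b - a in [- pi, pi) attains the infimum: any other lift differs from it by a nonzero
    multiple of 2 pi and is at least as long. *)
Lemma circle_distP a b : exists h : R,
  [/\ `|h| <= pi, a + circle_pi h = b & circle_dist a b = `|h|].
Proof.
have p0 := @two_pi_gt0 R; have pi0 := @pi_gt0 R.
pose h0 := repr b - repr a.
pose N := Num.floor ((h0 + pi) / (2 * pi)).
have /andP[N1 N2] : (N%:~R : R) * (2 * pi) <= h0 + pi < (N%:~R + 1) * (2 * pi).
  have := floor_itv ((h0 + pi) / (2 * pi)).
  by rewrite -/N intrD ler_pdivlMr // ltr_pdivrMr.
pose h := h0 - N%:~R * (2 * pi).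
have hb : - pi <= h < pi.
  by rewrite /h; apply/andP; split; lra.
have hab : a + circle_pi h = b.
  rewrite -[a in LHS]circle_pi_repr -circle_piD -[RHS]circle_pi_repr.
  apply/circle_pi_eq; rewrite /period_lattice.
  have -> : repr a + h - repr b = - N%:~R * (2 * pi) by rewrite /h /h0; ring.
  by rewrite mulfK ?gt_eqF // -intrN intr_int.
exists h; split => //.
  by rewrite ler_norml; apply/andP; split; lra.
apply/eqP; rewrite eq_le; apply/andP; split.
  by apply: ge_inf; [exists 0 => _ [y _ <-]|exists h].
apply: lb_le_inf; first by exists `|h|, h.
move=> _ [y /= yab <-].
have : circle_pi y = circle_pi h by apply: (addrI a); rewrite yab hab.
move/circle_pi_eq; rewrite /period_lattice => /intrP[z].
move/(congr1 (fun w => w * (2 * pi))); rewrite divfK ?gt_eqF // => e.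
have -> : y = h + z%:~R * (2 * pi) by rewrite -e; ring.
case/andP: hb => hb1 hb2.
have [z0|z0|->] := ltgtP z 0; last by rewrite mul0r addr0.
- have z1 : z%:~R <= -1 :> R.
    have : (z <= -1)%R by lia.
    by rewrite -(@ler_int R).
  rewrite (@ler0_norm _ (h + _)); last by nra.
  by rewrite ler_norml; apply/andP; split; nra.
- have z1 : 1 <= z%:~R :> R.
    have : (1 <= z)%R by lia.
    by rewrite -(@ler_int R).
  rewrite (@ger0_norm _ (h + _)); last by nra.
  by rewrite ler_norml; apply/andP; split; nra.
Qed.

Lemma circle_dist_le a u : circle_dist a (a + circle_pi u) <= `|u|.
Proof. by apply: ge_inf; [exists 0 => _ [y _ <-]|exists u]. Qed.

Lemma circle_dist_small a u : `|u| <= pi -> circle_dist a (a + circle_pi u) = `|u|.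
Proof.
move=> upi; have [h [hpi /addrI hu ->]] := circle_distP a (a + circle_pi u).
have p0 := @two_pi_gt0 R; have pi0 := @pi_gt0 R.
move/circle_pi_eq: hu; rewrite /period_lattice => /intrP[z].
move/(congr1 (fun w => w * (2 * pi))); rewrite divfK ?gt_eqF // => e.
move: hpi upi; rewrite !ler_norml => /andP[h1 h2] /andP[u1 u2].
have zb : `|z| <= 1.
  have z1 : z%:~R <= 1 :> R by nra.
  have z2 : -1 <= z%:~R :> R by nra.
  by rewrite -(@ler_int R) intr_norm ler_norml z1 z2.
(* Two lifts in [- pi, pi] agree, or are the two ends pi and - pi, which have the same absolute
   value. *)
have : z = 0 \/ z = 1 \/ z = -1 by lia.
case=> [z0|[z1|z1]]; move: e; rewrite ?z0 ?z1.
- by rewrite mul0r => /= e; have -> : h = u; [lra|].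
- by rewrite mul1r => /= e; have [-> ->] : h = pi /\ u = - pi; [split; lra|rewrite normrN].
- by rewrite mulN1r => /= e; have [-> ->] : h = - pi /\ u = pi; [split; lra|rewrite normrN].
Qed.

Lemma circle_dist_ge0 a b : 0 <= circle_dist a b.
Proof. by have [h [_ _ ->]] := circle_distP a b. Qed.

Lemma circle_dist_sym a b : circle_dist a b = circle_dist b a.
Proof.
suff H c d : circle_dist c d <= circle_dist d c by apply/eqP; rewrite eq_le !H.
have [h [_ <- ->]] := circle_distP d c.
rewrite -normrN; apply: (le_trans _ (circle_dist_le (d + circle_pi h) (- h))).
by rewrite circle_piN addrK.
Qed.

Lemma circle_dist_tri c a b : circle_dist a b <= circle_dist a c + circle_dist c b.
Proof.
have [h [_ hac ->]] := circle_distP a c; have [k [_ <- ->]] := circle_distP c b.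
apply: (le_trans _ (ler_normD h k)); rewrite -hac -addrA -circle_piD.
exact: circle_dist_le.
Qed.

End CircleGeometry.

Section TorusGeometry.
Context {R : realType} {n : nat}.
Implicit Types (x y z : torus R n) (u v h : 'rV[R]_n).

Definition tlift x : 'rV[R]_n := \row_p repr (tnth x p).

Definition tev T x : R := teval T (tlift x).

Lemma tnth_torus_exp x v p : tnth (torus_exp x v) p = tnth x p + circle_pi (v 0 p).
Proof. exact: tnth_mktuple. Qed.

Lemma torus_expD x u v : torus_exp (torus_exp x u) v = torus_exp x (u + v).
Proof.
apply: eq_from_tnth => p.
by rewrite !tnth_torus_exp mxE circle_piD addrA.
Qed.

Lemma torus_exp0 x : torus_exp x 0 = x.
Proof. by apply: eq_from_tnth => p; rewrite !tnth_torus_exp mxE circle_pi0 addr0. Qed.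

Lemma tev_exp T x v : tev T (torus_exp x v) = teval T (tlift x + v).
Proof.
apply: teval_periodic => p; rewrite !mxE tnth_torus_exp.
rewrite -[tnth x p in X in period_lattice X]circle_pi_repr -circle_piD.
have := repr_circle_pi (repr (tnth x p) + v 0 p).
by rewrite circle_piD !circle_pi_repr.
Qed.

Lemma torus_distP x y : exists h, [/\ y = torus_exp x h, torus_dist x y = enorm h
  & forall p, `|h 0 p| <= pi].
Proof.
have /choice[f fP] p := circle_distP (tnth x p) (tnth y p).
exists (\row_p f p); split.
- apply: eq_from_tnth => p; rewrite tnth_torus_exp mxE.
  by have [_ -> _] := fP p.
- rewrite /torus_dist /enorm /edot; congr Num.sqrt; apply: eq_bigr => p _.
  by have [_ _ ->] := fP p; rewrite mxE real_normK ?num_real // expr2.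
- by move=> p; rewrite mxE; have [] := fP p.
Qed.

Lemma torus_dist_exp x u v : (forall p, `|u 0 p - v 0 p| <= pi) ->
  torus_dist (torus_exp x u) (torus_exp x v) = enorm (u - v).
Proof.
move=> H; rewrite /torus_dist /enorm /edot; congr Num.sqrt; apply: eq_bigr => p _.
rewrite !tnth_torus_exp !mxE -expr2.
have -> : tnth x p + circle_pi (v 0 p) = tnth x p + circle_pi (u 0 p) + circle_pi (v 0 p - u 0 p).
  by rewrite -addrA -circle_piD (addrC (u 0 p)) subrK.
by rewrite circle_dist_small distrC // real_normK ?num_real.
Qed.

Lemma tnth_dist_le x y p : circle_dist (tnth x p) (tnth y p) <= torus_dist x y.
Proof.
rewrite /torus_dist -[leLHS]ger0_norm ?circle_dist_ge0 // -sqrtr_sqr ler_wsqrtr //.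
by rewrite (bigD1 p) //= lerDl sumr_ge0 // => q _; rewrite sqr_ge0.
Qed.

Lemma torus_dist_le_sum x y :
  torus_dist x y <= \sum_p circle_dist (tnth x p) (tnth y p).
Proof.
rewrite /torus_dist -[leRHS]ger0_norm ?sumr_ge0 // => [|p _]; last exact: circle_dist_ge0.
rewrite -sqrtr_sqr ler_wsqrtr //.
elim: (index_enum _) => [|p r IH]; first by rewrite !big_nil expr0n.
rewrite !big_cons sqrrD (le_trans (lerD (lexx _) IH)) // addrAC lerDl.
by rewrite mulrn_wge0 // mulr_ge0 ?circle_dist_ge0 // sumr_ge0 // => q _; rewrite circle_dist_ge0.
Qed.

Lemma torus_dist_ge0 x y : 0 <= torus_dist x y.
Proof. exact: sqrtr_ge0. Qed.

Lemma tev_le T x : `|tev T x| <= tbound T. Proof. exact: teval_le. Qed.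

Lemma tev_taylor T x h :
  `|tev T (torus_exp x h) - tev T x - \sum_p tev (tD p T) x * h 0 p|
  <= tbound2 T * \sum_p h 0 p ^+ 2.
Proof. by rewrite tev_exp; exact: teval_taylor. Qed.

Lemma tev_lip T : exists2 C : R, 0 <= C & forall x h,
  `|tev T (torus_exp x h) - tev T x| <= C * \sum_p `|h 0 p|.
Proof.
exists (\sum_(c <- T) `|c.1.1| * \sum_p `|(c.1.2 0 p)%:~R : R|).
  by apply: sumr_ge0 => c _; rewrite mulr_ge0 // sumr_ge0.
move=> x h; rewrite tev_exp /tev /teval -sumrB (le_trans (ler_norm_sum _ _ _)) //.
rewrite mulr_suml ler_sum // => c _.
rewrite -mulrBr normrM -mulrA ler_wpM2l //.
rewrite phaseD addrAC (le_trans (cos_lip1 _ _)) //.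
rewrite (le_trans (ler_norm_sum _ _ _)) // mulr_suml ler_sum // => p _.
rewrite normrM ler_wpM2l // (bigD1 p) //= lerDl sumr_ge0 //.
Qed.

Lemma grad_tev T x : grad (tev T) x = \row_p tev (tD p T) x.
Proof.
apply/rowP => p; rewrite !mxE.
under eq_fun do rewrite tev_exp.
by have D := is_derive_teval T (tlift x) p 0; rewrite derive1E derive_val scale0r addr0.
Qed.

End TorusGeometry.

Lemma countable_bigcup_measurable d (T : measurableType d) (K : countType)
  (F : K -> set T) : (forall k, measurable (F k)) -> measurable (\bigcup_k F k).
Proof.
move=> mF.
pose G j := if unpickle j is Some k then F k else set0.
have -> : \bigcup_k F k = \bigcup_j G j.
  apply/seteqP; split => x [k _ Fx].
    by exists (pickle k) => //; rewrite /G pickleK.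
  by move: Fx; rewrite /G; case: (unpickle k) => // k' ?; exists k'.
by apply: bigcupT_measurable => j; rewrite /G; case: (unpickle j).
Qed.

(** Separability: an open set of a finite product is the union of those products of balls, with
    centres in the dense sequences and radius 1 / (m + 1), that it contains, and there are countably
    many. This links the product sigma-algebra of the torus with the Borel sets of the metrics. *)
Lemma measurable_open_preimage (R : realType) d (T : measurableType d) (I : finType)
    (X : I -> Type) (dist : forall i, X i -> X i -> R) (e : forall i, nat -> X i)
    (f : forall i, T -> X i) (O : set (forall i, X i)) :
  (forall i a b, dist i a b = dist i b a) ->
  (forall i a b c, dist i a b <= dist i a c + dist i c b) ->
  (forall i x (r : R), 0 < r -> exists k, dist i (e i k) x < r) ->
  (forall i k r, measurable [set x | dist i (e i k) (f i x) < r]) ->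
  (forall v, O v -> exists2 r : R, 0 < r &
    forall v', (forall i, dist i (v i) (v' i) < r) -> O v') ->
  measurable [set x | O (fun i => f i x)].
Proof.
move=> sym tri dense mball Oopen.
pose good (k : {ffun I -> nat}) (m : nat) :=
  forall v', (forall i, dist i (e i (k i)) (v' i) < m.+1%:R^-1) -> O v'.
pose F (km : {ffun I -> nat} * nat) :=
  if `[< good km.1 km.2 >] then
    \bigcap_(i in [set: I]) [set x | dist i (e i (km.1 i)) (f i x) < km.2.+1%:R^-1]
  else set0.
suff -> : [set x | O (fun i => f i x)] = \bigcup_km F km.
  apply: countable_bigcup_measurable => km; rewrite /F; case: asboolP => // _.
  by apply: fin_bigcap_measurable => //; exact: finite_finset.
apply/seteqP; split => x /=; last first.
  by move=> [km _]; rewrite /F; case: asboolP => // G H; apply: G => i; exact: H.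
move=> /Oopen[r r0 H].
(* One radius leads from the given point to the centre, a second one from the centre to v'. *)
have [m mr] : exists m : nat, 2 * m.+1%:R^-1 < r.
  have h0 : 0 < r / 2 by rewrite divr_gt0.
  have [m hm] := ltr_add_invr h0.
  by exists m; rewrite add0r in hm; rewrite mulrC -ltr_pdivlMr.
have m0 : 0 < m.+1%:R^-1 :> R by rewrite invr_gt0.
have /choice[k kP] i : exists k, dist i (e i k) (f i x) < m.+1%:R^-1 by exact: dense.
exists ([ffun i => k i], m) => //; rewrite /F; case: asboolP => /= [_ i _|[]].
  by rewrite ffunE; exact: kP.
move=> v' v'P; apply: H => i.
have := v'P i; rewrite ffunE => h.
rewrite (le_lt_trans (tri _ _ _ (e i (k i)))) // sym.
by apply: lt_trans (ltrD (kP i) h) _; move: mr; rewrite mulr_natl mulr2n.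
Qed.

Section TorusMeasurability.
Context {R : realType}.

Lemma circle_ball_open (a : circle R) r : metric_open (@circle_dist R) [set b | circle_dist a b < r].
Proof.
move=> x /= ax; exists (r - circle_dist a x); first by rewrite subr_gt0.
by move=> y xy; rewrite (le_lt_trans (circle_dist_tri x a y)) //; lra.
Qed.

Lemma measurable_metric_open_circle (A : set (circle R)) :
  metric_open (@circle_dist R) A -> measurable A.
Proof. exact: sub_sigma_algebra. Qed.

Lemma measurable_circle_real d (T : measurableType d) n m
    (y : 'I_n -> T -> circle R) (U : 'I_m -> T -> R)
    (O : ('I_n -> circle R) -> ('I_m -> R) -> Prop) :
  (forall p, measurable_fun setT (y p)) ->
  (forall q, measurable_fun setT (U q)) ->
  (forall v u, O v u -> exists2 r : R, 0 < r & forall v' u',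
     (forall p, circle_dist (v p) (v' p) < r) -> (forall q, `|u q - u' q| < r) -> O v' u') ->
  measurable [set x | O (fun p => y p x) (fun q => U q x)].
Proof.
move=> my mU Oopen.
pose X (i : 'I_n + 'I_m) : Type := if i is inl _ then circle R else R.
pose dist i : X i -> X i -> R :=
  match i with inl _ => fun a b => circle_dist a b | inr _ => fun a b => `|a - b| end.
pose q k : R := ratr (odflt 0 (unpickle k)).
pose e i : nat -> X i := match i with inl _ => fun k => circle_pi (q k) | inr _ => q end.
pose f i : T -> X i := match i with inl p => y p | inr s => U s end.
have qdense (x r : R) : 0 < r -> exists k, `|q k - x| < r.
  move=> r0; have [z] := @rat_in_itvoo _ (x - r) (x + r) (ltac:(lra)).
  rewrite in_itv /= => /andP[z1 z2].
  by exists (pickle z); rewrite /q pickleK /= ltr_distl; apply/andP; split; lra.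
apply: (@measurable_open_preimage R d T _ X dist e f
  (fun v => O (fun p => v (inl p)) (fun q => v (inr q)))).
- by case=> i a b; [exact: circle_dist_sym|exact: distrC].
- case=> i a b c; [exact: circle_dist_tri|].
  by rewrite /= (_ : a - b = (a - c) + (c - b)) ?ler_normD //; ring.
- case=> i x r r0; last exact: qdense.
  have [k hk] := qdense (repr (x : circle R)) r r0; exists k.
  rewrite /= -[x in circle_dist _ x]circle_pi_repr.
  by rewrite (le_lt_trans (circle_dist_pi _ _)) // distrC.
- case=> i k r.
    have := my i measurableT _ (measurable_metric_open_circle (@circle_ball_open (circle_pi (q k)) r)).
    by rewrite setTI.
  have bo : open (ball (q k) r) by exact: ball_open.
  have := mU i measurableT _ (open_measurable bo).
  by rewrite setTI.
- move=> v /Oopen[r r0 H]; exists r => // v' v'P.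
  apply: (H (fun p => v' (inl p)) (fun q => v' (inr q))) => i; [exact: (v'P (inl i))|exact: (v'P (inr i))].
Qed.

Lemma measurable_circle_add d (T : measurableType d) (y : T -> circle R) (u : T -> R) :
  measurable_fun setT y -> measurable_fun setT u ->
  measurable_fun setT (fun x => y x + circle_pi (u x)).
Proof.
move=> my mu; apply: (measurability (metric_open (@circle_dist R))) => //.
move=> _ [A Aopen <-]; rewrite setTI.
apply: (@measurable_circle_real d T 1 1 (fun=> y) (fun=> u)
  (fun v u => A (v ord0 + circle_pi (u ord0)))) => // v w /Aopen[r r0 H].
exists (r / 2) => [|v' w' h1 h2]; first by rewrite divr_gt0.
apply: H; have := h1 ord0; have := h2 ord0 => k1 k2.
have [h [_ hv e]] := circle_distP (v ord0) (v' ord0).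
rewrite e in k2; rewrite -hv.
rewrite (_ : _ + circle_pi (w' ord0) = (v ord0 + circle_pi (w ord0)) + circle_pi (h + (w' ord0 - w ord0))).
  rewrite (le_lt_trans (circle_dist_le _ _)) // (le_lt_trans (ler_normD _ _)) //.
  by rewrite (distrC (w' _)); lra.
by rewrite -!addrA -!circle_piD; congr (_ + circle_pi _); ring.
Qed.

Lemma measurable_tnth n p : measurable_fun setT (fun x : torus R n => tnth x p).
Proof. by have /measurable_fun_tnthP := @measurable_id _ (torus R n) setT; apply. Qed.

Lemma measurable_torus_exp d (T : measurableType d) n (y : T -> torus R n) (v : T -> 'rV[R]_n) :
  measurable_fun setT y -> (forall p, measurable_fun setT (fun x => v x 0 p)) ->
  measurable_fun setT (fun x => torus_exp (y x) (v x)).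
Proof.
move=> my mv; apply/measurable_fun_tnthP => p.
rewrite (_ : _ \o _ = fun x => tnth (y x) p + circle_pi (v x 0 p)); last first.
  by apply/funext => x /=; rewrite tnth_torus_exp.
by apply: measurable_circle_add => //; apply: (measurableT_comp (measurable_tnth p)).
Qed.

Lemma measurable_tev n T : measurable_fun setT (@tev R n T).
Proof.
apply: (measurability _ (RGenOpens.measurableE R)) => _ [_ [a [b ->]] <-].
rewrite setTI.
have [C C0 H] := @tev_lip R n T.
pose A : set R := `]a, b[%classic.
have Ao : open A by exact: interval_open.
have : measurable [set x : torus R n | A (tev T [tuple tnth x p | p < n])].
  apply: (@measurable_circle_real _ _ n 0 (fun p x => tnth x p) (fun _ _ => 0)
    (fun v u => A (tev T [tuple v p | p < n]))) => [p|[]//|v u Av]; first exact: measurable_tnth.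
  move: (Ao _ Av) => /nbhs_ballP[r /= r0 Hr].
  have K0 : 0 < C * n%:R + 1 by rewrite ltr_wpDl // mulr_ge0.
  exists (r / (C * n%:R + 1)) => [|v' _ h _]; first by rewrite divr_gt0.
  apply: Hr; rewrite /ball /= distrC.
  have /choice[w wP] p := circle_distP (v p) (v' p).
  have -> : [tuple v' p | p < n] = torus_exp [tuple v p | p < n] (\row_p w p).
    apply: eq_from_tnth => p; rewrite tnth_torus_exp !tnth_mktuple mxE.
    by have [_ -> _] := wP p.
  rewrite (le_lt_trans (H _ _)) //.
  apply: (@le_lt_trans _ _ (C * \sum_(p < n) r / (C * n%:R + 1))).
    rewrite ler_wpM2l // ler_sum // => p _; rewrite mxE ltW //.
    by have [_ _ <-] := wP p; exact: h.
  have q0 : 0 < r / (C * n%:R + 1) by rewrite divr_gt0.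
  have qr : r / (C * n%:R + 1) * (C * n%:R + 1) = r by rewrite divfK // gt_eqF.
  rewrite sumr_const card_ord -[_ *+ n]mulr_natr; move: q0 qr; set q := r / _; lra.
congr measurable; apply/funext => x /=; congr (A (tev T _)).
by apply: eq_from_tnth => p; rewrite tnth_mktuple.
Qed.

End TorusMeasurability.

(** * Changes of variables *)

Section PushDensity.
Context d1 d2 (T1 : measurableType d1) (T2 : measurableType d2) (R : realType).
Variables (nu : {measure set T1 -> \bar R}) (h : T1 -> T2) (rho : T1 -> R).
Hypotheses (mh : measurable_fun setT h) (mrho : measurable_fun setT rho).
Hypothesis (rho0 : forall x, 0 <= rho x).

Let mpre A : measurable A -> measurable (h @^-1` A).
Proof. by move=> mA; rewrite -[X in measurable X]setTI; exact: mh. Qed.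

Definition pushdens (A : set T2) : \bar R := (\int[nu]_(x in h @^-1` A) (rho x)%:E)%E.

Let pushdens0 : pushdens set0 = 0%E.
Proof. by rewrite /pushdens preimage_set0 integral_set0. Qed.

Let pushdens_ge0 A : (0 <= pushdens A)%E.
Proof. by apply: integral_ge0 => x _; rewrite lee_fin. Qed.

Let mErho : measurable_fun setT (fun x => (rho x)%:E).
Proof. exact/measurable_EFinP. Qed.

Let pushdens_sigma_additive : semi_sigma_additive pushdens.
Proof.
move=> F mF tF mUF; rewrite /pushdens preimage_bigcup.
have rho0' x : (0 <= (rho x)%:E)%E by rewrite lee_fin.
have H := @semi_sigma_additive_nng_induced _ _ _ nu _ mErho rho0'.
apply: (H (fun i => h @^-1` (F i))).
- by move=> i; exact: mpre.
- apply/trivIsetP => /= i j _ _ ij; rewrite -preimage_setI.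
  by move/trivIsetP : tF => /(_ _ _ _ _ ij) ->//; rewrite preimage_set0.
- by rewrite -preimage_bigcup; exact: mpre.
Qed.

HB.instance Definition _ := isMeasure.Build _ _ _ pushdens
  pushdens0 pushdens_ge0 pushdens_sigma_additive.

Definition pushdens_measure : {measure set T2 -> \bar R} := pushdens.

(** On indicators this is the definition of [pushdens]; simple approximations from below and
    monotone convergence on both sides do the rest. *)
Lemma ge0_integral_pushdens (f : T2 -> \bar R) :
  measurable_fun setT f -> (forall y, (0 <= f y)%E) ->
  (\int[pushdens_measure]_y f y = \int[nu]_x (f (h x) * (rho x)%:E))%E.
Proof.
move=> mf f0; pose g := nnsfun_approx measurableT mf.
have mgh k : measurable_fun setT (fun x => (g k (h x))%:E).
  by apply/measurable_EFinP; apply: measurableT_comp.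
have mindh (A : set T2) : measurable A -> measurable_fun setT (fun x => (\1_A (h x) : R)).
  by move=> mA; apply: measurableT_comp.
transitivity (limn (fun k => \int[pushdens_measure]_y (g k y)%:E)%E).
  rewrite -monotone_convergence//.
  - apply: eq_integral => y _; apply/esym/cvg_lim => //.
    by apply: cvg_nnsfun_approx.
  - by move=> k; exact/measurable_EFinP.
  - by move=> k y _; rewrite lee_fin.
  - by move=> y _ k m km; rewrite lee_fin; exact/lefP/nd_nnsfun_approx.
transitivity (limn (fun k => \int[nu]_x ((g k (h x))%:E * (rho x)%:E))%E); last first.
  rewrite -monotone_convergence//.
  - apply: eq_integral => x _; apply/cvg_lim => //.
    by apply: cvgeZr => //; apply: cvg_nnsfun_approx.
  - by move=> k; exact: emeasurable_funM.
  - by move=> k x _; rewrite mule_ge0 // lee_fin.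
  - move=> x _ k m km; rewrite lee_wpmul2r ?lee_fin //; exact/lefP/nd_nnsfun_approx.
congr (limn _); apply/funext => k.
under eq_integral do rewrite fimfunE -fsumEFin//.
rewrite ge0_integral_fsum//; last 2 first.
- by move=> y; exact/measurable_EFinP/measurable_funM.
- by move=> y x _; rewrite nnfun_muleindic_ge0.
transitivity (\sum_(r \in range (g k)) \int[nu]_x ((r * \1_(g k @^-1` [set r]) (h x))%:E * (rho x)%:E))%E.
  apply: eq_fsbigr => r; rewrite inE => -[y _ gr]; rewrite integralZl_indic_nnsfun// integral_indic//= setIT.
  have r0 : 0 <= r by rewrite -gr.
  under eq_integral do rewrite EFinM -muleA.
  rewrite ge0_integralZl_EFin //; last 2 first.
  - by move=> x _; rewrite -EFinM lee_fin mulr_ge0.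
  - by apply: emeasurable_funM => //; apply/measurable_EFinP/mindh.
  congr (_ * _)%E; rewrite /pushdens integral_mkcond; apply: eq_integral => x _.
  rewrite patchE indicE /=; case: ifPn => xr.
    by rewrite mem_set ?mul1e //; rewrite inE in xr.
  by rewrite memNset ?mul0e // => H; move: xr; rewrite notin_setE.
rewrite -ge0_integral_fsum//.
- apply: eq_integral => x _; rewrite [g k (h x)]fimfunE -fsumEFin//.
  by rewrite ge0_mule_fsuml // => r; exact: nnfun_muleindic_ge0.
- move=> r; apply: emeasurable_funM => //; apply/measurable_EFinP/measurable_funM => //.
  exact: mindh.
- by move=> r x _; rewrite mule_ge0 ?lee_fin // -lee_fin nnfun_muleindic_ge0.
Qed.

End PushDensity.

Section EqPushDensity.
Context d1 d2 d (T1 : measurableType d1) (T2 : measurableType d2) (T : measurableType d) (R : realType).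

(** Both sides are integrals against pushforwards of densities, and measures that agree on sets have
    the same integrals. *)
Lemma eq_integral_density (nu1 : {measure set T1 -> \bar R}) (nu2 : {measure set T2 -> \bar R})
  (h1 : T1 -> T) (h2 : T2 -> T) (r1 : T1 -> R) (r2 : T2 -> R) (f : T -> \bar R) :
  measurable_fun setT h1 -> measurable_fun setT h2 ->
  measurable_fun setT r1 -> measurable_fun setT r2 ->
  (forall x, 0 <= r1 x) -> (forall x, 0 <= r2 x) ->
  (forall A, measurable A -> (\int[nu1]_(x in h1 @^-1` A) (r1 x)%:E =
     \int[nu2]_(x in h2 @^-1` A) (r2 x)%:E)%E) ->
  measurable_fun setT f -> (forall y, (0 <= f y)%E) ->
  (\int[nu1]_x (f (h1 x) * (r1 x)%:E) = \int[nu2]_x (f (h2 x) * (r2 x)%:E))%E.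
Proof.
move=> mh1 mh2 mr1 mr2 r10 r20 H mf f0.
rewrite -(ge0_integral_pushdens nu1 mh1 mr1 r10 mf f0).
rewrite -(ge0_integral_pushdens nu2 mh2 mr2 r20 mf f0).
by apply: eq_measure_integral => A mA _; exact: H.
Qed.
End EqPushDensity.

Lemma measurable_funT_restrict d (T : measurableType d) (R : realType)
    (f : T -> \bar R) (D : set T) :
  measurable D -> measurable_fun setT f -> measurable_fun setT (f \_ D).
Proof. by move=> mD mf; apply/(measurable_restrictT _ mD); exact: measurable_funTS. Qed.

(** * Shears of the line, the circle and the torus *)

Definition shear (R : realType) (u : R -> R) (y : R) : R := y + u y.
Definition shearJ (R : realType) (du : R -> R) (y : R) : R := 1 + du y.

Section LineShear.
Context {R : realType}.
Notation leb := (@lebesgue_measure R).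
Variables (u du : R -> R) (B : R).
Hypotheses (hu : forall y : R, is_derive y (1 : R) u (du y)) (cdu : continuous du).
Hypotheses (du_small : forall y, `|du y| <= 1 / 2) (u_bound : forall y, `|u y| <= B).

Let eta := shear u.

Let deta (y : R) : is_derive y (1 : R) eta (1 + du y).
Proof. by apply: is_deriveD. Qed.

Let ceta : continuous eta.
Proof.
by move=> y; apply/differentiable_continuous/derivable1_diffP; have [] := deta y.
Qed.

Let mono x y : x < y -> eta x < eta y.
Proof.
move=> xy.
have [|c _ e] := @MVT_segment _ eta (fun y => 1 + du y) x y (ltW xy).
  exact: continuous_subspaceT.
rewrite -subr_gt0 e mulr_gt0 ?subr_gt0 //.
by have := du_small c; rewrite ler_norml => /andP[]; lra.
Qed.

Lemma shear_lt x y : (shear u x < shear u y) = (x < y).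
Proof.
apply/idP/idP; last exact: mono.
rewrite !ltNge; apply: contra; rewrite le_eqVlt => /predU1P[->//|/mono/ltW].
by [].
Qed.

Lemma shear_le x y : (shear u x <= shear u y) = (x <= y).
Proof. by rewrite !leNgt shear_lt. Qed.

Let surj a : exists c, eta c = a.
Proof.
have h1 := u_bound (a - B); have h2 := u_bound (a + B).
have B0 : 0 <= B by rewrite (le_trans _ h1).
move: h1 h2; rewrite !ler_norml => /andP[h1 h1'] /andP[h2 h2'].
have [|||c _ e] := @IVT _ eta (a - B) (a + B) a; last by exists c.
- lra.
- exact: continuous_subspaceT.
- by rewrite ge_min le_max /eta /shear; apply/andP; split; apply/orP; [left|right]; lra.
Qed.

Let meta : measurable_fun (setT : set (measurableTypeR R)) (eta : _ -> measurableTypeR R).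
Proof. exact: continuous_measurable_fun. Qed.

Let mrho : measurable_fun (setT : set (measurableTypeR R)) (shearJ du).
Proof. by apply: measurable_funD => //; exact: continuous_measurable_fun. Qed.

Let rho0 y : 0 <= shearJ du y.
Proof. by have := du_small y; rewrite /shearJ ler_norml => /andP[]; lra. Qed.

(** The pushforward of the density [shearJ] gives the interval ]a, b] the mass b - a, by the
    fundamental theorem of calculus between the preimages c and d; this characterizes Lebesgue
    measure. *)
Lemma line_shear (f : measurableTypeR R -> \bar R) :
  measurable_fun setT f -> (forall y, (0 <= f y)%E) ->
  (\int[leb]_y (f (shear u y) * (shearJ du y)%:E) = \int[leb]_y f y)%E.
Proof.
move=> mf f0.
rewrite -(ge0_integral_pushdens leb meta mrho rho0 mf f0).
apply: eq_measure_integral => A mA _; apply/esym.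
apply: lebesgue_measure_unique mA => X /ocitvP[->|[[a b] /= ab ->]].
  by rewrite !measure0.
have [c ec] := surj a; have [d ed] := surj b.
have cd : c < d by rewrite -shear_lt -/eta ec ed.
rewrite /= /pushdens.
have -> : eta @^-1` `]a, b]%classic = `]c, d]%classic.
  by apply/seteqP; split => y /=; rewrite !in_itv /= -ec -ed /eta shear_lt shear_le.
rewrite integral_itv_obnd_cbnd; last by apply/measurable_funTS/measurable_EFinP.
rewrite (@continuous_FTC2 _ (fun y => 1 + du y) eta c d cd).
- by rewrite lebesgue_measure_itv /= lte_fin ab ec ed.
- by apply: continuous_subspaceT => y; apply: cvgD; [exact: cvg_cst|exact: cdu].
- split=> [y _||].
  + by have [] := deta y.
  + by apply: cvg_at_right_filter; exact: ceta.
  + by apply: cvg_at_left_filter; exact: ceta.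
- by move=> y _; have D := deta y; rewrite derive1E derive_val.
Qed.

End LineShear.

Section CircleShear.
Context {R : realType}.
Notation leb := (@lebesgue_measure R).

Lemma line_translation (c : R) (f : measurableTypeR R -> \bar R) :
  measurable_fun setT f -> (forall y, (0 <= f y)%E) ->
  (\int[leb]_y f (shear (fun=> c) y) = \int[leb]_y f y)%E.
Proof.
move=> mf f0.
rewrite -(@line_shear R (fun=> c) (fun=> 0) `|c| _ _ _ _ _ mf f0) //.
- by apply: eq_integral => y _; rewrite /shearJ addr0 mule1.
- by move=> y; exact: cvg_cst.
- by move=> y; rewrite normr0.
Qed.

Section Periodic.
Variable F : measurableTypeR R -> \bar R.
Hypotheses (mF : measurable_fun setT F) (F0 : forall y, (0 <= F y)%E).
Hypothesis (Fper : forall y, F (y + 2 * pi) = F y).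

Let I a b := (\int[leb]_(y in `[a, b[) F y)%E.

Let Itrans a b : I (a + 2 * pi) (b + 2 * pi) = I a b.
Proof.
rewrite /I [LHS]integral_mkcond [RHS]integral_mkcond -[LHS](@line_translation (2 * pi)); last 2 first.
- by apply: measurable_funT_restrict.
- by move=> y; rewrite patchE; case: ifP.
apply: eq_integral => y _; rewrite !patchE !mem_setE !in_itv /= /shear lerD2r ltrD2r Fper.
by [].
Qed.

Let Isplit a b c : a <= b -> b <= c -> I a c = (I a b + I b c)%E.
Proof.
move=> ab bc; rewrite /I -ge0_integral_setU //=.
- congr integral; apply/seteqP; split => y /=; rewrite !in_itv /=.
    by case/andP=> ay yc; have [yb|yb] := ltP y b; [left; rewrite ay|right].
  by case=> /andP[h1 h2]; rewrite ?h1 ?h2 ?(lt_le_trans h2) ?(le_trans ab).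
- exact: measurable_funTS.
- apply/disj_setPS => y /= []; rewrite !in_itv /= => /andP[_ h] /andP[h' _].
  by move: h; rewrite ltNge h'.
Qed.

(** For c in [0, 2 pi], cut at 2 pi and move the part beyond it back by one period; a negative c is
    first moved forward. *)
Lemma integral_period (c : R) : `|c| <= 2 * pi ->
  (\int[leb]_(y in `[c, (c + 2 * pi)%R[) F y = \int[leb]_(y in `[0%R, (2 * pi)%R[) F y)%E.
Proof.
have p0 := @pi_gt0 R.
rewrite -/(I _ _) -/(I _ _).
suff H (b : R) : 0 <= b -> b <= 2 * pi -> I b (b + 2 * pi) = I 0 (2 * pi).
  rewrite ler_norml => /andP[c1 c2].
  have [c0|c0] := leP 0 c; first exact: H.
  by rewrite -Itrans H //; lra.
move=> b0 b1.
rewrite (@Isplit _ (2 * pi)) // ?lerDr // -[X in I X (b + _)]add0r Itrans addeC -Isplit //.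
Qed.
End Periodic.

Lemma ge0_integral_circle (f : circle R -> \bar R) :
  measurable_fun setT f -> (forall y, (0 <= f y)%E) ->
  (\int[circle_volume R]_y f y =
   ((2 * pi)^-1)%:E * \int[leb]_(x in `[0%R, (2 * pi)%R[) f (circle_pi x))%E.
Proof.
move=> mf f0.
have mfp : measurable_fun setT (f \o @circle_pi R).
  by apply: measurableT_comp mf _; exact: measurable_circle_pi.
rewrite ge0_integral_distribution // integral_uniform //; last by move=> x; exact: f0.
rewrite subr0; congr (_ * _)%E.
rewrite integral_itv_bndo_bndc //.
exact: measurable_funTS.
Qed.

(** The lifted shear is increasing and its displacement is periodic, so it carries [0, 2 pi) onto
    the shifted period [u 0, u 0 + 2 pi). The change of variables on the line and [integral_period]
    then give the claim. *)
Lemma circle_shear (ut dut : circle R -> R) (f : circle R -> \bar R) :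
  (forall y : R, is_derive y (1 : R) (ut \o @circle_pi R) (dut (circle_pi y))) ->
  continuous (dut \o @circle_pi R) ->
  (forall y, `|dut y| <= 1 / 2) -> (forall y, `|ut y| <= 2 * pi) ->
  measurable_fun setT ut -> measurable_fun setT dut ->
  measurable_fun setT f -> (forall y, (0 <= f y)%E) ->
  (\int[circle_volume R]_y (f (y + circle_pi (ut y))%R * (1 + dut y)%:E) =
   \int[circle_volume R]_y f y)%E.
Proof.
move=> hu cdu dub ub mu mdu mf f0.
pose u := ut \o @circle_pi R; pose du := dut \o @circle_pi R.
have dub' y : `|du y| <= 1 / 2 by exact: dub.
have ub' y : `|u y| <= 2 * pi by exact: ub.
have du0 y : 0 <= 1 + dut y.
  by have := dub y; rewrite ler_norml => /andP[]; lra.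
rewrite !ge0_integral_circle //; last 2 first.
- apply: emeasurable_funM; last by apply/measurable_EFinP; apply: measurable_funD.
  by apply: measurableT_comp mf _; apply: measurable_circle_add.
- by move=> y; rewrite mule_ge0 // lee_fin.
congr (_ * _)%E.
pose F : measurableTypeR R -> \bar R := f \o @circle_pi R.
have mF : measurable_fun setT F.
  by apply: measurableT_comp mf _; exact: measurable_circle_pi.
have pi2 : circle_pi (2 * pi) = 0 :> circle R.
  rewrite -circle_pi0; apply/circle_pi_eq; rewrite /period_lattice subr0 divff ?rpred1 //.
  by rewrite gt_eqF // mulr_gt0 // pi_gt0.
have Fper y : F (y + 2 * pi) = F y by rewrite /F /= circle_piD pi2 addr0.
rewrite -[RHS](@integral_period F mF (fun y => f0 _) Fper (u 0) (ub' 0)).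
rewrite [RHS]integral_mkcond -[RHS](@line_shear R u du (2 * pi)) //; last 2 first.
- by apply: measurable_funT_restrict.
- by move=> y; rewrite patchE; case: ifP => // _; exact: f0.
rewrite [LHS]integral_mkcond; apply: eq_integral => y _.
have E : (shear u y \in `[u 0, (u 0 + 2 * pi)%R[) = (y \in `[0, (2 * pi)%R[) :> bool.
  have e0 : u 0 = 0 + u 0 by rewrite add0r.
  have e1 : u 0 + 2 * pi = 2 * pi + u (2 * pi) by rewrite /u /= pi2 circle_pi0 addrC.
  rewrite !in_itv /= e1 {1}e0 -![_ + u _]/(shear u _).
  by rewrite (@shear_le R u du hu dub') (@shear_lt R u du hu dub').
rewrite !patchE !mem_setE E; case: ifP => _; last by rewrite mul0e.
by rewrite /F /shear /= circle_piD.
Qed.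

End CircleShear.

Section TorusShear.
Context {R : realType}.

Definition tupd n (x : torus R n) (p : 'I_n) (y : circle R) : torus R n :=
  [tuple if q == p then y else tnth x q | q < n].

Lemma measurable_tupd n (p : 'I_n) (x : torus R n) : measurable_fun setT (tupd x p).
Proof.
apply/measurable_fun_tnthP => q.
rewrite (_ : _ \o _ = fun y => if q == p then y else tnth x q); last first.
  by apply/funext => y /=; rewrite tnth_mktuple.
by case: eqP.
Qed.

Lemma ge0_integral_torusS n (f : torus R n.+1 -> \bar R) :
  measurable_fun setT f -> (forall x, (0 <= f x)%E) ->
  (\int[torus_volume R n.+1]_x f x =
   \int[circle_volume R \x torus_volume R n]_z f (torus_cons z))%E.
Proof. by move=> mf f0; rewrite /torus_volume -/torus_volume ge0_integral_distribution. Qed.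

(** The volume is built by adding one coordinate in front, so Tonelli's theorem peels off
    coordinates until p is the first one. *)
Lemma eq_integral_slice n (p : 'I_n) (f g : torus R n -> \bar R) :
  measurable_fun setT f -> measurable_fun setT g ->
  (forall x, (0 <= f x)%E) -> (forall x, (0 <= g x)%E) ->
  (forall x, \int[circle_volume R]_y f (tupd x p y) = \int[circle_volume R]_y g (tupd x p y))%E ->
  (\int[torus_volume R n]_x f x = \int[torus_volume R n]_x g x)%E.
Proof.
elim: n p f g => [[]//|n IH p f g mf mg f0 g0 H].
have mc (h : torus R n.+1 -> \bar R) : measurable_fun setT h ->
    measurable_fun setT (h \o @torus_cons R n).
  by move=> mh; apply: measurableT_comp mh _; exact: measurable_torus_cons.
rewrite !ge0_integral_torusS //.
case: (unliftP ord0 p) H => [p' ->|->] H; last first.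
  rewrite !fubini_tonelli2 //; try exact: mc.
  apply: eq_integral => x _; rewrite /fubini_G.
  have := H (torus_cons (0, x)).
  suff E (y : circle R) : tupd (torus_cons (0, x)) ord0 y = torus_cons (y, x).
    rewrite (_ : (fun y => f (tupd _ _ y)) = (fun y => f (torus_cons (y, x)))); last first.
      by apply/funext => y; rewrite E.
    rewrite (_ : (fun y => g (tupd _ _ y)) = (fun y => g (torus_cons (y, x)))) //.
    by apply/funext => y; rewrite E.
  apply: eq_from_tnth => q; rewrite tnth_mktuple.
  by case: (unliftP ord0 q) => [q' ->|->] //=; rewrite !tnthS.
rewrite !fubini_tonelli1 //; try exact: mc.
apply: eq_integral => y _; rewrite /fubini_F.
have my (h : torus R n.+1 -> \bar R) : measurable_fun setT h ->
    measurable_fun setT (fun x => h (torus_cons (y, x))).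
  by move=> mh; apply: measurableT_comp mh _; apply: measurableT_comp (@measurable_torus_cons R n) _;
    apply: measurable_fun_pair.
apply: (IH p') => //; try exact: my.
move=> x; have := H (torus_cons (y, x)).
suff E (z : circle R) : tupd (torus_cons (y, x)) (lift ord0 p') z = torus_cons (y, tupd x p' z).
  rewrite (_ : (fun z => f (tupd _ _ z)) = (fun z => f (torus_cons (y, tupd x p' z)))); last first.
    by apply/funext => z; rewrite E.
  rewrite (_ : (fun z => g (tupd _ _ z)) = (fun z => g (torus_cons (y, tupd x p' z)))) //.
  by apply/funext => z; rewrite E.
apply: eq_from_tnth => q; rewrite tnth_mktuple.
case: (unliftP ord0 q) => [q' ->|->] //=; rewrite !tnthS tnth_mktuple.
by rewrite (inj_eq lift_inj).
Qed.

End TorusShear.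

Section TorusFlow.
Context {R : realType} {n : nat}.
Implicit Types (x : torus R n) (T : seq (R * 'rV[int]_n * R)).
Notation mu := (torus_volume R n).

Lemma torus_exp_tupd x p (y : circle R) (a : R) :
  torus_exp (tupd x p y) (a *: delta_mx 0 p) = tupd x p (y + circle_pi a).
Proof.
apply: eq_from_tnth => q; rewrite tnth_torus_exp !tnth_mktuple !mxE /=.
by case: eqP => _; rewrite ?mulr1 // mulr0 circle_pi0 addr0.
Qed.

Definition tshear T p (e : R) x := torus_exp x ((e * tev T x) *: delta_mx 0 p).

Lemma measurable_shear T p (e : R) : measurable_fun setT (tshear T p e).
Proof.
apply: measurable_torus_exp => // q.
rewrite (_ : (fun x => _) = (fun x => e * tev T x * (delta_mx 0 p : 'rV[R]_n) 0 q)); last first.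
  by apply/funext => x; rewrite !mxE.
by apply: measurable_funM => //; apply: measurable_funM => //; exact: measurable_tev.
Qed.

(** With the other coordinates fixed, this is a shear of the circle in direction p, whose derivative
    is given by [tD p]. *)
Lemma torus_shear T p (e : R) (f : torus R n -> \bar R) :
  `|e| * tbound T <= 1 -> `|e| * tbound (tD p T) <= 1 / 2 ->
  measurable_fun setT f -> (forall x, (0 <= f x)%E) ->
  (\int[mu]_x (f (tshear T p e x) * (1 + e * tev (tD p T) x)%:E) =
   \int[mu]_x f x)%E.
Proof.
move=> e1 e2 mf f0.
have db x : `|e * tev (tD p T) x| <= 1 / 2.
  by rewrite normrM (le_trans _ e2) // ler_wpM2l // tev_le.
have ub x : `|e * tev T x| <= 1.
  by rewrite normrM (le_trans _ e1) // ler_wpM2l // tev_le.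
have mt S : measurable_fun setT (fun x => e * tev S x).
  by apply: measurable_funM => //; exact: measurable_tev.
apply: (eq_integral_slice (p := p)) => //.
- apply: emeasurable_funM; first exact: measurableT_comp mf (measurable_shear T p e).
  by apply/measurable_EFinP; apply: measurable_funD.
- move=> x; rewrite mule_ge0 // lee_fin.
  by have := db x; rewrite ler_norml => /andP[]; lra.
move=> x.
pose ut y := e * tev T (tupd x p y).
pose dut y := e * tev (tD p T) (tupd x p y).
have mut S : measurable_fun setT (fun y => e * tev S (tupd x p y)).
  exact: measurableT_comp (mt S) (measurable_tupd p x).
have E S (y : R) : tev S (tupd x p (circle_pi y)) =
    teval S (tlift (tupd x p 0) + y *: delta_mx 0 p).
  by rewrite -tev_exp torus_exp_tupd add0r.
rewrite -[RHS](@circle_shear R ut dut (fun y => f (tupd x p y))) //.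
- by apply: eq_integral => y _; rewrite /tshear torus_exp_tupd.
- move=> y; rewrite /dut E.
  have -> : ut \o @circle_pi R = (fun y => e * teval T (tlift (tupd x p 0) + y *: delta_mx 0 p)).
    by apply/funext => z; rewrite /ut /= E.
  have D := is_derive_teval T (tlift (tupd x p 0)) p y.
  exact: is_deriveZ.
- have -> : dut \o @circle_pi R =
      (fun y => e * teval (tD p T) (tlift (tupd x p 0) + y *: delta_mx 0 p)).
    by apply/funext => z; rewrite /dut /= E.
  move=> y; apply: cvgM; first exact: cvg_cst.
  have [D _] := is_derive_teval (tD p T) (tlift (tupd x p 0)) p y.
  by have /derivable1_diffP/differentiable_continuous := D; exact.
- by move=> y; exact: db.
- move=> y; rewrite (le_trans (ub _)) //.
  by have := @pi_ge2 R; lra.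
- exact: mut.
- exact: mut.
- exact: measurableT_comp mf (measurable_tupd p x).
Qed.

Section Flow.
Variables (w : 'I_n -> seq (R * 'rV[int]_n * R)) (e : R).

(* The flow is a composition of the coordinate shears x_p |-> x_p + e w_p (x): to first order it is
   x |-> x + e w (x), but its Jacobian is a product of one-dimensional ones. *)
Fixpoint flow_disp (ps : seq 'I_n) x : 'rV[R]_n :=
  if ps is p :: ps' then
    flow_disp ps' x + (e * tev (w p) (torus_exp x (flow_disp ps' x))) *: delta_mx 0 p
  else 0.

Fixpoint flow_jac (ps : seq 'I_n) x : R :=
  if ps is p :: ps' then
    (1 + e * tev (tD p (w p)) (torus_exp x (flow_disp ps' x))) * flow_jac ps' x
  else 1.

Definition flow ps x := torus_exp x (flow_disp ps x).

Lemma flow_cons p ps x : flow (p :: ps) x = tshear (w p) p e (flow ps x).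
Proof. by rewrite /flow /tshear torus_expD. Qed.

Lemma measurable_flow ps : measurable_fun setT (flow ps).
Proof.
elim: ps => [|p ps IH].
  by rewrite (_ : flow _ = id) //; apply/funext => x; rewrite /flow torus_exp0.
rewrite (_ : flow _ = tshear (w p) p e \o flow ps).
  exact: measurableT_comp (measurable_shear _ _ _) IH.
by apply/funext => x; rewrite flow_cons.
Qed.

Lemma measurable_flow_jac ps : measurable_fun setT (flow_jac ps).
Proof.
elim: ps => [|p ps IH] /=; first exact: measurable_cst.
apply: measurable_funM => //; apply: measurable_funD => //; apply: measurable_funM => //.
exact: measurableT_comp (measurable_tev _) (measurable_flow ps).
Qed.

Hypotheses (e1 : forall p, `|e| * tbound (w p) <= 1)
  (e2 : forall p, `|e| * tbound (tD p (w p)) <= 1 / 2).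

Lemma flow_factor_ge0 p x : 1 / 2 <= 1 + e * tev (tD p (w p)) x.
Proof.
have : `|e * tev (tD p (w p)) x| <= 1 / 2.
  by rewrite normrM (le_trans _ (e2 p)) // ler_wpM2l // tev_le.
by rewrite ler_norml => /andP[]; lra.
Qed.

(** One shear at a time, each factor of [flow_jac] being taken where the earlier shears have
    arrived. The formula is exact, as the coupling must have exactly the prescribed second
    marginal. *)
Lemma ge0_integral_flow ps (f : torus R n -> \bar R) :
  measurable_fun setT f -> (forall x, (0 <= f x)%E) ->
  (\int[mu]_x (f (flow ps x) * (flow_jac ps x)%:E) = \int[mu]_x f x)%E.
Proof.
elim: ps f => [|p ps IH] f mf f0.
  by apply: eq_integral => x _; rewrite /= /flow torus_exp0 mule1.
rewrite -[RHS](torus_shear (e1 p) (e2 p) mf f0) -[RHS]IH.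
- by apply: eq_integral => x _; rewrite flow_cons /= EFinM muleA.
- apply: emeasurable_funM; first exact: measurableT_comp mf (measurable_shear _ _ _).
  apply/measurable_EFinP; apply: measurable_funD => //; apply: measurable_funM => //.
  exact: measurable_tev.
- move=> x; rewrite mule_ge0 // lee_fin.
  by have := flow_factor_ge0 p x; lra.
Qed.

End Flow.

(** * Expectations of bounded measurable functions *)

Section Expectation.

Definition bm (f : torus R n -> R) :=
  measurable_fun setT f /\ exists C, forall x, `|f x| <= C.

Definition expect (f : torus R n -> R) : R := \int[mu]_x f x.

Lemma bm_cst c : bm (fun=> c).
Proof. by split => //; exists `|c|. Qed.

Lemma bm_add f g : bm f -> bm g -> bm (fun x => f x + g x).
Proof.
move=> [mf [C fC]] [mg [D gD]]; split; first exact: measurable_funD.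
by exists (C + D) => x; rewrite (le_trans (ler_normD _ _)) // lerD.
Qed.

Lemma bm_mul f g : bm f -> bm g -> bm (fun x => f x * g x).
Proof.
move=> [mf [C fC]] [mg [D gD]]; split; first exact: measurable_funM.
by exists (C * D) => x; rewrite normrM ler_pM.
Qed.

Lemma bm_opp f : bm f -> bm (fun x => - f x).
Proof.
move=> [mf [C fC]]; split; first exact: measurableT_comp mf.
by exists C => x; rewrite normrN.
Qed.

Lemma bm_sub f g : bm f -> bm g -> bm (fun x => f x - g x).
Proof. by move=> hf hg; exact: bm_add hf (bm_opp hg). Qed.

Lemma bm_X f k : bm f -> bm (fun x => f x ^+ k).
Proof.
move=> [mf [C fC]]; split; first exact: measurable_funX.
exists (C ^+ k) => x; rewrite normrX lerXn2r // ?nnegrE //.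
by rewrite (le_trans _ (fC x)).
Qed.

Lemma bm_sum (I : finType) (F : I -> torus R n -> R) :
  (forall p, bm (F p)) -> bm (fun x => \sum_p F p x).
Proof.
move=> H; split; first by apply: measurable_sum => p; have [] := H p.
have /choice[C hC] p : exists C, forall x, `|F p x| <= C by have [_] := H p.
exists (\sum_p C p) => x; rewrite (le_trans (ler_norm_sum _ _ _)) // ler_sum // => p _.
Qed.

Lemma bm_tev T : bm (tev T).
Proof. by split; [exact: measurable_tev|exists (tbound T) => x; exact: tev_le]. Qed.

Lemma bm_integrable f : bm f -> mu.-integrable setT (EFin \o f).
Proof.
move=> [mf [C fC]]; apply: measurable_bounded_integrable => //.
  by rewrite -ge0_fin_numE // fin_num_measure.
exists C; split; first exact: num_real.
by move=> y Cy x _; exact: le_trans (fC x) (ltW Cy).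
Qed.

Lemma expectD f g : bm f -> bm g -> expect (fun x => f x + g x) = expect f + expect g.
Proof. by move=> hf hg; apply: RintegralD => //; exact: bm_integrable. Qed.

Lemma expectB f g : bm f -> bm g -> expect (fun x => f x - g x) = expect f - expect g.
Proof. by move=> hf hg; apply: RintegralB => //; exact: bm_integrable. Qed.

Lemma expectZ c f : bm f -> expect (fun x => c * f x) = c * expect f.
Proof. by move=> hf; apply: RintegralZl => //; exact: bm_integrable. Qed.

Lemma expect_cst c : expect (fun=> c) = c.
Proof. by rewrite /expect Rintegral_cst //= probability_setT mulr1. Qed.

Lemma expect_sum (I : finType) (F : I -> torus R n -> R) :
  (forall p, bm (F p)) -> expect (fun x => \sum_p F p x) = \sum_p expect (F p).
Proof.
move=> H; elim: (index_enum I) => [|p r IH].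
  by rewrite big_nil; under eq_fun do rewrite big_nil; rewrite expect_cst.
rewrite big_cons -IH -expectD //; first by congr expect; apply/funext => x; rewrite big_cons.
split; first by apply: measurable_sum => q; have [] := H q.
have /choice[C hC] q : exists C, forall x, `|F q x| <= C by have [_] := H q.
by exists (\sum_(q <- r) C q) => x; rewrite (le_trans (ler_norm_sum _ _ _)) // ler_sum.
Qed.

Lemma le_expect f g : bm f -> bm g -> (forall x, f x <= g x) -> expect f <= expect g.
Proof. by move=> hf hg fg; apply: le_Rintegral => //; exact: bm_integrable. Qed.

Lemma EFin_expect f : bm f -> ((expect f)%:E = \int[mu]_x (f x)%:E)%E.
Proof.
move=> hf; rewrite /expect /Rintegral fineK //.
exact: integrable_fin_num (bm_integrable hf).
Qed.

Lemma expect_le_norm f C : bm f -> (forall x, `|f x| <= C) -> `|expect f| <= C.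
Proof.
move=> hf fC; rewrite ler_norml -{2}[C]expect_cst -[- C]expect_cst.
have h x : - C <= f x <= C by rewrite -ler_norml.
by apply/andP; split; (apply: le_expect => //; first exact: bm_cst) => x; have /andP[] := h x.
Qed.

(** Applying the change of variables of a small shear to the constant function 1 gives E
    [1 + e d_p T] = 1. The number e only serves to meet the smallness conditions. *)
Lemma expect_tD p T : expect (tev (tD p T)) = 0.
Proof.
pose e := (1 + tbound T + 2 * tbound (tD p T))^-1.
have b0 (S : seq (R * 'rV[int]_n * R)) : 0 <= tbound S by apply: sumr_ge0.
have d0 : 0 < 1 + tbound T + 2 * tbound (tD p T).
  by have := b0 T; have := b0 (tD p T); lra.
have e0 : 0 < e by rewrite invr_gt0.
have e1 : `|e| * tbound T <= 1.
  by rewrite gtr0_norm // mulrC ler_pdivrMr //; have := b0 T; have := b0 (tD p T); lra.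
have e2 : `|e| * tbound (tD p T) <= 1 / 2.
  rewrite gtr0_norm // mulrC ler_pdivrMr //; have := b0 T; have := b0 (tD p T); lra.
have := torus_shear e1 e2 (measurable_cst (1%:E : \bar R)) (fun=> lee01).
under eq_integral do rewrite mul1e.
have hb : bm (fun x => e * tev (tD p T) x) by apply: bm_mul (bm_cst e) (bm_tev _).
rewrite -!EFin_expect; [|exact: bm_cst|exact: bm_add (bm_cst 1) hb].
move=> [/eqP]; rewrite expectD //; last exact: bm_cst.
rewrite expect_cst -subr_eq0 addrAC subrr add0r expectZ; last exact: bm_tev.
by rewrite mulf_eq0 gt_eqF //= => /eqP.
Qed.

End Expectation.
End TorusFlow.

(** * The cone and the Hellinger-Kantorovich distance *)

Section MeasurableReal.
Context {R : realType} d (T : measurableType d).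

Lemma measurable_fun_inv (f : T -> R) : measurable_fun setT f -> measurable_fun setT (fun x => (f x)^-1).
Proof.
suff mi : measurable_fun setT (fun a : R => a^-1) by move=> mf; exact: measurableT_comp mi mf.
rewrite -(setUv [set 0 : R]); apply/measurable_funU => //.
  by apply: measurableC.
split; last first.
  apply: open_continuous_measurable_fun.
    by apply: closed_openC; exact: closed_eq.
  by move=> x; rewrite inE /= => /eqP; exact: inv_continuous.
apply: (eq_measurable_fun (cst (0 : R))); last exact: measurable_cst.
by move=> x; rewrite inE /= => ->; rewrite invr0.
Qed.

Lemma measurable_fun_continuous (g : R -> R) (f : T -> R) :
  continuous g -> measurable_fun setT f -> measurable_fun setT (fun x => g (f x)).
Proof. by move=> cg mf; apply: measurableT_comp mf; exact: continuous_measurable_fun. Qed.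

Lemma measurable_fun_sqrt (f : T -> R) :
  measurable_fun setT f -> measurable_fun setT (fun x => Num.sqrt (f x)).
Proof. by apply: measurable_fun_continuous; exact: sqrt_continuous. Qed.

Lemma measurable_fun_atan (f : T -> R) :
  measurable_fun setT f -> measurable_fun setT (fun x => atan (f x)).
Proof. by apply: measurable_fun_continuous => x; exact: continuous_atan. Qed.

Lemma measurable_fun_cos (f : T -> R) :
  measurable_fun setT f -> measurable_fun setT (fun x => cos (f x)).
Proof. by apply: measurable_fun_continuous => x; exact: continuous_cos. Qed.
End MeasurableReal.

Section ConeGeometry.
Context {R : realType} {n : nat}.
Implicit Types (c : cone R n) (y z : torus R n) (r : half_line R).

Lemma half_line_inj r r' : r%:num = r'%:num -> r = r'.
Proof. by move=> e; apply/eqP; rewrite -num_eq e. Qed.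

Lemma cone_pi_eq p q : (@cone_pi R n p = cone_pi q) <-> cone_rel p q.
Proof. by split=> /(eqquotP (cone R n)). Qed.

Lemma cone_radius_pi y r : cone_radius (cone_pi (y, r)) = r%:num.
Proof.
have : cone_rel (repr (cone_pi (y, r))) (y, r).
  by apply/cone_pi_eq; rewrite /cone_pi reprK.
by rewrite /cone_radius /cone_rel => /orP[/eqP->//|/andP[/eqP-> /eqP ->]].
Qed.

Lemma cone_base_pi y r : r%:num != 0 -> cone_base (cone_pi (y, r)) = y.
Proof.
move=> r0; have : cone_rel (repr (cone_pi (y, r))) (y, r).
  by apply/cone_pi_eq; rewrite /cone_pi reprK.
by rewrite /cone_base /cone_rel /= (negPf r0) andbF orbF => /eqP->.
Qed.

Lemma cone_pi0 y y' r r' : r%:num = 0 -> r'%:num = 0 -> cone_pi (y, r) = cone_pi (y', r').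
Proof. by move=> r0 r0'; apply/cone_pi_eq; rewrite /cone_rel /= r0 r0' eqxx orbT. Qed.

Lemma cone_piK c : cone_pi (cone_base c, (repr c).2) = c.
Proof. by rewrite /cone_base -surjective_pairing /cone_pi reprK. Qed.

Lemma cone_radius_ge0 c : 0 <= cone_radius c.
Proof. by rewrite /cone_radius. Qed.

Lemma cone_dist_sqr_arg (a b c : R) : 0 <= a -> 0 <= b -> c <= 1 ->
  (a - b) ^+ 2 <= a ^+ 2 + b ^+ 2 - 2 * a * b * c.
Proof.
move=> a0 b0 c1.
have : 0 <= a * b * (1 - c) by rewrite !mulr_ge0 // subr_ge0.
lra.
Qed.

Lemma cone_dist2 c c' : cone_dist c c' ^+ 2 =
  cone_radius c ^+ 2 + cone_radius c' ^+ 2 - 2 * cone_radius c * cone_radius c' *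
    cos (Num.min (torus_dist (cone_base c) (cone_base c')) pi).
Proof.
rewrite /cone_dist sqr_sqrtr //.
exact: le_trans (sqr_ge0 _) (cone_dist_sqr_arg (cone_radius_ge0 _) (cone_radius_ge0 _) (cos_le1 _)).
Qed.

Lemma cone_dist2_pi y r y' r' : cone_dist (cone_pi (y, r)) (cone_pi (y', r')) ^+ 2 =
  r%:num ^+ 2 + r'%:num ^+ 2 - 2 * r%:num * r'%:num * cos (Num.min (torus_dist y y') pi).
Proof.
rewrite cone_dist2 !cone_radius_pi.
have [->|r0] := eqVneq (r%:num) 0; first by rewrite !mulr0 !mul0r.
have [->|r0'] := eqVneq (r'%:num) 0; first by rewrite !mulr0 !mul0r.
by rewrite !cone_base_pi.
Qed.

Lemma cone_dist_ge0 c c' : 0 <= cone_dist c c'.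
Proof. exact: sqrtr_ge0. Qed.

Lemma cone_radius_lip c c' : `|cone_radius c - cone_radius c'| <= cone_dist c c'.
Proof.
rewrite -sqrtr_sqr ler_wsqrtr //.
exact: cone_dist_sqr_arg (cone_radius_ge0 _) (cone_radius_ge0 _) (cos_le1 _).
Qed.

Lemma cone_dist_pi_le y r y' r' : cone_dist (cone_pi (y, r)) (cone_pi (y', r')) ^+ 2 <=
  (r%:num - r'%:num) ^+ 2 + r%:num * r'%:num * torus_dist y y' ^+ 2.
Proof.
rewrite cone_dist2_pi.
set d := torus_dist y y'; have d0 : 0 <= d by exact: torus_dist_ge0.
have m0 : 0 <= Num.min d pi by rewrite le_min d0 pi_ge0.
have h := cos_ge2 m0.
have h2 : Num.min d pi ^+ 2 <= d ^+ 2 by rewrite lerXn2r ?nnegrE // ge_min lexx.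
have h3 : 0 <= r%:num * r'%:num * (2 * cos (Num.min d pi) - 2 + d ^+ 2).
  by rewrite !mulr_ge0 //; lra.
by lra.
Qed.

(** At the apex [cone_base] is whatever [repr] picks; with a known value there, preimages can be
    computed. *)
Definition cone_base0 c : torus R n := if cone_radius c == 0 then point else cone_base c.

Lemma cone_base0K c : cone_pi (cone_base0 c, (repr c).2) = c.
Proof.
rewrite /cone_base0; case: eqP => [r0|_]; last exact: cone_piK.
by rewrite -[RHS]cone_piK; apply: cone_pi0.
Qed.

Lemma cone_metric_openT (A : set (cone R n)) : metric_open (@cone_dist R n) A -> measurable A.
Proof. exact: sub_sigma_algebra. Qed.

Lemma measurable_cone_radius : measurable_fun setT (@cone_radius R n).
Proof.
apply: (measurability _ (RGenOpens.measurableE R)) => _ [_ [a [b ->]] <-].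
rewrite setTI; apply: cone_metric_openT => c abc.
have : open (`]a, b[%classic : set R) by exact: interval_open.
move=> /(_ _ abc) /nbhs_ballP[e /= e0 He].
exists e => // c' cc'; apply: He; rewrite /ball /=.
exact: le_lt_trans (cone_radius_lip _ _) cc'.
Qed.

(** Away from the apex the base point depends continuously on the cone point: bases at distance at
    least e1 would give r^2 g <= 2 r r' (1 - cos e1) < (r g)^2, which is impossible for g <= 1/2.
    The same bound on g keeps r' above r / 2. *)
Lemma cone_near_base c (e : R) : 0 < cone_radius c -> 0 < e ->
  exists2 f : R, 0 < f & forall c', cone_dist c c' < f ->
    0 < cone_radius c' /\ torus_dist (cone_base c) (cone_base c') < e.
Proof.
move=> r0 e0; set r := cone_radius c in r0 *.
have p0 := @pi_gt0 R.
pose e1 := Num.min e pi.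
have e10 : 0 < e1 by rewrite lt_min e0.
have e1pi : e1 <= pi by rewrite ge_min lexx orbT.
have c1 : cos e1 < 1.
  rewrite -[X in _ < X]cos0 ltr_cos ?in_itv /= ?lexx ?(ltW e10) ?e1pi ?pi_ge0 //.
pose g := Num.min (1 / 2) (1 - cos e1).
have g0 : 0 < g by rewrite lt_min subr_gt0 c1 andbT; lra.
have g2 : g <= 1 / 2 by rewrite ge_min lexx.
have gc : g <= 1 - cos e1 by rewrite ge_min lexx orbT.
exists (r * g) => [|c' cc']; first by rewrite mulr_gt0.
have h1 := le_lt_trans (cone_radius_lip c c') cc'.
have rr : r / 2 < cone_radius c'.
  move: h1; rewrite -/r ltr_distl => /andP[_ h1].
  have : r * g <= r / 2 by rewrite ler_pM2l //; lra.
  by move: h1; lra.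
have r'0 : 0 < cone_radius c' by rewrite (lt_trans _ rr) // divr_gt0.
split=> //; rewrite ltNge; apply/negP => ed.
have e1d : e1 <= Num.min (torus_dist (cone_base c) (cone_base c')) pi.
  by rewrite le_min e1pi andbT (le_trans _ ed) // ge_min lexx.
have cd : cos (Num.min (torus_dist (cone_base c) (cone_base c')) pi) <= cos e1.
  rewrite leNgt ltr_cos -?leNgt // in_itv /= ?(ltW e10) ?e1pi //.
  by rewrite (le_trans (ltW e10) e1d) ge_min lexx orbT.
have h2 : cone_dist c c' ^+ 2 < (r * g) ^+ 2.
  by rewrite ltr_pXn2r ?nnegrE ?cone_dist_ge0 ?mulr_ge0 ?(ltW r0) ?(ltW g0).
move: h2; rewrite cone_dist2 -/r => h2.
have h3 : r * cone_radius c' * (1 - cos e1) * 2 < (r * g) ^+ 2.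
  apply: le_lt_trans h2.
  have : 0 <= r * cone_radius c' * (cos e1 - cos (Num.min (torus_dist (cone_base c) (cone_base c')) pi)).
    by rewrite !mulr_ge0 ?(ltW r0) ?(ltW r'0) // subr_ge0.
  have := sqr_ge0 (r - cone_radius c'); lra.
have h4 : r * (r / 2) * g * 2 <= r * cone_radius c' * (1 - cos e1) * 2.
  have h4a : r * (r / 2) <= r * cone_radius c' by rewrite ler_wpM2l ?(ltW r0) // ltW.
  have h40 : 0 <= r * (r / 2) by rewrite mulr_ge0 ?divr_ge0 ?(ltW r0).
  by rewrite ler_wpM2r // ler_pM // ltW.
have h5 : (r * g) ^+ 2 <= r * (r / 2) * g * 2.
  have -> : r * (r / 2) * g * 2 = (r * g) * (r * 1) by field.
  by rewrite expr2 ler_wpM2l ?mulr_ge0 ?(ltW r0) ?(ltW g0) // ler_wpM2l ?(ltW r0) //; lra.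
by move: (lt_le_trans (le_lt_trans h4 h3) h5); rewrite ltxx.
Qed.

Lemma measurable_radius0 : measurable [set c : cone R n | cone_radius c = 0].
Proof.
have := measurable_cone_radius measurableT (measurable_set1 (0 : R)).
by rewrite setTI.
Qed.

Lemma measurable_cone_base0 : measurable_fun setT cone_base0.
Proof.
apply/measurable_fun_tnthP => p.
apply: (measurability (metric_open (@circle_dist R))) => //.
move=> _ [A Aopen <-]; rewrite setTI.
rewrite (_ : _ @^-1` A =
   [set c | cone_radius c = 0] `&` [set c | A (tnth (point : torus R n) p)] `|`
   [set c | 0 < cone_radius c /\ A (tnth (cone_base c) p)]); last first.
  apply/seteqP; split => c /=; rewrite /cone_base0.
    case: eqP => [r0 H|r0 H]; [by left|right; split => //].
    by rewrite lt_neqAle cone_radius_ge0 andbT eq_sym; apply/eqP.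
  case=> [[-> H]|[r0 H]]; first by rewrite eqxx.
  by rewrite gt_eqF.
apply: measurableU.
  apply: measurableI; first exact: measurable_radius0.
  have [H|H] := pselect (A (tnth (point : torus R n) p)).
    by rewrite (_ : [set c | _] = setT) //; apply/seteqP; split.
  by rewrite (_ : [set c | _] = set0) //; apply/seteqP; split.
apply: cone_metric_openT => c /= [r0 /Aopen[e e0 He]].
have [f f0 Hf] := cone_near_base r0 e0; exists f => // c' /Hf[r'0 h]; split => //.
by apply: He; exact: le_lt_trans (tnth_dist_le _ _ _) h.
Qed.

Lemma measurable_cone_pi d (T : measurableType d) (y : T -> torus R n) (r : T -> half_line R) :
  measurable_fun setT y -> measurable_fun setT (fun x => (r x)%:num) ->
  measurable_fun setT (fun x => cone_pi (y x, r x)).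
Proof.
move=> my mr; apply: (measurability (metric_open (@cone_dist R n))) => //.
move=> _ [A Aopen <-]; rewrite setTI.
(* The real coordinate enters as sqrt (u^2) = |u|, so that O makes sense for every u and is
   unchanged on radii. *)
pose O (v : 'I_n -> circle R) (u : 'I_1 -> R) :=
  A (cone_pi ([tuple v p | p < n], sqrt_nng (u ord0 ^+ 2))).
have -> : (fun x => cone_pi (y x, r x)) @^-1` A =
    [set x | O (fun p => tnth (y x) p) (fun=> (r x)%:num)].
  apply/funext => x; rewrite /O /=; congr (A (cone_pi (_, _))).
    by apply: eq_from_tnth => p; rewrite tnth_mktuple.
  by apply: half_line_inj; rewrite /= sqrtr_sqr ger0_norm.
apply: (@measurable_circle_real R d T n 1 (fun p x => tnth (y x) p) (fun _ x => (r x)%:num) O) => //.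
  by move=> p; exact: measurableT_comp (measurable_tnth p) my.
move=> v u /Aopen[e e0 He].
set a := `|u ord0|.
have a0 : 0 <= a by exact: normr_ge0.
(* By [cone_dist_pi_le] the squared distance is at most f^2 + a (a + 1) (n f)^2 = K f^2, and the
   choice of f makes this at most e^2 / (4 K). The bound f <= 1 gives |u'| <= a + 1. *)
pose K := 1 + a * (a + 1) * n%:R ^+ 2.
have K1 : 1 <= K by rewrite lerDl !mulr_ge0 // ?exprn_ge0 // addr_ge0.
pose f := Num.min 1 (e / (2 * K)).
have f0 : 0 < f by rewrite lt_min ltr01 divr_gt0 // mulr_gt0 //; lra.
exists f => // v' u' hv hu; apply: He.
rewrite -(@ltr_pXn2r _ 2) ?nnegrE ?cone_dist_ge0 ?(ltW e0) //.
apply: (le_lt_trans (cone_dist_pi_le _ _ _ _)); rewrite /= !sqrtr_sqr -/a.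
have hu0 : `|a - `|u' ord0| | < f by exact: le_lt_trans (ler_dist_dist _ _) (hu ord0).
have hd : torus_dist [tuple v p | p < n] [tuple v' p | p < n] <= n%:R * f.
  rewrite (le_trans (torus_dist_le_sum _ _)) //.
  have -> : n%:R * f = \sum_(p < n) f by rewrite sumr_const card_ord mulr_natl.
  rewrite ler_sum // => p _.
  by rewrite !tnth_mktuple ltW.
have f1 : f <= 1 by rewrite ge_min lexx.
have fe : f <= e / (2 * K) by rewrite ge_min lexx orbT.
have u'a : `|u' ord0| <= a + 1 by move: hu0; rewrite ltr_distl => /andP[]; lra.
have t1 : (a - `|u' ord0|) ^+ 2 <= f ^+ 2.
  by rewrite -real_normK ?num_real // lerXn2r ?nnegrE // ltW.
have t2 : torus_dist [tuple v p | p < n] [tuple v' p | p < n] ^+ 2 <= n%:R ^+ 2 * f ^+ 2.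
  by rewrite -exprMn lerXn2r ?nnegrE ?torus_dist_ge0 // mulr_ge0 // ltW.
have t3 : a * `|u' ord0| * torus_dist [tuple v p | p < n] [tuple v' p | p < n] ^+ 2 <=
   a * (a + 1) * (n%:R ^+ 2 * f ^+ 2).
  by apply: ler_pM; [rewrite mulr_ge0|exact: sqr_ge0|rewrite ler_wpM2l|exact: t2].
apply: (@le_lt_trans _ _ (K * f ^+ 2)); first by rewrite /K; lra.
have t4 : f ^+ 2 <= (e / (2 * K)) ^+ 2.
  by rewrite lerXn2r ?nnegrE ?(ltW f0) ?(le_trans (ltW f0) fe).
have K0 : 0 < K by lra.
apply: (@le_lt_trans _ _ (K * (e / (2 * K)) ^+ 2)); first by rewrite ler_wpM2l // ltW.
have -> : K * (e / (2 * K)) ^+ 2 = e ^+ 2 / (4 * K) by field; rewrite gt_eqF.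
rewrite ltr_pdivrMr ?mulr_gt0 // ltr_pMr ?exprn_gt0 //; lra.
Qed.

Lemma measurable_torus_dist d (T : measurableType d) (y z : T -> torus R n) :
  measurable_fun setT y -> measurable_fun setT z ->
  measurable_fun setT (fun x => torus_dist (y x) (z x)).
Proof.
move=> my mz; apply: measurable_fun_sqrt; apply: measurable_sum => p.
apply: measurable_funX.
apply: (measurability _ (RGenOpens.measurableE R)) => _ [_ [a [b ->]] <-]; rewrite setTI.
pose g (i : 'I_2) x := if i == ord0 then tnth (y x) p else tnth (z x) p.
have mg i : measurable_fun setT (g i).
  by rewrite /g; case: eqP => _; [exact: measurableT_comp (measurable_tnth p) my|exact: measurableT_comp (measurable_tnth p) mz].
have := @measurable_circle_real R d T 2 0 g (fun _ _ => 0)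
  (fun v u => `]a, b[%classic (circle_dist (v ord0) (v ord_max))) mg.
apply => [[]//|v u].
have : open (`]a, b[%classic : set R) by exact: interval_open.
move=> ao /ao /nbhs_ballP[e /= e0 He].
exists (e / 2) => [|v' u' hv _]; first by rewrite divr_gt0.
apply: He; rewrite /ball /=.
have h0 := hv ord0; have h1 := hv ord_max.
have k1 := circle_dist_tri (v' ord0) (v ord0) (v ord_max).
have k2 := circle_dist_tri (v' ord_max) (v' ord0) (v ord_max).
have k3 := circle_dist_tri (v ord0) (v' ord0) (v' ord_max).
have k4 := circle_dist_tri (v ord_max) (v ord0) (v' ord_max).
have s1 := circle_dist_sym (v' ord_max) (v ord_max).
have s2 := circle_dist_sym (v' ord0) (v ord0).
by rewrite ltr_distl; apply/andP; split; lra.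
Qed.

Lemma cone_dist2_base0 c c' : cone_dist c c' ^+ 2 =
  cone_radius c ^+ 2 + cone_radius c' ^+ 2 - 2 * cone_radius c * cone_radius c' *
    cos (Num.min (torus_dist (cone_base0 c) (cone_base0 c')) pi).
Proof. by rewrite -{1}[c]cone_base0K -{1}[c']cone_base0K cone_dist2_pi. Qed.

Lemma measurable_cone_dist2 :
  measurable_fun setT (fun p : cone R n * cone R n => cone_dist p.1 p.2 ^+ 2).
Proof.
rewrite (_ : (fun p => _) = (fun p : cone R n * cone R n =>
  cone_radius p.1 ^+ 2 + cone_radius p.2 ^+ 2 - 2 * cone_radius p.1 * cone_radius p.2 *
    cos (Num.min (torus_dist (cone_base0 p.1) (cone_base0 p.2)) pi))); last first.
  by apply/funext => p; exact: cone_dist2_base0.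
have m1 : measurable_fun setT (fun p : cone R n * cone R n => cone_radius p.1).
  exact: measurableT_comp measurable_cone_radius measurable_fst.
have m2 : measurable_fun setT (fun p : cone R n * cone R n => cone_radius p.2).
  exact: measurableT_comp measurable_cone_radius measurable_snd.
apply: measurable_funB; first by apply: measurable_funD; exact: measurable_funX.
apply: measurable_funM; first by apply: measurable_funM => //; apply: measurable_funM.
apply: measurable_fun_cos; apply: measurable_minr => //; apply: measurable_torus_dist.
  exact: measurableT_comp measurable_cone_base0 measurable_fst.
exact: measurableT_comp measurable_cone_base0 measurable_snd.
Qed.

End ConeGeometry.

Section ConePushforward.
Context {R : realType} {n : nat}.

(** The apex has representatives over all base points, so it lies in the cylinder over any nonempty
    set; the empty set is treated apart. *)
Lemma measurable_cone_cylinder (A : set (torus R n)) :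
  measurable A -> measurable (@cone_pi R n @` (A `*` setT)).
Proof.
move=> mA.
have [A0|/set0P[a Aa]] := eqVneq A set0.
  by rewrite A0 set0X image_set0.
rewrite (_ : _ @` _ = [set c | cone_radius c = 0] `|` @cone_base0 R n @^-1` A); last first.
  apply/seteqP; split => c /=.
    move=> [[y r] /= [Ay _] <-].
    have [r0|r0] := eqVneq (r%:num) 0; first by left; rewrite cone_radius_pi.
    by right; rewrite /cone_base0 cone_radius_pi (negPf r0) cone_base_pi.
  case=> [r0|Ab]; last by exists (cone_base0 c, (repr c).2) => //; exact: cone_base0K.
  exists (a, (repr c).2) => //; rewrite -[RHS]cone_piK; exact: cone_pi0.
apply: measurableU; first exact: measurable_radius0.
by rewrite -[X in measurable X]setTI; exact: measurable_cone_base0.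
Qed.

(** Membership in the cylinder and membership of y x in A can differ only at the apex, where the
    weight r^2 vanishes. *)
Lemma Pr_pushforward d (T : measurableType d) (m : {measure set T -> \bar R})
    (c : T -> cone R n) (y : T -> torus R n) (r : T -> half_line R) A :
  measurable_fun setT c -> (forall x, c x = cone_pi (y x, r x)) -> measurable A ->
  (Pr (pushforward m c) A = \int[m]_(x in y @^-1` A) ((r x)%:num ^+ 2)%:E)%E.
Proof.
move=> mc cE mA; rewrite /Pr ge0_integral_pushforward //; last 3 first.
- exact: measurable_cone_cylinder.
- apply/measurable_funTS/measurable_EFinP/measurable_funX; exact: measurable_cone_radius.
- by move=> z _; rewrite lee_fin sqr_ge0.
rewrite [LHS]integral_mkcond [RHS]integral_mkcond; apply: eq_integral => x _.
rewrite !patchE /= cE cone_radius_pi.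
have [->|r0] := eqVneq ((r x)%:num) 0; first by rewrite expr0n /= !if_same.
congr (if _ then _ else _); apply/idP/idP; rewrite !inE /=.
  move=> [[z q] /= [Az _]]; rewrite cE => /cone_pi_eq; rewrite /cone_rel /= (negPf r0) andbF orbF.
  by move=> /eqP[<-].
by move=> Ay; rewrite cE; exists (y x, r x).
Qed.

Notation mu := (torus_volume R n).

(* Both constructions at the apex give the apex, whatever point of the torus represents it. *)
Lemma cone_exp_pi (phi : torus R n -> R) x (r : half_line R) :
  let c := cone_pi (x, r) in
  cone_exp c (grad phi (cone_base c)) (2 * cone_radius c * phi (cone_base c)) =
  cone_pi (torus_exp x ((atan (r%:num * enorm (grad phi x) / (r%:num + 2 * r%:num * phi x))
                          / enorm (grad phi x)) *: grad phi x),
    sqrt_nng ((r%:num + 2 * r%:num * phi x) ^+ 2 + r%:num ^+ 2 * enorm (grad phi x) ^+ 2)).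
Proof.
rewrite /= /cone_exp cone_radius_pi.
have [r0|r0] := eqVneq (r%:num) 0; last by rewrite cone_base_pi.
by apply: cone_pi0; rewrite /= r0 !(mulr0, mul0r, expr0n, addr0) /= ?mul0r ?addr0 sqrtr0.
Qed.

Definition exp_base (phi : torus R n -> R) x : torus R n :=
  torus_exp x ((atan (enorm (grad phi x) / (1 + 2 * phi x)) / enorm (grad phi x)) *: grad phi x).
Definition exp_mass (phi : torus R n -> R) x : R :=
  (1 + 2 * phi x) ^+ 2 + enorm (grad phi x) ^+ 2.

Lemma exp_mass_ge0 phi x : 0 <= exp_mass phi x.
Proof. by rewrite addr_ge0 ?sqr_ge0. Qed.

Section ExpMu.
Variable phi : torus R n -> R.
Hypotheses (mphi : measurable_fun setT phi)
  (mgrad : forall p, measurable_fun setT (fun x => grad phi x 0 p)).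

Lemma measurable_enorm_grad : measurable_fun setT (fun x => enorm (grad phi x)).
Proof. by apply: measurable_fun_sqrt; apply: measurable_sum => p; apply: measurable_funM. Qed.

Lemma measurable_exp_base : measurable_fun setT (exp_base phi).
Proof.
have mN := measurable_enorm_grad.
apply: measurable_torus_exp => // p.
rewrite (_ : (fun x => _) = fun x => (atan (enorm (grad phi x) / (1 + 2 * phi x)) / enorm (grad phi x)) * grad phi x 0 p); last first.
  by apply/funext => x; rewrite mxE.
apply: measurable_funM => //; apply: measurable_funM; last exact: measurable_fun_inv.
apply: measurable_fun_atan; apply: measurable_funM => //; apply: measurable_fun_inv.
by apply: measurable_funD => //; apply: measurable_funM.
Qed.

Lemma measurable_num : measurable_fun setT (fun r : half_line R => r%:num).
Proof.
apply: (measurability _ (RGenOpens.measurableE R)) => _ [_ [a [b ->]] <-].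
rewrite setTI; apply: sub_sigma_algebra => r /= abr.
have : open (`]a, b[%classic : set R) by exact: interval_open.
by move=> /(_ _ abr) /nbhs_ballP[e /= e0 He]; exists e => // r' rr'; apply: He.
Qed.

Lemma exp_muE A : measurable A ->
  (exp_mu mu phi A = \int[mu]_(x in exp_base phi @^-1` A) (exp_mass phi x)%:E)%E.
Proof.
move=> mA.
(* The measure mu has mass one, so all cone points start at radius 1; q0 names this radius while
   hiding how it was built. *)
have [q0 q0E] : exists q, q = mass_radius mu by exists (mass_radius mu).
have m1 : q0%:num = 1.
  by rewrite q0E /mass_radius /= probability_setT /= sqrtr1.
set E := fun c : cone R n => cone_exp c (grad phi (cone_base c)) (2 * cone_radius c * phi (cone_base c)).
pose m2 : {measure set (torus R n * half_line R)%type -> \bar R} :=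
  (mu \x \d_q0)%E.
pose c := E \o @cone_pi R n.
pose y (z : torus R n * half_line R) := torus_exp z.1
  ((atan (z.2%:num * enorm (grad phi z.1) / (z.2%:num + 2 * z.2%:num * phi z.1))
                          / enorm (grad phi z.1)) *: grad phi z.1).
pose r (z : torus R n * half_line R) : half_line R :=
  sqrt_nng ((z.2%:num + 2 * z.2%:num * phi z.1) ^+ 2 + z.2%:num ^+ 2 * enorm (grad phi z.1) ^+ 2).
have cE z : c z = cone_pi (y z, r z) by case: z => x q; exact: cone_exp_pi.
have mfst (f : torus R n -> R) : measurable_fun setT f ->
  measurable_fun setT (fun z : torus R n * half_line R => f z.1).
  by move=> mf; exact: measurableT_comp mf measurable_fst.
have msnd : measurable_fun setT (fun z : torus R n * half_line R => z.2%:num).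
  exact: measurableT_comp measurable_num measurable_snd.
have mN := mfst _ measurable_enorm_grad.
have mp := mfst _ mphi.
have mr2 : measurable_fun setT (fun z : torus R n * half_line R => z.2%:num + 2 * z.2%:num * phi z.1).
  by apply: measurable_funD => //; apply: measurable_funM => //; apply: measurable_funM.
have my : measurable_fun setT y.
  apply: measurable_torus_exp => // p.
  rewrite (_ : (fun x => _) = fun z => (atan (z.2%:num * enorm (grad phi z.1) / (z.2%:num + 2 * z.2%:num * phi z.1))
      / enorm (grad phi z.1)) * grad phi z.1 0 p); last by apply/funext => z; rewrite mxE.
  apply: measurable_funM; last exact: (mfst (fun x => grad phi x 0 p) (mgrad p)).
  apply: measurable_funM; last exact: measurable_fun_inv.
  apply: measurable_fun_atan; apply: measurable_funM; first exact: measurable_funM.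
  exact: measurable_fun_inv.
have mr : measurable_fun setT (fun z => (r z)%:num).
  apply: measurable_fun_sqrt; apply: measurable_funD; first exact: measurable_funX.
  by apply: measurable_funM; exact: measurable_funX.
have mc : measurable_fun setT c.
  by rewrite (_ : c = fun z => cone_pi (y z, r z)); [exact: measurable_cone_pi|apply/funext].
have -> : exp_mu mu phi = Pr (pushforward m2 c).
  apply: (congr1 (@Pr R n)); apply/funext => B.
  by rewrite /pushforward /mu_hat -q0E m1 expr1n invr1 mul1e.
rewrite (Pr_pushforward m2 mc cE mA) integral_mkcond.
have mry : measurable_fun setT ((fun z => ((r z)%:num ^+ 2)%:E) \_ (y @^-1` A)).
  apply: measurable_funT_restrict; last by apply/measurable_EFinP; exact: measurable_funX.
  by rewrite -[X in measurable X]setTI; exact: my.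
rewrite /m2 fubini_tonelli1 //; last first.
  by move=> z; rewrite patchE; case: ifP => // _; rewrite lee_fin sqr_ge0.
rewrite [RHS]integral_mkcond; apply: eq_integral => x _.
have Ey : y (x, q0) = exp_base phi x by rewrite /y /exp_base /= m1 !mul1r mulr1.
have Er : (r (x, q0))%:num ^+ 2 = exp_mass phi x.
  rewrite /r /exp_mass /= m1 sqr_sqrtr; first by rewrite mulr1 expr1n mul1r.
  by rewrite addr_ge0 ?sqr_ge0 // -exprMn sqr_ge0.
have md := @integral_dirac _ _ q0 R setT measurableT _ (measurableT_comp mry (measurable_pair1 x)).
rewrite diracT mul1e in md; rewrite [LHS]md /= !patchE Er.
by congr (if _ then _ else _); apply/idP/idP; rewrite !inE /= Ey.
Qed.

End ExpMu.
End ConePushforward.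

(** * Weak duality and explicit couplings *)

Section HKBounds.
Context {R : realType} {n : nat}.
Notation mu := (torus_volume R n).
Implicit Types (h : torus R n -> torus R n) (r P Q : torus R n -> R).

(** The marginal condition speaks of sets only; weak duality needs it for test functions. *)
Lemma integral_cone_radius (q : {measure set (cone R n * cone R n) -> \bar R})
    (pr : cone R n * cone R n -> cone R n) (m : set (torus R n) -> \bar R) h r (f : torus R n -> \bar R) :
  measurable_fun setT pr ->
  (forall A, measurable A -> Pr (pushforward q pr) A = m A) ->
  measurable_fun setT h -> measurable_fun setT r -> (forall x, 0 <= r x) ->
  (forall A, measurable A -> (m A = \int[mu]_(x in h @^-1` A) (r x)%:E)%E) ->
  measurable_fun setT f -> (forall x, (0 <= f x)%E) ->
  (\int[q]_p (f (cone_base0 (pr p)) * (cone_radius (pr p) ^+ 2)%:E) =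
   \int[mu]_x (f (h x) * (r x)%:E))%E.
Proof.
move=> mpr prq mh mr r0 mE mf f0.
have mb : measurable_fun setT (fun p => cone_base0 (pr p)).
  exact: measurableT_comp measurable_cone_base0 mpr.
have mrad : measurable_fun setT (fun p => cone_radius (pr p) ^+ 2).
  by apply: measurable_funX; exact: measurableT_comp measurable_cone_radius mpr.
apply: (eq_integral_density mb mh mrad mr) => // [p|A mA].
  exact: sqr_ge0.
rewrite -mE // -prq // (Pr_pushforward q mpr (y := fun p => cone_base0 (pr p))
  (r := fun p => (repr (pr p)).2)) // => p.
by rewrite cone_base0K.
Qed.

(** By the dual inequality the cost a^2 + b^2 - 2 a b cos is at least (1 - P) a^2 + (1 - Q) b^2, and
    the weights a^2 and b^2 integrate to the two marginals. *)
Lemma HK_coupling_lower (m0 m1 : set (torus R n) -> \bar R) h0 h1 r0 r1 P Q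
    (q : {measure set (cone R n * cone R n) -> \bar R}) :
  measurable_fun setT h0 -> measurable_fun setT h1 ->
  (forall A, measurable A -> (m0 A = \int[mu]_(x in h0 @^-1` A) (r0 x)%:E)%E) ->
  (forall A, measurable A -> (m1 A = \int[mu]_(x in h1 @^-1` A) (r1 x)%:E)%E) ->
  (forall x, 0 <= r0 x) -> (forall x, 0 <= r1 x) -> bm r0 -> bm r1 ->
  bm (P \o h0) -> bm (Q \o h1) -> measurable_fun setT P -> measurable_fun setT Q ->
  (forall x, 0 <= P x) -> (forall x, 0 <= Q x) ->
  (forall y z (a b : R), 0 <= a -> 0 <= b ->
     2 * a * b * cos (Num.min (torus_dist y z) pi) <= P y * a ^+ 2 + Q z * b ^+ 2) ->
  HK_coupling m0 m1 q ->
  ((expect r0 + expect r1 - expect (fun x => P (h0 x) * r0 x) - expect (fun x => Q (h1 x) * r1 x))%:E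
   <= \int[q]_p (cone_dist p.1 p.2 ^+ 2)%:E)%E.
Proof.
move=> mh0 mh1 m0E m1E r00 r10 br0 br1 bP bQ mP mQ P0 Q0 dual [_ q0 q1].
have [mr0 _] := br0; have [mr1 _] := br1.
have I0 := integral_cone_radius measurable_fst q0 mh0 mr0 r00 m0E.
have I1 := integral_cone_radius measurable_snd q1 mh1 mr1 r10 m1E.
have mone : measurable_fun setT (fun _ : torus R n => (1 : \bar R)%E) by exact: measurable_cst.
have A0 := I0 _ mone (fun=> lee01); have A1 := I1 _ mone (fun=> lee01).
have mEP : measurable_fun setT (fun x => (P x)%:E) by exact/measurable_EFinP.
have mEQ : measurable_fun setT (fun x => (Q x)%:E) by exact/measurable_EFinP.
have B0 := I0 _ mEP (fun x => P0 x : (0 <= (P x)%:E)%E).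
have B1 := I1 _ mEQ (fun x => Q0 x : (0 <= (Q x)%:E)%E).
have bPr : bm (fun x => P (h0 x) * r0 x) by exact: bm_mul bP br0.
have bQr : bm (fun x => Q (h1 x) * r1 x) by exact: bm_mul bQ br1.
have E0 : (\int[mu]_x (1 * (r0 x)%:E) = (expect r0)%:E)%E.
  by under eq_integral do rewrite mul1e; rewrite EFin_expect.
have E1 : (\int[mu]_x (1 * (r1 x)%:E) = (expect r1)%:E)%E.
  by under eq_integral do rewrite mul1e; rewrite EFin_expect.
have F0 : (\int[mu]_x ((P (h0 x))%:E * (r0 x)%:E) = (expect (fun x => P (h0 x) * r0 x)%R)%:E)%E.
  by rewrite EFin_expect //; apply: eq_integral => x _; rewrite EFinM.
have F1 : (\int[mu]_x ((Q (h1 x))%:E * (r1 x)%:E) = (expect (fun x => Q (h1 x) * r1 x)%R)%:E)%E.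
  by rewrite EFin_expect //; apply: eq_integral => x _; rewrite EFinM.
rewrite E0 in A0; rewrite E1 in A1; rewrite F0 in B0; rewrite F1 in B1.
have mR0 : measurable_fun setT (fun p : cone R n * cone R n => (cone_radius p.1 ^+ 2)%:E).
  by apply/measurable_EFinP/measurable_funX; exact: measurableT_comp measurable_cone_radius measurable_fst.
have mR1 : measurable_fun setT (fun p : cone R n * cone R n => (cone_radius p.2 ^+ 2)%:E).
  by apply/measurable_EFinP/measurable_funX; exact: measurableT_comp measurable_cone_radius measurable_snd.
have mP0 : measurable_fun setT (fun p : cone R n * cone R n => (P (cone_base0 p.1))%:E).
  by apply: measurableT_comp mEP _; exact: measurableT_comp measurable_cone_base0 measurable_fst.
have mQ1 : measurable_fun setT (fun p : cone R n * cone R n => (Q (cone_base0 p.2))%:E).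
  by apply: measurableT_comp mEQ _; exact: measurableT_comp measurable_cone_base0 measurable_snd.
have R00 (p : cone R n * cone R n) : (0 <= (cone_radius p.1 ^+ 2)%:E)%E by rewrite lee_fin sqr_ge0.
have R10 (p : cone R n * cone R n) : (0 <= (cone_radius p.2 ^+ 2)%:E)%E by rewrite lee_fin sqr_ge0.
have D0 (p : cone R n * cone R n) : (0 <= (cone_dist p.1 p.2 ^+ 2)%:E)%E by rewrite lee_fin sqr_ge0.
have mD : measurable_fun setT (fun p : cone R n * cone R n => (cone_dist p.1 p.2 ^+ 2)%:E).
  by apply/measurable_EFinP; exact: measurable_cone_dist2.
have PR0 (p : cone R n * cone R n) : (0 <= (P (cone_base0 p.1))%:E * (cone_radius p.1 ^+ 2)%:E)%E.
  by apply: mule_ge0; [rewrite lee_fin|exact: R00].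
have QR0 (p : cone R n * cone R n) : (0 <= (Q (cone_base0 p.2))%:E * (cone_radius p.2 ^+ 2)%:E)%E.
  by apply: mule_ge0; [rewrite lee_fin|exact: R10].
have mPR := emeasurable_funM mP0 mR0; have mQR := emeasurable_funM mQ1 mR1.
(* Written without subtraction, because the integral of the cost is not yet known to be finite. *)
have key : (\int[q]_p (1 * (cone_radius p.1 ^+ 2)%:E) + \int[q]_p (1 * (cone_radius p.2 ^+ 2)%:E)
   <= \int[q]_p (cone_dist p.1 p.2 ^+ 2)%:E
     + \int[q]_p ((P (cone_base0 p.1))%:E * (cone_radius p.1 ^+ 2)%:E)
     + \int[q]_p ((Q (cone_base0 p.2))%:E * (cone_radius p.2 ^+ 2)%:E))%E.
  under eq_integral do rewrite mul1e.
  under [X in (_ + X <= _)%E]eq_integral do rewrite mul1e.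
  have S1 := @ge0_integralD _ _ _ q setT measurableT _ _ (fun p _ => R00 p) mR0 (fun p _ => R10 p) mR1.
  have S2 := @ge0_integralD _ _ _ q setT measurableT _ _ (fun p _ => D0 p) mD (fun p _ => PR0 p) mPR.
  have S3 := @ge0_integralD _ _ _ q setT measurableT _ _
    (fun p _ => adde_ge0 (D0 p) (PR0 p)) (emeasurable_funD mD mPR) (fun p _ => QR0 p) mQR.
  rewrite -S1 -S2 -S3.
  apply: ge0_le_integral => //.
  - by move=> p _; rewrite adde_ge0.
  - exact: emeasurable_funD.
  - by apply: emeasurable_funD => //; exact: emeasurable_funD.
  move=> p _; rewrite -!EFinM -!EFinD lee_fin cone_dist2_base0.
  have := dual (cone_base0 p.1) (cone_base0 p.2) _ _ (cone_radius_ge0 p.1) (cone_radius_ge0 p.2).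
  lra.
move: key; rewrite A0 A1 B0 B1 -EFinD.
have : (0 <= \int[q]_p (cone_dist p.1 p.2 ^+ 2)%:E)%E by apply: integral_ge0.
case: (\int[q]_p _)%E => [v||] // _; rewrite ?leey // -!EFinD !lee_fin; lra.
Qed.

(** The coupling is the image of mu under the map sending x to the pair of cone points; its
    marginals follow from [Pr_pushforward]. *)
Lemma HK_coupling_upper (m0 m1 : set (torus R n) -> \bar R)
    (y0 y1 : torus R n -> torus R n) (s0 s1 : torus R n -> half_line R) :
  measurable_fun setT y0 -> measurable_fun setT y1 ->
  bm (fun x => (s0 x)%:num) -> bm (fun x => (s1 x)%:num) ->
  (forall A, measurable A -> (m0 A = \int[mu]_(x in y0 @^-1` A) ((s0 x)%:num ^+ 2)%:E)%E) ->
  (forall A, measurable A -> (m1 A = \int[mu]_(x in y1 @^-1` A) ((s1 x)%:num ^+ 2)%:E)%E) ->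
  exists2 q, HK_coupling m0 m1 q &
   (\int[q]_p (cone_dist p.1 p.2 ^+ 2)%:E =
    \int[mu]_x (cone_dist (cone_pi (y0 x, s0 x)) (cone_pi (y1 x, s1 x)) ^+ 2)%:E)%E.
Proof.
move=> my0 my1 bs0 bs1 m0E m1E.
have [ms0 _] := bs0; have [ms1 _] := bs1.
have mc0 := measurable_cone_pi my0 ms0; have mc1 := measurable_cone_pi my1 ms1.
have mF := measurable_fun_pair mc0 mc1.
pose F : {mfun torus R n >-> (cone R n * cone R n)%type} :=
  @mfun_Sub _ _ (torus R n) (cone R n * cone R n)%type _ (mem_set mF).
pose q : {measure set (cone R n * cone R n) -> \bar R} := distribution mu F.
exists q; last first.
  rewrite ge0_integral_distribution //.
  - by apply/measurable_EFinP; exact: measurable_cone_dist2.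
  - by move=> p; rewrite lee_fin sqr_ge0.
have apex0 : cone_radius (cone_pi (point : torus R n, sqrt_nng (0 : R))) = 0.
  by rewrite cone_radius_pi /= sqrtr0.
split.
(* Seen from the apex distances are radii, so the second moment is that of two bounded functions. *)
- exists (cone_pi (point, sqrt_nng 0), cone_pi (point, sqrt_nng 0)).
  have E (p : cone R n * cone R n) :
      cone2_dist (cone_pi (point, sqrt_nng 0), cone_pi (point, sqrt_nng 0)) p ^+ 2 =
      cone_radius p.1 ^+ 2 + cone_radius p.2 ^+ 2.
    rewrite /cone2_dist sqr_sqrtr ?addr_ge0 ?sqr_ge0 // !cone_dist2 /= apex0.
    by rewrite expr0n !(mulr0, mul0r) !subr0 !add0r.
  under eq_integral do rewrite E.
  rewrite ge0_integral_distribution //.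
  + apply: (@le_lt_trans _ _ (\int[mu]_x (1 + ((s0 x)%:num ^+ 2 + (s1 x)%:num ^+ 2))%:E)%E).
      by under eq_integral do rewrite /= !cone_radius_pi.
    have B : bm (fun x => 1 + ((s0 x)%:num ^+ 2 + (s1 x)%:num ^+ 2)).
      by apply: bm_add (bm_cst 1) _; apply: bm_add; exact: bm_X.
    by rewrite -EFin_expect // ltry.
  + apply/measurable_EFinP; apply: measurable_funD => //; apply: measurable_funD; apply: measurable_funX.
      exact: measurableT_comp measurable_cone_radius measurable_fst.
    exact: measurableT_comp measurable_cone_radius measurable_snd.
  + by move=> p; rewrite lee_fin !addr_ge0 ?sqr_ge0.
- move=> A mA; rewrite m0E // -(Pr_pushforward mu mc0 (fun x => erefl) mA).
  by [].
- move=> A mA; rewrite m1E // -(Pr_pushforward mu mc1 (fun x => erefl) mA).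
  by [].
Qed.

Lemma HK_bounds (m0 m1 : set (torus R n) -> \bar R) (l c : R) :
  (forall q, HK_coupling m0 m1 q -> (l%:E <= \int[q]_p (cone_dist p.1 p.2 ^+ 2)%:E)%E) ->
  (exists2 q, HK_coupling m0 m1 q & (\int[q]_p (cone_dist p.1 p.2 ^+ 2)%:E = c%:E)%E) ->
  exists2 v : R, (HK m0 m1 ^+ 2 = v%:E)%E & l <= v <= c.
Proof.
move=> lo [q0 hq0 q0c].
set S := [set (\int[q]_p (cone_dist p.1 p.2 ^+ 2)%:E)%E | q in HK_coupling m0 m1].
have h1 : (ereal_inf S <= c%:E)%E by apply: ereal_inf_lbound; exists q0.
have h2 : (l%:E <= ereal_inf S)%E by apply: le_ereal_inf_tmp => _ [q hq <-]; exact: lo.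
have h3 : (0 <= ereal_inf S)%E.
  by apply: le_ereal_inf_tmp => _ [q hq <-]; apply: integral_ge0 => p _; rewrite lee_fin sqr_ge0.
have : (HK m0 m1 ^+ 2 = ereal_inf S)%E by rewrite /HK -/S sqr_sqrte.
move: h1 h2 h3; case: (ereal_inf S) => [v||] //; rewrite !lee_fin => h1 h2 h3 ->.
by exists v => //; apply/andP.
Qed.

End HKBounds.

(** * Expansion of the cost of the coupling *)

Section Expansions.
Context {R : realType} {X : Type}.
Notation I := (R * R * X)%type.

Section LawOfCosines.
Variables A B p q m aw bw ww ta tb Sp Sq C nu : I -> R.
Hypotheses (HA : isO 1 (fun i => A i - 1)) (HB : isO 1 (fun i => B i - 1)).
Hypotheses (Hp : isO 2 (fun i => p i)) (Hq : isO 2 (fun i => q i)) (Hm : isO 2 (fun i => m i)).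
Hypotheses (Haw : isO 3 (fun i => aw i)) (Hbw : isO 3 (fun i => bw i)) (Hww : isO 4 (fun i => ww i)).
Hypotheses (Hta : isO 4 (fun i => ta i - (1 - p i / 3))) (Htb : isO 4 (fun i => tb i - (1 - q i / 3))).
Hypotheses (HSp : isO 5 (fun i => Sp i - (1 + p i / 2 - p i ^+ 2 / 8)))
  (HSq : isO 5 (fun i => Sq i - (1 + q i / 2 - q i ^+ 2 / 8))).
Hypothesis nuE : forall i, nu i = ta i ^+ 2 * p i + tb i ^+ 2 * q i + ww i
  - 2 * ta i * tb i * m i - 2 * ta i * aw i + 2 * tb i * bw i.
Hypothesis HC : isO 5 (fun i => C i - (1 - nu i / 2 + nu i ^+ 2 / 24)).

(** Here a and b stand for the gradients of s phi at x and t psi at eta x, divided by A and B, and W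
    for the displacement of eta; p, q, m, aw, bw and ww are scalar products of these vectors, and C
    is the cosine of the distance of the end points. For W = 0 and parallel a, b the two square
    roots times the cosine give exactly 1 + m, since the cone over a line is flat; (p q - m^2) / 6
    measures the failure to be parallel. *)
Lemma law_of_cosines : isO 5 (fun i => A i * B i * Sp i * Sq i * C i -
  (A i * B i * (1 + m i - (p i * q i - m i ^+ 2) / 6 + aw i - bw i) - ww i / 2)).
Proof.
have Ha2 : isO 4 (fun i => ta i ^+ 2 - (1 - 2 * p i / 3)).
  refine (isO_by (g := fun i => (ta i - (1 - p i / 3)) * ((ta i - (1 - p i / 3)) + 2 * (1 - p i / 3)) + p i ^+ 2 / 9) _ _); [intros j; by field|bigO].
have Hb2 : isO 4 (fun i => tb i ^+ 2 - (1 - 2 * q i / 3)).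
  refine (isO_by (g := fun i => (tb i - (1 - q i / 3)) * ((tb i - (1 - q i / 3)) + 2 * (1 - q i / 3)) + q i ^+ 2 / 9) _ _); [intros j; by field|bigO].
have Hab : isO 4 (fun i => ta i * tb i - (1 - (p i + q i) / 3)).
  refine (isO_by (g := fun i => (ta i - (1 - p i / 3)) * ((tb i - (1 - q i / 3)) + (1 - q i / 3))
    + (1 - p i / 3) * (tb i - (1 - q i / 3)) + p i * q i / 9) _ _); [intros j; by field|bigO].
have Ha1 : isO 2 (fun i => ta i - 1).
  refine (isO_by (g := fun i => (ta i - (1 - p i / 3)) - p i / 3) _ _); [intros j; by field|bigO].
have Hb1 : isO 2 (fun i => tb i - 1).
  refine (isO_by (g := fun i => (tb i - (1 - q i / 3)) - q i / 3) _ _); [intros j; by field|bigO].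
pose nu1 (i : I) := p i - 2 * p i ^+ 2 / 3 + q i - 2 * q i ^+ 2 / 3 - 2 * m i
   + 2 * (p i + q i) * m i / 3 + ww i - 2 * aw i + 2 * bw i.
have Hnu : isO 5 (fun i => nu i - nu1 i).
  refine (isO_by (g := fun i => p i * (ta i ^+ 2 - (1 - 2 * p i / 3)) + q i * (tb i ^+ 2 - (1 - 2 * q i / 3))
   - 2 * m i * (ta i * tb i - (1 - (p i + q i) / 3)) - 2 * aw i * (ta i - 1) + 2 * bw i * (tb i - 1)) _ _).
    intros j; by rewrite nuE /nu1; field.
  bigO.
have Hnu0 : isO 3 (fun i => nu i - (p i + q i - 2 * m i)).
  refine (isO_by (g := fun i => (nu i - nu1 i) + (- 2 * p i ^+ 2 / 3 - 2 * q i ^+ 2 / 3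
   + 2 * (p i + q i) * m i / 3 + ww i - 2 * aw i + 2 * bw i)) _ _); [intros j; by rewrite /nu1; field|bigO].
(* The expansions are graded: [c1] and [x1] collect the terms of order 2, [c2] and [x2] those of
   orders 3 and 4. *)
pose c1 (i : I) := - (p i + q i - 2 * m i) / 2.
pose c2 (i : I) := p i ^+ 2 / 3 + q i ^+ 2 / 3 - (p i + q i) * m i / 3 - ww i / 2 + aw i - bw i
   + (p i + q i - 2 * m i) ^+ 2 / 24.
have HC1 : isO 5 (fun i => C i - (1 + c1 i + c2 i)).
  refine (isO_by (g := fun i => (C i - (1 - nu i / 2 + nu i ^+ 2 / 24)) - (nu i - nu1 i) / 2
    + (nu i - (p i + q i - 2 * m i)) * ((nu i - (p i + q i - 2 * m i)) + 2 * (p i + q i - 2 * m i)) / 24) _ _);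
    [intros j; by rewrite /nu1 /c1 /c2; field|bigO].
pose x1 (i : I) := (p i + q i) / 2.
pose x2 (i : I) := - (p i ^+ 2 + q i ^+ 2) / 8 + p i * q i / 4.
have HS : isO 5 (fun i => Sp i * Sq i - (1 + x1 i + x2 i)).
  refine (isO_by (g := fun i => (Sp i - (1 + p i / 2 - p i ^+ 2 / 8)) * ((Sq i - (1 + q i / 2 - q i ^+ 2 / 8)) + (1 + q i / 2 - q i ^+ 2 / 8))
     + (1 + p i / 2 - p i ^+ 2 / 8) * (Sq i - (1 + q i / 2 - q i ^+ 2 / 8))
     - p i * q i ^+ 2 / 16 - q i * p i ^+ 2 / 16 + p i ^+ 2 * q i ^+ 2 / 64) _ _); [intros j; by rewrite /x1 /x2; field|bigO].
have Hc1 : isO 2 c1 by rewrite /c1; bigO.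
have Hc2 : isO 3 c2 by rewrite /c2; bigO.
have Hx1 : isO 2 x1 by rewrite /x1; bigO.
have Hx2 : isO 4 x2 by rewrite /x2; bigO.
have HSC : isO 5 (fun i => Sp i * Sq i * C i - (1 + m i - (p i * q i - m i ^+ 2) / 6 + aw i - bw i - ww i / 2)).
  refine (isO_by (g := fun i => (Sp i * Sq i - (1 + x1 i + x2 i)) * ((C i - (1 + c1 i + c2 i)) + (1 + c1 i + c2 i))
    + (1 + x1 i + x2 i) * (C i - (1 + c1 i + c2 i)) + x1 i * c2 i + x2 i * (c1 i + c2 i)) _ _).
    intros j; by rewrite /x1 /x2 /c1 /c2; field.
  bigO.
refine (isO_by (g := fun i => ((A i - 1) + 1) * ((B i - 1) + 1) *
   (Sp i * Sq i * C i - (1 + m i - (p i * q i - m i ^+ 2) / 6 + aw i - bw i - ww i / 2))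
   - ((A i - 1) * B i + (B i - 1)) * ww i / 2) _ _); first by intros j; by field.
have HB0 : isO 0 (fun i => B i).
  refine (isO_by (g := fun i => (B i - 1) + 1) _ _); [intros j; ring|bigO].
bigO.
Qed.
End LawOfCosines.
End Expansions.

(* Unlike [mulr_sumr], this cannot unfold a trigonometric polynomial into a sum over its terms. *)
Lemma mulr_sumF (R : pzRingType) (J : finType) (a : R) (F : J -> R) :
  a * (\sum_j F j) = \sum_j a * F j.
Proof. exact: mulr_sumr. Qed.

(** * Expansions of the exponential map and of the flow *)

Section TorusExpansions.
Context {R : realType} {n : nat}.
Notation I := (R * R * torus R n)%type.
Notation trig := (seq (R * 'rV[int]_n * R)).

Global Instance isO_tev (T : trig) (h : I -> torus R n) : isO 0 (fun i => tev T (h i)) | 1.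
Proof. by apply: (isO_ub (c := tbound T)) => i; exact: tev_le. Qed.

Lemma isO_taylor2 k T (y : I -> torus R n) (v : I -> 'rV[R]_n) :
  (forall p, isO k (fun i => v i 0 p)) ->
  isO (2 * k)%N (fun i => tev T (torus_exp (y i) (v i)) - tev T (y i)
    - \sum_p tev (tD p T) (y i) * v i 0 p).
Proof.
move=> Hv; apply: (isO_le (g := fun i => tbound2 T * \sum_p v i 0 p ^+ 2)).
  move=> i; rewrite (le_trans (tev_taylor _ _ _)) // ler_norm //.
have H : isO (2 * k)%N (fun i => \sum_p v i 0 p ^+ 2) by apply: isO_sum => p; exact: isO_X.
exact: (isO_mul (isO_cst (tbound2 T)) H).
Qed.

Lemma isO_taylor1 k T (y : I -> torus R n) (v : I -> 'rV[R]_n) :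
  (forall p, isO k (fun i => v i 0 p)) ->
  isO k (fun i => tev T (torus_exp (y i) (v i)) - tev T (y i)).
Proof.
move=> Hv; have [C C0 HC] := @tev_lip R n T.
apply: (isO_le (g := fun i => C * \sum_p `|v i 0 p|)).
  by move=> i; rewrite (le_trans (HC _ _)) // ler_norm.
have H : isO k (fun i => \sum_p `|v i 0 p|).
  by apply: isO_sum => p; apply: isO_le (Hv p) => i; rewrite normr_id.
exact: (isO_mul (isO_cst C) H).
Qed.

Section ExpExpansion.
Variables (r : I -> R) (T : trig) (y : I -> torus R n).
Hypothesis Hr : isO 1 (fun i => r i).

(** For the potential r T at y, [eA] is the radial and [ev_] the tangential part of the point
    reached in the cone. The norm of [ea] is the tangent of the angle covered, [edisp] is the
    displacement on the torus and [erad] the new radius. *)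
Definition eA i := 1 + 2 * r i * tev T (y i).
Definition ev_ i p := r i * tev (tD p T) (y i).
Definition ea i p := ev_ i p / eA i.
Definition ep i := \sum_p ea i p ^+ 2.
(* [etheta] is atan r / r at r^2 = [ep], continued by 1 to r = 0. *)
Definition etheta i := if ep i == 0 then 1 else atan (Num.sqrt (ep i)) / Num.sqrt (ep i).
Definition eN i := Num.sqrt (\sum_p ev_ i p ^+ 2).
Definition edisp i p := atan (eN i / eA i) / eN i * ev_ i p.
Definition erad i := Num.sqrt (eA i ^+ 2 + eN i ^+ 2).

Lemma exp_base_edisp i :
  exp_base (fun x => r i * tev T x) (y i) = torus_exp (y i) (\row_p edisp i p).
Proof.
have E : grad (fun x => r i * tev T x) (y i) = \row_p ev_ i p.
  rewrite (_ : (fun x => _) = tev (tscale (r i) T)).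
    by rewrite grad_tev; apply/rowP => p; rewrite !mxE /tev tevalD_scale.
  by apply/funext => x; rewrite /tev teval_scale.
rewrite /exp_base E; congr torus_exp; apply/rowP => p; rewrite !mxE /edisp.
have -> : enorm (\row_p0 ev_ i p0) = eN i.
  by rewrite /enorm /edot /eN; congr Num.sqrt; apply: eq_bigr => q _; rewrite !mxE expr2.
by rewrite /eA mulrA.
Qed.

Lemma exp_mass_eA i :
  exp_mass (fun x => r i * tev T x) (y i) = eA i ^+ 2 + \sum_p ev_ i p ^+ 2.
Proof.
rewrite /exp_mass (_ : (fun x => _) = tev (tscale (r i) T)); last first.
  by apply/funext => x; rewrite /tev teval_scale.
rewrite grad_tev /enorm sqr_sqrtr; last first.
  by apply: sumr_ge0 => p _; rewrite -expr2 sqr_ge0.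
rewrite /eA mulrA; congr (_ + _); apply: eq_bigr => p _.
by rewrite !mxE /tev tevalD_scale expr2.
Qed.

Lemma exp_mass_erad i : exp_mass (fun x => r i * tev T x) (y i) = erad i ^+ 2.
Proof.
rewrite exp_mass_eA /erad sqr_sqrtr ?addr_ge0 ?sqr_ge0 // /eN sqr_sqrtr //.
by apply: sumr_ge0 => p _; exact: sqr_ge0.
Qed.

Lemma isO_ev_ p : isO 1 (fun i => ev_ i p). Proof. by rewrite /ev_; bigO. Qed.

Lemma isO_eA : isO 1 (fun i => eA i - 1).
Proof. by rewrite /eA; asO (fun i => 2 * r i * tev T (y i)); move=> i; ring. Qed.

Lemma near_eA : ev (fun i => 1 / 2 <= eA i).
Proof.
have h : 0 < 1 / 2 :> R by lra.
apply: ev_imp (isO_small _ h isO_eA) => // i; rewrite ler_norml => /andP[]; lra.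
Qed.

Lemma isO_ea p : isO 1 (fun i => ea i p).
Proof.
rewrite /ea -[1%N]addn0; apply: isO_mul; first exact: isO_ev_.
apply: (isO_eq (g := fun i => (1 + (eA i - 1))^-1)); last exact: isO_inv isO_eA.
by move=> i; rewrite addrC subrK.
Qed.

Lemma near_ea : ev (fun i => forall p, eA i * ea i p = ev_ i p).
Proof.
apply: ev_imp near_eA => i h p; rewrite /ea mulrC divfK // gt_eqF //; lra.
Qed.

Lemma ep_ge0 i : 0 <= ep i.
Proof. by apply: sumr_ge0 => p _; exact: sqr_ge0. Qed.

Lemma isO_ep : isO 2 (fun i => ep i).
Proof.
by rewrite /ep; apply: isO_sum => p; have H := isO_ea p; bigO.
Qed.

Lemma isO_etheta : isO 4 (fun i => etheta i - (1 - ep i / 3)).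
Proof.
apply: (isO_le (g := fun i => ep i ^+ 2)); last by have H := isO_ep; bigO.
move=> i; rewrite /etheta; have e0 := ep_ge0 i.
rewrite [leRHS]ger0_norm ?sqr_ge0 //.
have [->|ne0] := eqVneq (ep i) 0; first by rewrite mul0r subr0 subrr normr0 expr0n.
set x := Num.sqrt (ep i).
have x0 : 0 < x by rewrite sqrtr_gt0 lt_neqAle eq_sym ne0.
have x2 : ep i = x ^+ 2 by rewrite sqr_sqrtr.
rewrite x2.
have -> : atan x / x - (1 - x ^+ 2 / 3) = (atan x - (x - x ^+ 3 / 3)) / x.
  by field; rewrite gt_eqF.
rewrite normf_div (gtr0_norm x0) ler_pdivrMr //.
apply: (le_trans (atan_taylor (ltW x0))).
by rewrite -exprM -exprSr.
Qed.

(** The quotient in [edisp] degenerates at critical points of T, where it is only the vanishing of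
    the gradient that matters; the right-hand side admits expansions that are uniform across
    them. *)
Lemma near_edisp : ev (fun i => forall p, edisp i p = etheta i * ea i p).
Proof.
apply: ev_imp (ev_and near_ea near_eA) => i [h A0] p.
have A1 : 0 < eA i by lra.
have NE : eN i = eA i * Num.sqrt (ep i).
  rewrite /eN -{1}[eA i]ger0_norm ?(ltW A1) // -sqrtr_sqr -sqrtrM ?sqr_ge0 //.
  congr Num.sqrt; rewrite /ep mulr_sumr; apply: eq_bigr => q _.
  by rewrite -exprMn h.
rewrite /edisp /etheta NE -h.
have [e0|e0] := eqVneq (ep i) 0.
  have -> : ea i p = 0.
    have := ep_ge0 i; rewrite le_eqVlt eq_sym e0 eqxx /= => _.
    move/eqP: e0; rewrite psumr_eq0 => [/allP/(_ p)|q _]; last exact: sqr_ge0.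
    by rewrite mem_index_enum sqrf_eq0 => /(_ isT)/eqP.
  by rewrite !mulr0.
have s0 : Num.sqrt (ep i) != 0.
  by rewrite gt_eqF // sqrtr_gt0 lt_neqAle eq_sym e0 ep_ge0.
have -> : eA i * Num.sqrt (ep i) / eA i = Num.sqrt (ep i) by field; rewrite gt_eqF.
by field; rewrite s0 gt_eqF.
Qed.

Lemma near_erad : ev (fun i => erad i = eA i * Num.sqrt (1 + ep i)).
Proof.
apply: ev_imp (ev_and near_ea near_eA) => i [h A0].
have A1 : 0 <= eA i by lra.
rewrite /erad -{2}[eA i]ger0_norm // -sqrtr_sqr -sqrtrM ?sqr_ge0 //.
congr Num.sqrt; rewrite mulrDr mulr1 /eN sqr_sqrtr; last first.
  by apply: sumr_ge0 => p _; exact: sqr_ge0.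
congr (_ + _); rewrite /ep mulr_sumr; apply: eq_bigr => q _.
by rewrite -exprMn h.
Qed.

Lemma isO_sqrt_ep : isO 6 (fun i => Num.sqrt (1 + ep i) - (1 + ep i / 2 - ep i ^+ 2 / 8)).
Proof. exact: (@isO_sqrt1D _ _ 2 _ isT isO_ep). Qed.

Lemma isO_ea2 p : isO 3 (fun i => ea i p - (ev_ i p - 2 * r i * tev T (y i) * ev_ i p)).
Proof.
have H := isO_ea p; have H1 := isO_ev_ p.
apply: (isO_near (g := fun i => (2 * r i * tev T (y i)) ^+ 2 * ea i p)); last by bigO.
apply: ev_imp near_ea => i h; rewrite -h /eA; ring.
Qed.

Lemma isO_edisp2 p : isO 3 (fun i => edisp i p - (ev_ i p - 2 * r i * tev T (y i) * ev_ i p)).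
Proof.
have H := isO_ea p; have H1 := isO_ev_ p; have H2 := isO_ea2 p; have H3 := isO_etheta; have H4 := isO_ep.
apply: (isO_near (g := fun i => (etheta i - (1 - ep i / 3)) * ea i p - ep i / 3 * ea i p +
   (ea i p - (ev_ i p - 2 * r i * tev T (y i) * ev_ i p)))); last by bigO.
by apply: ev_imp near_edisp => i h; rewrite h; field.
Qed.

Lemma isO_edisp p : isO 1 (fun i => edisp i p).
Proof.
have H1 := isO_ev_ p; have H2 := isO_edisp2 p.
asO (fun i => (edisp i p - (ev_ i p - 2 * r i * tev T (y i) * ev_ i p)) + (ev_ i p - 2 * r i * tev T (y i) * ev_ i p)).
by move=> i; ring.
Qed.

Lemma isO_erad2 : isO 3 (fun i => erad i - (1 + 2 * r i * tev T (y i) + (\sum_p ev_ i p ^+ 2) / 2)).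
Proof.
have H := isO_ep; have H1 := isO_sqrt_ep; have H2 := isO_eA.
have H3 : isO 3 (fun i => ep i - \sum_p ev_ i p ^+ 2).
  apply: (isO_near (g := fun i => \sum_p (1 - eA i) * (1 + eA i) * ea i p ^+ 2)).
    apply: ev_imp near_ea => i h; rewrite /ep -sumrB; apply: eq_bigr => p _.
    by rewrite -h; ring.
  apply: isO_sum => p; have H4 := isO_ea p.
  by asO (fun i => - (eA i - 1) * ((eA i - 1) + 2) * ea i p ^+ 2); move=> i; ring.
apply: (isO_near (g := fun i => ((eA i - 1) + 1) * (Num.sqrt (1 + ep i) - (1 + ep i / 2 - ep i ^+ 2 / 8))
   + (eA i - 1) * (ep i / 2 - ep i ^+ 2 / 8) - ep i ^+ 2 / 8 + (ep i - \sum_p ev_ i p ^+ 2) / 2)); last by bigO.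
by apply: ev_imp near_erad => i ->; rewrite /eA; field.
Qed.

Lemma isO_erad : isO 0 (fun i => erad i).
Proof.
have H2 := isO_erad2.
have H3 : isO 2 (fun i => \sum_p ev_ i p ^+ 2) by apply: isO_sum => p; have H := isO_ev_ p; bigO.
asO (fun i => (erad i - (1 + 2 * r i * tev T (y i) + (\sum_p ev_ i p ^+ 2) / 2)) + (1 + 2 * r i * tev T (y i) + (\sum_p ev_ i p ^+ 2) / 2)).
by move=> i; ring.
Qed.

End ExpExpansion.

Section FlowExpansion.
Variable w : 'I_n -> trig.
Notation e i := (i.1.1 * i.1.2).

(** Each shear has size O (s t) and is evaluated at a point already displaced by O (s t), so the
    interaction of the shears is of order 4. *)
Lemma isO_flow_disp_list (ps : seq 'I_n) q : isO 4 (fun i : I =>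
  flow_disp w (e i) ps i.2 0 q - e i * \sum_(p <- ps) (p == q)%:R * tev (w p) i.2).
Proof.
elim: ps q => [|p ps IH] q.
  by apply: isO_eq (isO_zero _) => i; rewrite big_nil /= mxE; ring.
have IH2 q' : isO 2 (fun i : I => flow_disp w (e i) ps i.2 0 q').
  have H := IH q'.
  have H2 : isO 0 (fun i : I => \sum_(p <- ps) (p == q')%:R * tev (w p) i.2).
    by rewrite /=; elim: (ps) => [|p' ps' IH'];
      [apply: isO_eq (isO_zero _) => i; rewrite big_nil|
       asO (fun i : I => (p' == q')%:R * tev (w p') i.2 + \sum_(p <- ps') (p == q')%:R * tev (w p) i.2);
         move=> i; rewrite big_cons].
  asO (fun i : I => (flow_disp w (e i) ps i.2 0 q' - e i * \sum_(p <- ps) (p == q')%:R * tev (w p) i.2)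
    + e i * \sum_(p <- ps) (p == q')%:R * tev (w p) i.2).
  by move=> i; ring.
have Ht := isO_taylor1 (w p) (fun i => i.2) IH2.
have H := IH q.
asO (fun i : I => (flow_disp w (e i) ps i.2 0 q - e i * \sum_(p <- ps) (p == q)%:R * tev (w p) i.2)
  + e i * (tev (w p) (torus_exp i.2 (flow_disp w (e i) ps i.2)) - tev (w p) i.2) * (p == q)%:R).
by move=> i; rewrite big_cons /= !mxE /= (eq_sym q p); ring.
Qed.

Definition fd (i : I) : 'rV[R]_n := flow_disp w (e i) (index_enum _) i.2.
Definition fJ (i : I) : R := flow_jac w (e i) (index_enum _) i.2.

Lemma isO_fd q : isO 4 (fun i => fd i 0 q - e i * tev (w q) i.2).
Proof.
have H := isO_flow_disp_list (index_enum _) q.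
refine (isO_by (g := fun i : I => flow_disp w (e i) (index_enum _) i.2 0 q - e i * \sum_(p <- index_enum _) (p == q)%:R * tev (w p) i.2) _ _); last by bigO.
move=> i; congr (_ - _ * _); rewrite (bigD1 q) //= eqxx mul1r big1 ?addr0 // => p pq.
by rewrite (negPf pq) mul0r.
Qed.

Lemma isO_fd1 q : isO 2 (fun i => fd i 0 q).
Proof.
have H := isO_fd q.
by asO (fun i => (fd i 0 q - e i * tev (w q) i.2) + e i * tev (w q) i.2); move=> i; ring.
Qed.

Lemma isO_flow_disp_list1 (ps : seq 'I_n) q : isO 2 (fun i : I => flow_disp w (e i) ps i.2 0 q).
Proof.
elim: ps q => [|p ps IH] q; first by apply: isO_eq (isO_zero _) => i; rewrite /= mxE.
have H := IH q.
asO (fun i : I => flow_disp w (e i) ps i.2 0 q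
  + e i * tev (w p) (torus_exp i.2 (flow_disp w (e i) ps i.2)) * (p == q)%:R).
by move=> i; rewrite /= !mxE /= (eq_sym q p).
Qed.

Lemma isO_flow_jac_list (ps : seq 'I_n) : isO 4 (fun i : I =>
  flow_jac w (e i) ps i.2 - 1 - e i * \sum_(p <- ps) tev (tD p (w p)) i.2).
Proof.
elim: ps => [|p ps IH].
  by apply: isO_eq (isO_zero _) => i; rewrite big_nil /=; ring.
have Ht := isO_taylor1 (tD p (w p)) (fun i => i.2) (isO_flow_disp_list1 ps).
have H2 : isO 0 (fun i : I => \sum_(p <- ps) tev (tD p (w p)) i.2).
  by elim: (ps) => [|p' ps' IH'];
    [apply: isO_eq (isO_zero _) => i; rewrite big_nil|
     asO (fun i : I => tev (tD p' (w p')) i.2 + \sum_(p <- ps') tev (tD p (w p)) i.2);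
       move=> i; rewrite big_cons].
asO (fun i : I => (1 + e i * tev (tD p (w p)) (torus_exp i.2 (flow_disp w (e i) ps i.2))) *
   (flow_jac w (e i) ps i.2 - 1 - e i * \sum_(p <- ps) tev (tD p (w p)) i.2)
   + e i * (tev (tD p (w p)) (torus_exp i.2 (flow_disp w (e i) ps i.2)) - tev (tD p (w p)) i.2)
   + e i * tev (tD p (w p)) (torus_exp i.2 (flow_disp w (e i) ps i.2)) * (e i * \sum_(p <- ps) tev (tD p (w p)) i.2)).
by move=> i; rewrite big_cons /=; ring.
Qed.

Lemma isO_fJ : isO 4 (fun i => fJ i - 1 - e i * \sum_p tev (tD p (w p)) i.2).
Proof. exact: isO_flow_jac_list. Qed.

End FlowExpansion.
End TorusExpansions.

Section GammaAlgebra.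
Context {R : realType} {X : Type}.
Notation I := (R * R * X)%type.
Notation s i := (i.1.1). Notation t i := (i.1.2).

Variables f g sff sgg sfg sfw sgw sfgw sww dw : I -> R.
Hypotheses (Hf : isO 0 (fun i => f i)) (Hg : isO 0 (fun i => g i)) (Hsff : isO 0 (fun i => sff i))
  (Hsgg : isO 0 (fun i => sgg i)) (Hsfg : isO 0 (fun i => sfg i)) (Hsfw : isO 0 (fun i => sfw i))
  (Hsgw : isO 0 (fun i => sgw i)) (Hsfgw : isO 0 (fun i => sfgw i)) (Hsww : isO 0 (fun i => sww i))
  (Hdw : isO 0 (fun i => dw i)).

Variables AB ABm ABx ABaw ABbw ww Rr J lam : I -> R.
Hypotheses
  (HAB : isO 5 (fun i => AB i - (1 + 2 * s i * f i) * (1 + 2 * t i * g i + 2 * t i * (s i * t i) * sgw i)))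
  (HABm : isO 5 (fun i => ABm i - (s i * t i * sfg i + s i * t i * (s i * t i) * sfgw i)))
  (HABx : isO 5 (fun i => ABx i - s i ^+ 2 * t i ^+ 2 * (sff i * sgg i - sfg i ^+ 2)))
  (HABaw : isO 5 (fun i => ABaw i - (1 + 2 * t i * g i) * s i * (s i * t i) * sfw i))
  (HABbw : isO 5 (fun i => ABbw i - (1 + 2 * s i * f i) * t i * (s i * t i) * sgw i))
  (Hww : isO 5 (fun i => ww i - (s i * t i) ^+ 2 * sww i))
  (HRr : isO 5 (fun i => Rr i - (AB i + ABm i - ABx i / 6 + ABaw i - ABbw i - ww i / 2)))
  (HJ : isO 4 (fun i => J i - 1 - s i * t i * dw i))
  (Hlam : isO 5 (fun i => lam i - (1 + (J i - 1) / 2 - (J i - 1) ^+ 2 / 8))).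

(* Expansion of the product of the two radii with the cosine of the distance, except for the term
   (J - 1) / 2, which has mean zero. *)
Definition gamma_poly (i : I) : R :=
  (1 + 2 * s i * f i) * (1 + 2 * t i * g i) + s i * t i * sfg i
  + (s i * t i) * ((1 + 2 * s i * f i) * t i * sgw i + (1 + 2 * t i * g i) * s i * sfw i
      + s i * t i * sfgw i)
  - s i ^+ 2 * t i ^+ 2 * (sff i * sgg i - sfg i ^+ 2) / 6
  - (s i * t i) ^+ 2 * sww i / 2 - (s i * t i) ^+ 2 * dw i ^+ 2 / 8
  + s i * t i * dw i / 2 * (2 * s i * f i + 2 * t i * g i + 4 * s i * t i * f i * g i + s i * t i * sfg i).

(** The expansion of J is known to order 4, one order too few. Hence (J - 1) / 2 is kept as it
    stands, while all other occurrences of J - 1 are multiplied by something small. *)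
Lemma gamma_algebra : isO 5 (fun i => lam i * Rr i - ((J i - 1) / 2 + gamma_poly i)).
Proof.
pose P i := (1 + 2 * s i * f i) * (1 + 2 * t i * g i) + s i * t i * sfg i
  + (s i * t i) * ((1 + 2 * s i * f i) * t i * sgw i + (1 + 2 * t i * g i) * s i * sfw i
      + s i * t i * sfgw i)
  - s i ^+ 2 * t i ^+ 2 * (sff i * sgg i - sfg i ^+ 2) / 6
  - (s i * t i) ^+ 2 * sww i / 2.
have HR : isO 5 (fun i => Rr i - P i).
  asO (fun i => (Rr i - (AB i + ABm i - ABx i / 6 + ABaw i - ABbw i - ww i / 2))
    + (AB i - (1 + 2 * s i * f i) * (1 + 2 * t i * g i + 2 * t i * (s i * t i) * sgw i))
    + (ABm i - (s i * t i * sfg i + s i * t i * (s i * t i) * sfgw i))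
    - (ABx i - s i ^+ 2 * t i ^+ 2 * (sff i * sgg i - sfg i ^+ 2)) / 6
    + (ABaw i - (1 + 2 * t i * g i) * s i * (s i * t i) * sfw i)
    - (ABbw i - (1 + 2 * s i * f i) * t i * (s i * t i) * sgw i)
    - (ww i - (s i * t i) ^+ 2 * sww i) / 2).
  by move=> i; rewrite /P; field.
have HP3 : isO 3 (fun i => P i - 1 - (2 * s i * f i + 2 * t i * g i + 4 * s i * t i * f i * g i + s i * t i * sfg i)).
  asO (fun i => (s i * t i) * ((1 + 2 * s i * f i) * t i * sgw i + (1 + 2 * t i * g i) * s i * sfw i
      + s i * t i * sfgw i)
  - s i ^+ 2 * t i ^+ 2 * (sff i * sgg i - sfg i ^+ 2) / 6
  - (s i * t i) ^+ 2 * sww i / 2).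
  by move=> i; rewrite /P; field.
have HP1 : isO 1 (fun i => P i - 1).
  asO (fun i => (P i - 1 - (2 * s i * f i + 2 * t i * g i + 4 * s i * t i * f i * g i + s i * t i * sfg i))
    + (2 * s i * f i + 2 * t i * g i + 4 * s i * t i * f i * g i + s i * t i * sfg i)).
  by move=> i; ring.
have HJ2 : isO 2 (fun i => J i - 1).
  by asO (fun i => (J i - 1 - s i * t i * dw i) + s i * t i * dw i); move=> i; ring.
have Hl : isO 4 (fun i => lam i - 1 - s i * t i * dw i / 2).
  asO (fun i => (lam i - (1 + (J i - 1) / 2 - (J i - 1) ^+ 2 / 8)) + (J i - 1 - s i * t i * dw i) / 2 - (J i - 1) ^+ 2 / 8).
  by move=> i; field.
have Hl0 : isO 0 (fun i => lam i).
  by asO (fun i => (lam i - 1 - s i * t i * dw i / 2) + (1 + s i * t i * dw i / 2)); move=> i; ring.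
asO (fun i => lam i * (Rr i - P i)
  + (lam i - 1 - s i * t i * dw i / 2) * (P i - 1)
  + s i * t i * dw i / 2 * (P i - 1 - (2 * s i * f i + 2 * t i * g i + 4 * s i * t i * f i * g i + s i * t i * sfg i))
  + (lam i - (1 + (J i - 1) / 2 - (J i - 1) ^+ 2 / 8))
  - (J i - 1 - s i * t i * dw i) * ((J i - 1 - s i * t i * dw i) + 2 * (s i * t i * dw i)) / 8).
by move=> i; rewrite /P /gamma_poly; field.
Qed.
End GammaAlgebra.

(** * The cross term of the cost along the coupling *)

Section GammaExpansion.
Context {R : realType} {n : nat}.
Notation I := (R * R * torus R n)%type.
Notation trig := (seq (R * 'rV[int]_n * R)).
Variables (F G : trig) (w : 'I_n -> trig).
Notation s i := (i.1.1). Notation t i := (i.1.2).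
Notation e i := (i.1.1 * i.1.2).

Definition Eta (i : I) : torus R n := torus_exp i.2 (fd w i).
Definition px (i : I) : torus R n := i.2.
Definition ps (i : I) : R := i.1.1.
Definition pt (i : I) : R := i.1.2.

Let f (i : I) := tev F i.2. Let g (i : I) := tev G i.2.
Let f1 p (i : I) := tev (tD p F) i.2. Let g1 p (i : I) := tev (tD p G) i.2.
Let g2 p q (i : I) := tev (tD q (tD p G)) i.2.
Let w0 p (i : I) := tev (w p) i.2.
Let A := eA ps F px. Let a := ea ps F px.
Let B := eA pt G Eta. Let b := ea pt G Eta.
Let W (i : I) p := fd w i 0 p.

Let Hs : isO 1 ps. Proof. exact: isO_s. Qed.
Let Ht : isO 1 pt. Proof. exact: isO_t. Qed.

Definition disp_diff (i : I) p := edisp ps F px i p - W i p - edisp pt G Eta i p.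
Definition disp2 (i : I) := \sum_p disp_diff i p ^+ 2.
(** Half of the cross term in the squared cone distance of the two end points, when the second
    radius carries the factor sqrt J that preserves its mass under eta. *)
Definition gam (i : I) := Num.sqrt (fJ w i) * (erad ps F px i * erad pt G Eta i * cos (Num.sqrt (disp2 i))).

Definition sfg (x : torus R n) := \sum_p tev (tD p F) x * tev (tD p G) x.
Definition sff (x : torus R n) := \sum_p tev (tD p F) x ^+ 2.
Definition sgg (x : torus R n) := \sum_p tev (tD p G) x ^+ 2.
Definition sfw (x : torus R n) := \sum_p tev (tD p F) x * tev (w p) x.
Definition sgw (x : torus R n) := \sum_p tev (tD p G) x * tev (w p) x.
Definition sfgw (x : torus R n) := \sum_p \sum_q tev (tD p F) x * tev (tD q (tD p G)) x * tev (w q) x.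
Definition sww (x : torus R n) := \sum_p tev (w p) x ^+ 2.
Definition dw (x : torus R n) := \sum_p tev (tD p (w p)) x.

Let Hw p : isO 2 (fun i => W i p). Proof. exact: isO_fd1. Qed.
Let Hw4 p : isO 4 (fun i => W i p - e i * w0 p i). Proof. exact: isO_fd. Qed.
Let Ha p : isO 1 (fun i => a i p). Proof. exact: (isO_ea F px Hs p). Qed.
Let Hb p : isO 1 (fun i => b i p). Proof. exact: (isO_ea G Eta Ht p). Qed.

Let HG1 T : isO 2 (fun i => tev T (Eta i) - tev T i.2).
Proof. exact: (isO_taylor1 T (fun i : I => i.2) Hw). Qed.
Let HG2 T : isO 4 (fun i => tev T (Eta i) - tev T i.2 - \sum_p tev (tD p T) i.2 * W i p).
Proof. exact: (isO_taylor2 T (fun i : I => i.2) Hw). Qed.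

Let near_ab : ev (fun i : I => (forall p, A i * a i p = ps i * f1 p i) /\
   (forall p, B i * b i p = pt i * tev (tD p G) (Eta i))).
Proof. exact: ev_and (near_ea F px Hs) (near_ea G Eta Ht). Qed.

Let HA : isO 1 (fun i => A i - 1). Proof. exact: isO_eA. Qed.
Let HB : isO 1 (fun i => B i - 1). Proof. exact: isO_eA. Qed.
Let HA0 : isO 0 (fun i => A i).
Proof. by have H := HA; asO (fun i => (A i - 1) + 1); move=> i; ring. Qed.
Let HB0 : isO 0 (fun i => B i).
Proof. by have H := HB; asO (fun i => (B i - 1) + 1); move=> i; ring. Qed.

Let m i := \sum_p a i p * b i p.
Let aw i := \sum_p a i p * W i p.
Let bw i := \sum_p b i p * W i p.
Let ww i := \sum_p W i p ^+ 2.
Let p2 := ep ps F px. Let q2 := ep pt G Eta.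

Let Hm : isO 2 (fun i => m i).
Proof. by apply: isO_sum => p; have := Ha p; have := Hb p => ? ?; bigO. Qed.
Let Haw : isO 3 (fun i => aw i).
Proof. by apply: isO_sum => p; have := Ha p; have := Hw p => ? ?; bigO. Qed.
Let Hbw : isO 3 (fun i => bw i).
Proof. by apply: isO_sum => p; have := Hb p; have := Hw p => ? ?; bigO. Qed.
Let Hww : isO 4 (fun i => ww i).
Proof. by apply: isO_sum => p; have := Hw p => ?; bigO. Qed.

(** The factor A B clears the denominators of a and b; what remains is the Taylor expansion of the
    gradient of G at eta x. *)
Lemma isO_ABm : isO 5 (fun i => A i * B i * m i - (e i * sfg i.2 + e i * e i * sfgw i.2)).
Proof.
apply: (isO_near (g := fun i => \sum_p (s i * t i * f1 p i * (tev (tD p G) (Eta i) - tev (tD p G) i.2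
    - \sum_q tev (tD q (tD p G)) i.2 * W i q)
    + s i * t i * f1 p i * \sum_q g2 p q i * (W i q - e i * w0 q i)))).
  apply: ev_imp near_ab => i [hA hB].
  rewrite /m /sfg /sfgw !mulr_sumF -!big_split /= -sumrB; apply: eq_bigr => p _.
  have -> : A i * B i * (a i p * b i p) = (A i * a i p) * (B i * b i p) by ring.
  rewrite hA hB /f1 /g2 /w0 /ps /pt.
  have -> : \sum_q tev (tD q (tD p G)) i.2 * (W i q - e i * tev (w q) i.2) =
     \sum_q tev (tD q (tD p G)) i.2 * W i q - \sum_q tev (tD q (tD p G)) i.2 * (e i * tev (w q) i.2).
    by rewrite -sumrB; apply: eq_bigr => q _; ring.
  have -> : e i * e i * \sum_q tev (tD p F) i.2 * tev (tD q (tD p G)) i.2 * tev (w q) i.2 =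
     s i * t i * tev (tD p F) i.2 * \sum_q tev (tD q (tD p G)) i.2 * (e i * tev (w q) i.2).
    by rewrite !mulr_sumF; apply: eq_bigr => q _; ring.
  ring.
apply: isO_sum => p; have H := HG2 (tD p G).
have H2 : isO 4 (fun i : I => \sum_q g2 p q i * (W i q - e i * w0 q i)).
  by apply: isO_sum => q; have H3 := Hw4 q; rewrite /g2; bigO.
by rewrite /f1; bigO.
Qed.

Lemma isO_ABaw : isO 5 (fun i => A i * B i * aw i - (1 + 2 * t i * g i) * s i * e i * sfw i.2).
Proof.
apply: (isO_near (g := fun i => \sum_p (2 * t i * (tev G (Eta i) - tev G i.2) * (s i * f1 p i) * W i p
   + (1 + 2 * t i * g i) * s i * f1 p i * (W i p - e i * w0 p i)))).
  apply: ev_imp near_ab => i [hA hB].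
  rewrite /aw /sfw !mulr_sumF -sumrB; apply: eq_bigr => p _.
  have -> : A i * B i * (a i p * W i p) = B i * (A i * a i p) * W i p by ring.
  by rewrite hA /B /eA /f1 /g /w0 /ps /pt; ring.
by apply: isO_sum => p; have H := HG1 G; have H1 := Hw p; have H2 := Hw4 p; rewrite /f1 /g; bigO.
Qed.

Lemma isO_ABbw : isO 5 (fun i => A i * B i * bw i - (1 + 2 * s i * f i) * t i * e i * sgw i.2).
Proof.
apply: (isO_near (g := fun i => \sum_p ((1 + 2 * s i * f i) * t i * (tev (tD p G) (Eta i) - tev (tD p G) i.2) * W i p
   + (1 + 2 * s i * f i) * t i * g1 p i * (W i p - e i * w0 p i)))).
  apply: ev_imp near_ab => i [hA hB].
  rewrite /bw /sgw !mulr_sumF -sumrB; apply: eq_bigr => p _.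
  have -> : A i * B i * (b i p * W i p) = A i * (B i * b i p) * W i p by ring.
  by rewrite hB /A /eA /f /g1 /w0 /ps /pt /px; ring.
by apply: isO_sum => p; have H := HG1 (tD p G); have H1 := Hw p; have H2 := Hw4 p; rewrite /g1 /f; bigO.
Qed.

Lemma isO_AB : isO 5 (fun i => A i * B i - (1 + 2 * s i * f i) * (1 + 2 * t i * g i + 2 * t i * e i * sgw i.2)).
Proof.
have H := HG2 G.
have H2 : isO 4 (fun i : I => \sum_p g1 p i * (W i p - e i * w0 p i)).
  by apply: isO_sum => q; have H2 := Hw4 q; rewrite /g1; bigO.
refine (isO_by (g := fun i => (1 + 2 * s i * f i) * (2 * t i) * ((tev G (Eta i) - tev G i.2 - \sum_p tev (tD p G) i.2 * W i p)
   + \sum_p g1 p i * (W i p - e i * w0 p i))) _ _); last by rewrite /f; bigO.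
move=> i; rewrite /A /B /eA /f /g /g1 /w0 /ps /pt /px.
have -> : \sum_p tev (tD p G) i.2 * (W i p - e i * tev (w p) i.2) =
    \sum_p tev (tD p G) i.2 * W i p - e i * sgw i.2.
  by rewrite /sgw mulr_sumF -sumrB; apply: eq_bigr => p _; ring.
ring.
Qed.

Lemma isO_ww : isO 5 (fun i => ww i - e i ^+ 2 * sww i.2).
Proof.
apply: (isO_eq (g := fun i => \sum_p (W i p - e i * w0 p i) * ((W i p - e i * w0 p i) + 2 * (e i * w0 p i)))).
  move=> i; rewrite /ww /sww mulr_sumF -sumrB; apply: eq_bigr => p _; rewrite /w0; ring.
by apply: isO_sum => p; have H := Hw4 p; rewrite /w0; bigO.
Qed.

(** Clearing denominators takes A^2 B^2; replacing one factor A B by 1 costs an order on a term of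
    order 4. *)
Lemma isO_ABx : isO 5 (fun i => A i * B i * (p2 i * q2 i - m i ^+ 2) - s i ^+ 2 * t i ^+ 2 * (sff i.2 * sgg i.2 - sfg i.2 ^+ 2)).
Proof.
have Hp := isO_ep F px Hs; have Hq := isO_ep G Eta Ht.
have H1 := HA; have H2 := HB; have H3 := HB0; have H4 := Hm; have H5 := HA0.
have K1 : isO 2 (fun i : I => \sum_p (tev (tD p G) (Eta i) ^+ 2 - tev (tD p G) i.2 ^+ 2)).
  apply: isO_sum => p; have H := HG1 (tD p G).
  asO (fun i : I => (tev (tD p G) (Eta i) - tev (tD p G) i.2) * (tev (tD p G) (Eta i) + tev (tD p G) i.2)).
  by move=> i; ring.
have K2 : isO 2 (fun i : I => \sum_p f1 p i * (tev (tD p G) (Eta i) - tev (tD p G) i.2)).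
  by apply: isO_sum => p; have H := HG1 (tD p G); rewrite /f1; bigO.
have K3 : isO 0 (fun i : I => sff i.2) by rewrite /sff; bigO.
have K4 : isO 0 (fun i : I => sfg i.2) by rewrite /sfg; bigO.
apply: (isO_near (g := fun i => - ((A i - 1) * B i + (B i - 1)) * (A i * B i) * (p2 i * q2 i - m i ^+ 2)
   + s i ^+ 2 * t i ^+ 2 * (sff i.2 * (\sum_p (tev (tD p G) (Eta i) ^+ 2 - tev (tD p G) i.2 ^+ 2))
     - (\sum_p f1 p i * (tev (tD p G) (Eta i) - tev (tD p G) i.2)) *
       ((\sum_p f1 p i * (tev (tD p G) (Eta i) - tev (tD p G) i.2)) + 2 * sfg i.2)))); last first.
  by rewrite /p2 /q2; bigO.
apply: ev_imp near_ab => i [hA hB].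
have E1 : A i ^+ 2 * p2 i = s i ^+ 2 * sff i.2.
  by rewrite /p2 /ep /sff !mulr_sumF; apply: eq_bigr => p _; rewrite -!exprMn hA.
have E2 : B i ^+ 2 * q2 i = t i ^+ 2 * (sgg i.2 + \sum_p (tev (tD p G) (Eta i) ^+ 2 - tev (tD p G) i.2 ^+ 2)).
  rewrite /q2 /ep /sgg -big_split /= !mulr_sumF; apply: eq_bigr => p _.
  by rewrite -!exprMn hB /pt exprMn addrC subrK.
have E3 : A i * B i * m i = s i * t i * (sfg i.2 + \sum_p f1 p i * (tev (tD p G) (Eta i) - tev (tD p G) i.2)).
  rewrite /m /sfg -big_split /= !mulr_sumF; apply: eq_bigr => p _.
  have -> : A i * B i * (a i p * b i p) = (A i * a i p) * (B i * b i p) by ring.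
  by rewrite hA hB /f1 /ps /pt; ring.
have E4 : A i ^+ 2 * B i ^+ 2 * (p2 i * q2 i - m i ^+ 2) =
   s i ^+ 2 * t i ^+ 2 * (sff i.2 * (sgg i.2 + \sum_p (tev (tD p G) (Eta i) ^+ 2 - tev (tD p G) i.2 ^+ 2))
     - (sfg i.2 + \sum_p f1 p i * (tev (tD p G) (Eta i) - tev (tD p G) i.2)) ^+ 2).
  have -> : A i ^+ 2 * B i ^+ 2 * (p2 i * q2 i - m i ^+ 2) =
    (A i ^+ 2 * p2 i) * (B i ^+ 2 * q2 i) - (A i * B i * m i) ^+ 2 by ring.
  by rewrite E1 E2 E3; ring.
transitivity (A i * B i * (p2 i * q2 i - m i ^+ 2) - A i ^+ 2 * B i ^+ 2 * (p2 i * q2 i - m i ^+ 2)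
   + s i ^+ 2 * t i ^+ 2 * (sff i.2 * (\sum_p (tev (tD p G) (Eta i) ^+ 2 - tev (tD p G) i.2 ^+ 2))
     - (\sum_p f1 p i * (tev (tD p G) (Eta i) - tev (tD p G) i.2)) *
       ((\sum_p f1 p i * (tev (tD p G) (Eta i) - tev (tD p G) i.2)) + 2 * sfg i.2))).
  by rewrite E4; ring.
by ring.
Qed.

Definition gpoly (i : I) := gamma_poly f g (fun i => sff i.2) (fun i => sgg i.2) (fun i => sfg i.2)
  (fun i => sfw i.2) (fun i => sgw i.2) (fun i => sfgw i.2) (fun i => sww i.2) (fun i => dw i.2) i.

Lemma isO_gam : isO 5 (fun i => gam i - ((fJ w i - 1) / 2 + gpoly i)).
Proof.
(* The smooth form of [disp2], to which it is equal for small s + t by [near_edisp]. *)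
pose nu' i := \sum_p (etheta ps F px i * a i p - W i p - etheta pt G Eta i * b i p) ^+ 2.
have nu'E i : nu' i = etheta ps F px i ^+ 2 * p2 i + etheta pt G Eta i ^+ 2 * q2 i + ww i
  - 2 * etheta ps F px i * etheta pt G Eta i * m i - 2 * etheta ps F px i * aw i + 2 * etheta pt G Eta i * bw i.
  rewrite /p2 /q2 /ep /ww /m /aw /bw !mulr_sumF -!big_split /= -!sumrB -big_split /=.
  by apply: eq_bigr => p _; rewrite -/(a i p) -/(b i p); ring.
have Hp := isO_ep F px Hs; have Hq := isO_ep G Eta Ht.
have Hta := isO_etheta F px Hs; have Htb := isO_etheta G Eta Ht.
have nu'2 : isO 2 nu'.
  apply: isO_sum => p; have H1 := Ha p; have H2 := Hb p; have H3 := Hw p.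
  have T1 : isO 0 (fun i => etheta ps F px i).
    by asO (fun i => (etheta ps F px i - (1 - ep ps F px i / 3)) + (1 - ep ps F px i / 3)); move=> i; ring.
  have T2 : isO 0 (fun i => etheta pt G Eta i).
    by asO (fun i => (etheta pt G Eta i - (1 - ep pt G Eta i / 3)) + (1 - ep pt G Eta i / 3)); move=> i; ring.
  by bigO.
have nu'0 i : 0 <= nu' i by apply: sumr_ge0 => p _; exact: sqr_ge0.
have HC := isO_cos_sqrt nu'0 nu'2.
have LC := @law_of_cosines R (torus R n) A B p2 q2 m aw bw ww (etheta ps F px) (etheta pt G Eta)
  (fun i => Num.sqrt (1 + p2 i)) (fun i => Num.sqrt (1 + q2 i)) (fun i => cos (Num.sqrt (nu' i))) nu'
  HA HB Hp Hq Hm Haw Hbw Hww Hta Htb (isO_weak (j := 5) (isO_sqrt_ep F px Hs) isT)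
  (isO_weak (j := 5) (isO_sqrt_ep G Eta Ht) isT) nu'E (isO_weak (j := 5) HC isT).
have HJ := isO_fJ w.
have HJ2 : isO 2 (fun i => fJ w i - 1).
  have H : isO 0 (fun i : I => \sum_p tev (tD p (w p)) i.2) by bigO.
  by asO (fun i => (fJ w i - 1 - e i * \sum_p tev (tD p (w p)) i.2) + e i * \sum_p tev (tD p (w p)) i.2); move=> i; ring.
have Hlam := isO_sqrt1D (k := 2) isT HJ2.
have K1 : isO 0 (fun i : I => sff i.2) by rewrite /sff; bigO.
have K2 : isO 0 (fun i : I => sgg i.2) by rewrite /sgg; bigO.
have K3 : isO 0 (fun i : I => sfg i.2) by rewrite /sfg; bigO.
have K4 : isO 0 (fun i : I => sfw i.2) by rewrite /sfw; bigO.
have K5 : isO 0 (fun i : I => sgw i.2) by rewrite /sgw; bigO.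
have K6 : isO 0 (fun i : I => sfgw i.2).
  by apply: isO_sum => p; bigO.
have K7 : isO 0 (fun i : I => sww i.2) by rewrite /sww; bigO.
have K8 : isO 0 (fun i : I => dw i.2) by rewrite /dw; bigO.
have GA := @gamma_algebra R (torus R n) f g _ _ _ _ _ _ _ _ (isO_tev _ _) (isO_tev _ _) K1 K2 K3 K4 K5 K6 K7 K8
  _ _ _ _ _ _ (fun i => erad ps F px i * erad pt G Eta i * cos (Num.sqrt (disp2 i))) (fJ w)
  (fun i => Num.sqrt (fJ w i)) isO_AB isO_ABm isO_ABx isO_ABaw isO_ABbw isO_ww.
apply: GA => //; last first.
  have := isO_weak (j := 5) Hlam isT.
  by apply: isO_eq => i; have -> : 1 + (fJ w i - 1) = fJ w i by ring.
apply: isO_near LC.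
apply: ev_imp (ev_and (ev_and (near_edisp F px Hs) (near_edisp G Eta Ht))
  (ev_and (near_erad F px Hs) (near_erad G Eta Ht))) => i [[h1 h2] [h3 h4]].
have -> : disp2 i = nu' i.
  by apply: eq_bigr => p _; rewrite /disp_diff h1 h2.
rewrite h3 h4 -/(A i) -/(B i) -/(p2 i) -/(q2 i); by field.
Qed.

End GammaExpansion.

(** * The dual potentials *)

Section DualPotentials.
Context {R : realType} {n : nat}.
Notation I := (R * R * torus R n)%type.
Notation trig := (seq (R * 'rV[int]_n * R)).
Variables (F G K : trig).
Notation s i := (i.1.1). Notation t i := (i.1.2).

(* The second-order coefficients of the dual potential are forced by [isO_balance] and [isO_disp_dual_disp]
   below, which make the duality gap small. *)
Definition pot_st : trig := K ++ tsum (fun q => tmul (tD q F) (tD q G)).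
Definition pot_ss : trig := tscale (-2) (tmul F F) ++ tscale (-1) (tsum (fun q => tmul (tD q F) (tD q F))).
Definition pot_tt : trig := tscale 2 (tmul G G).

(** The operator acts on every coefficient, so one formula gives the potential ([op] = id) and all
    of its derivatives. *)
Definition dual_pot (op : trig -> trig) (i : I) : R :=
  2 * s i * tev (op F) i.2 - 2 * t i * tev (op G) i.2 + s i * t i * tev (op pot_st) i.2
  + s i ^+ 2 * tev (op pot_ss) i.2 + t i ^+ 2 * tev (op pot_tt) i.2.

(* An approximate minimizer v of |v|^2 + |v|^4 / 6 - [dual_pot] at z + v. *)
Definition dual_disp (i : I) : 'rV[R]_n := \row_p (dual_pot (tD p) i / 2 +
  \sum_q (s i * tev (tD q (tD p F)) i.2 - t i * tev (tD q (tD p G)) i.2) *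
         (s i * tev (tD q F) i.2 - t i * tev (tD q G) i.2)).

Definition dual_disp2 (i : I) := \sum_p dual_disp i 0 p ^+ 2.
(** The value at [dual_disp] exceeds the infimum over all displacements by O (tau^6), which the last
    term absorbs: no exact minimization is needed for a valid dual pair. *)
Definition dual_conj (Kc : R) (i : I) : R :=
  dual_disp2 i + dual_disp2 i ^+ 2 / 6 - dual_pot id (i.1, torus_exp i.2 (dual_disp i)) - Kc * stsize i ^+ 6.

Lemma isO_alc1 op (y : I -> torus R n) :
  isO 2 (fun i => dual_pot op (i.1, y i) - 2 * (s i * tev (op F) (y i) - t i * tev (op G) (y i))).
Proof.
asO (fun i : I => s i * t i * tev (op pot_st) (y i) + s i ^+ 2 * tev (op pot_ss) (y i) + t i ^+ 2 * tev (op pot_tt) (y i)).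
by move=> i; rewrite /dual_pot /=; ring.
Qed.

Lemma isO_dual_pot_taylor2 k op (y : I -> torus R n) (v : I -> 'rV[R]_n) :
  (forall p, isO k (fun i => v i 0 p)) ->
  isO (1 + 2 * k)%N (fun i => dual_pot op (i.1, torus_exp (y i) (v i)) - dual_pot op (i.1, y i)
    - \sum_p dual_pot (fun T => tD p (op T)) (i.1, y i) * v i 0 p).
Proof.
move=> Hv; have H T := isO_taylor2 T y Hv.
pose r T i := tev T (torus_exp (y i) (v i)) - tev T (y i) - \sum_p tev (tD p T) (y i) * v i 0 p.
have Hr T : isO (2 * k)%N (r T) by exact: H.
have R1 := Hr (op F); have R2 := Hr (op G); have R3 := Hr (op pot_st); have R4 := Hr (op pot_ss); have R5 := Hr (op pot_tt).
have B : isO (1 + 2 * k)%N (fun i => 2 * s i * r (op F) i - 2 * t i * r (op G) i + s i * t i * r (op pot_st) i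
  + s i ^+ 2 * r (op pot_ss) i + t i ^+ 2 * r (op pot_tt) i).
  (* Since k is a variable, comparing the orders takes a rewriting step instead of mere
     computation. *)
  unfold bigOh; eapply isO_weak; [typeclasses eauto | ].
  by rewrite !leq_min !leq_add2r.
apply: isO_eq B => i; rewrite /r.
have -> : \sum_p dual_pot (fun T => tD p (op T)) (i.1, y i) * v i 0 p =
   2 * s i * (\sum_p tev (tD p (op F)) (y i) * v i 0 p) - 2 * t i * (\sum_p tev (tD p (op G)) (y i) * v i 0 p)
   + s i * t i * (\sum_p tev (tD p (op pot_st)) (y i) * v i 0 p)
  + s i ^+ 2 * (\sum_p tev (tD p (op pot_ss)) (y i) * v i 0 p) + t i ^+ 2 * (\sum_p tev (tD p (op pot_tt)) (y i) * v i 0 p).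
  rewrite !mulr_sumF -sumrB -!big_split /=; apply: eq_bigr => p _; rewrite /dual_pot /=; ring.
rewrite /dual_pot /=; ring.
Qed.

Lemma isO_hvec2 p : isO 2 (fun i => dual_disp i 0 p - (s i * tev (tD p F) i.2 - t i * tev (tD p G) i.2)).
Proof.
have H := isO_alc1 (tD p) (fun i => i.2).
have H2 : isO 2 (fun i : I => \sum_q (s i * tev (tD q (tD p F)) i.2 - t i * tev (tD q (tD p G)) i.2) *
         (s i * tev (tD q F) i.2 - t i * tev (tD q G) i.2)).
  by apply: isO_sum => q; bigO.
asO (fun i : I => (dual_pot (tD p) (i.1, i.2) - 2 * (s i * tev (tD p F) i.2 - t i * tev (tD p G) i.2)) / 2 +
   \sum_q (s i * tev (tD q (tD p F)) i.2 - t i * tev (tD q (tD p G)) i.2) *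
         (s i * tev (tD q F) i.2 - t i * tev (tD q G) i.2)).
by move=> i; rewrite mxE -surjective_pairing; field.
Qed.

Lemma isO_dual_disp p : isO 1 (fun i => dual_disp i 0 p).
Proof.
have H := isO_hvec2 p.
asO (fun i : I => (dual_disp i 0 p - (s i * tev (tD p F) i.2 - t i * tev (tD p G) i.2)) +
  (s i * tev (tD p F) i.2 - t i * tev (tD p G) i.2)).
by move=> i; ring.
Qed.

Lemma isO_dual_disp2 : isO 2 (fun i => dual_disp2 i).
Proof. by apply: isO_sum => p; have H := isO_dual_disp p; bigO. Qed.

Definition dual_defect p (i : I) := 2 * dual_disp i 0 p - dual_pot (tD p) (i.1, torus_exp i.2 (dual_disp i)).

(** To second order [dual_disp] is the second iterate, from 0, of v |-> grad alpha (z + v) / 2,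
    whose fixed points are critical for |v|^2 - alpha (z + v); the next correction is of order 3. *)
Lemma isO_dual_defect p : isO 3 (fun i => dual_defect p i).
Proof.
have H := isO_dual_pot_taylor2 (tD p) (fun i : I => i.2) isO_dual_disp.
have H1 : isO 3 (fun i : I => \sum_q (dual_pot (fun T => tD q (tD p T)) (i.1, i.2) -
    2 * (s i * tev (tD q (tD p F)) i.2 - t i * tev (tD q (tD p G)) i.2)) * dual_disp i 0 q).
  apply: isO_sum => q; have A := isO_alc1 (fun T => tD q (tD p T)) (fun i => i.2); have B := isO_dual_disp q; bigO.
have H2 : isO 3 (fun i : I => \sum_q (s i * tev (tD q (tD p F)) i.2 - t i * tev (tD q (tD p G)) i.2) *
    (dual_disp i 0 q - (s i * tev (tD q F) i.2 - t i * tev (tD q G) i.2))).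
  by apply: isO_sum => q; have B := isO_hvec2 q; bigO.
asO (fun i : I => - (dual_pot (tD p) (i.1, torus_exp i.2 (dual_disp i)) - dual_pot (tD p) (i.1, i.2)
    - \sum_q dual_pot (fun T => tD q (tD p T)) (i.1, i.2) * dual_disp i 0 q)
  - (\sum_q (dual_pot (fun T => tD q (tD p T)) (i.1, i.2) -
    2 * (s i * tev (tD q (tD p F)) i.2 - t i * tev (tD q (tD p G)) i.2)) * dual_disp i 0 q)
  - 2 * \sum_q (s i * tev (tD q (tD p F)) i.2 - t i * tev (tD q (tD p G)) i.2) *
    (dual_disp i 0 q - (s i * tev (tD q F) i.2 - t i * tev (tD q G) i.2))).
move=> i; rewrite /dual_defect {1}mxE -surjective_pairing.
have -> : (\sum_q (dual_pot (fun T => tD q (tD p T)) i -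
    2 * (s i * tev (tD q (tD p F)) i.2 - t i * tev (tD q (tD p G)) i.2)) * dual_disp i 0 q) =
  \sum_q dual_pot (fun T => tD q (tD p T)) i * dual_disp i 0 q
  - 2 * (\sum_q (s i * tev (tD q (tD p F)) i.2 - t i * tev (tD q (tD p G)) i.2) * (dual_disp i 0 q -
       (s i * tev (tD q F) i.2 - t i * tev (tD q G) i.2)))
  - 2 * (\sum_q (s i * tev (tD q (tD p F)) i.2 - t i * tev (tD q (tD p G)) i.2) *
       (s i * tev (tD q F) i.2 - t i * tev (tD q G) i.2)).
  rewrite !mulr_sumF -!sumrB; apply: eq_bigr => q _; ring.
by field.
Qed.

(** Second derivatives of alpha are O (tau), so half of |v|^2 dominates the Taylor remainder. This
    holds for every v, which makes the quadratic comparison below global. *)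
Lemma near_dual_pot_taylor : ev (fun i : I => forall y (v : 'rV[R]_n),
  `|dual_pot id (i.1, torus_exp y v) - dual_pot id (i.1, y) - \sum_p dual_pot (tD p) (i.1, y) * v 0 p|
  <= 1 / 2 * \sum_p v 0 p ^+ 2).
Proof.
pose c (i : I) := `|2 * s i| * tbound2 F + `|2 * t i| * tbound2 G + `|s i * t i| * tbound2 pot_st
  + `|s i ^+ 2| * tbound2 pot_ss + `|t i ^+ 2| * tbound2 pot_tt.
have Hn k (u : I -> R) : isO k u -> isO k (fun i => `|u i|).
  by move=> H; apply: isO_le H => i; rewrite normr_id.
have N1 : isO 1 (fun i : I => `|2 * s i|) by apply: Hn; bigO.
have N2 : isO 1 (fun i : I => `|2 * t i|) by apply: Hn; bigO.
have N3 : isO 1 (fun i : I => `|s i * t i|) by apply: Hn; bigO.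
have N4 : isO 1 (fun i : I => `|s i ^+ 2|) by apply: Hn; bigO.
have N5 : isO 1 (fun i : I => `|t i ^+ 2|) by apply: Hn; bigO.
have Hc : isO 1 c by rewrite /c; bigO.
have h : 0 < 1 / 2 :> R by lra.
apply: ev_imp (isO_small _ h Hc) => // i hc y v.
have S0 : 0 <= \sum_p v 0 p ^+ 2 by apply: sumr_ge0 => p _; exact: sqr_ge0.
apply: (le_trans _ (ler_wpM2r S0 (le_trans (ler_norm _) hc))).
pose r T := tev T (torus_exp y v) - tev T y - \sum_p tev (tD p T) y * v 0 p.
have -> : dual_pot id (i.1, torus_exp y v) - dual_pot id (i.1, y) - \sum_p dual_pot (tD p) (i.1, y) * v 0 p =
   2 * s i * r F - 2 * t i * r G + s i * t i * r pot_st + s i ^+ 2 * r pot_ss + t i ^+ 2 * r pot_tt.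
  have -> : \sum_p dual_pot (tD p) (i.1, y) * v 0 p =
     2 * s i * (\sum_p tev (tD p F) y * v 0 p) - 2 * t i * (\sum_p tev (tD p G) y * v 0 p)
     + s i * t i * (\sum_p tev (tD p pot_st) y * v 0 p)
    + s i ^+ 2 * (\sum_p tev (tD p pot_ss) y * v 0 p) + t i ^+ 2 * (\sum_p tev (tD p pot_tt) y * v 0 p).
    rewrite !mulr_sumF -sumrB -!big_split /=; apply: eq_bigr => p _; rewrite /dual_pot /=; ring.
  rewrite /r /dual_pot /=; ring.
have Hr T a : `|a * r T| <= `|a| * tbound2 T * \sum_p v 0 p ^+ 2.
  by rewrite normrM -mulrA ler_wpM2l // tev_taylor.
set S := \sum_p v 0 p ^+ 2 in Hr *.
rewrite (_ : c i * S = `|2 * s i| * tbound2 F * S + `|2 * t i| * tbound2 G * S + `|s i * t i| * tbound2 pot_st * S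
  + `|s i ^+ 2| * tbound2 pot_ss * S + `|t i ^+ 2| * tbound2 pot_tt * S); last by rewrite /c; ring.
do 3! (apply: (le_trans (ler_normD _ _)); apply: lerD; last exact: Hr).
by apply: (le_trans (ler_normB _ _)); apply: lerD; exact: Hr.
Qed.

(* Completing the square around [dual_disp], whose stationarity defect is O (tau^3). *)
Lemma dual_quadratic : exists2 Kc : R, 0 <= Kc & ev (fun i : I => forall v : 'rV[R]_n,
  dual_conj Kc i <= \sum_p v 0 p ^+ 2 + (\sum_p v 0 p ^+ 2) ^+ 2 / 6 - dual_pot id (i.1, torus_exp i.2 v)).
Proof.
pose E p i := dual_defect p i + 2 / 3 * dual_disp2 i * dual_disp i 0 p.
have HE : isO 6 (fun i => (\sum_p E p i ^+ 2) / 2).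
  have H p : isO 3 (E p).
    by have A := isO_dual_defect p; have B := isO_dual_disp p; have C := isO_dual_disp2; rewrite /E; bigO.
  have H6 : isO 6 (fun i => \sum_p E p i ^+ 2) by apply: isO_sum => p; have Hp := H p; bigO.
  by bigO.
have [Kc K0 HK] := HE; exists Kc => //.
apply: ev_imp (ev_and HK near_dual_pot_taylor) => i [hK hT] v.
pose D := v - dual_disp i.
have vE : v = dual_disp i + D by rewrite /D addrC subrK.
have := hT (torus_exp i.2 (dual_disp i)) D; rewrite torus_expD -vE.
set al1 := dual_pot id _; set al0 := dual_pot id _; rewrite ler_norml => /andP[_ T2].
have {hK} hK := le_trans (ler_norm _) hK.
rewrite /dual_conj -/al0.
set N := \sum_p v 0 p ^+ 2; set D2 := \sum_p D 0 p ^+ 2 in T2.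
set hD := \sum_p dual_disp i 0 p * D 0 p.
have NE : N = dual_disp2 i + 2 * hD + D2.
  rewrite /N /dual_disp2 /hD /D2 mulr_sumF -!big_split /=; apply: eq_bigr => p _.
  by rewrite vE !mxE; ring.
have D20 : 0 <= D2 by apply: sumr_ge0 => p _; exact: sqr_ge0.
have h0 : 0 <= dual_disp2 i by apply: sumr_ge0 => p _; exact: sqr_ge0.
have key : - ((\sum_p E p i ^+ 2) / 2) <= 2 * hD + 2 / 3 * dual_disp2 i * hD
   - (\sum_p dual_pot (tD p) (i.1, torus_exp i.2 (dual_disp i)) * D 0 p) + D2 / 2.
  rewrite -subr_ge0.
  have -> : 2 * hD + 2 / 3 * dual_disp2 i * hD
   - (\sum_p dual_pot (tD p) (i.1, torus_exp i.2 (dual_disp i)) * D 0 p) + D2 / 2 - - ((\sum_p E p i ^+ 2) / 2) =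
    \sum_p (E p i + D 0 p) ^+ 2 / 2.
    rewrite /E; move: (dual_disp2 i) => Q.
    rewrite /hD /D2 !mulr_sumF !mulr_suml opprK -big_split -sumrB -!big_split /=.
    apply: eq_bigr => p _; by rewrite /dual_defect; field.
  by apply: sumr_ge0 => p _; rewrite divr_ge0 ?sqr_ge0.
(* Convexity of the square: N^2 lies above its tangent at the squared norm of [dual_disp], and D2 >=
   0 may be dropped. *)
have N2 : 2 * dual_disp2 i * (2 * hD) <= N ^+ 2 - dual_disp2 i ^+ 2.
  have := sqr_ge0 (N - dual_disp2 i); have := mulr_ge0 h0 D20; rewrite NE; lra.
move: T2 key N2 hK; rewrite NE; move: (\sum_p dual_pot _ _ * _) => S.
set X := (dual_disp2 i + 2 * hD + D2) ^+ 2; lra.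
Qed.

(** Since alpha + beta <= r^2 + r^4 / 6, [cos_le_exp] bounds the cosine by exp (- alpha / 2) exp (-
    beta / 2), and 2 u v <= u^2 + v^2 concludes. For r > pi the cosine is -1. *)
Lemma dual_inequality : exists2 Kc : R, 0 <= Kc & exists2 e : R, 0 < e &
  forall s t : R, 0 < s -> 0 < t -> s + t <= e -> forall y z (a b : R), 0 <= a -> 0 <= b ->
   2 * a * b * cos (Num.min (torus_dist y z) pi) <=
     expR (- dual_pot id (s, t, y)) * a ^+ 2 + expR (- dual_conj Kc (s, t, z)) * b ^+ 2.
Proof.
have [Kc K0 [e e0 He]] := dual_quadratic; exists Kc => //; exists e => // s t s0 t0 ste y z a b a0 b0.
have [h [-> -> _]] := torus_distP y z.
have := He (s, t, torus_exp y h) s0 t0 ste (- h); rewrite /= torus_expD subrr torus_exp0.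
have -> : \sum_p (- h) 0 p ^+ 2 = enorm h ^+ 2.
  rewrite sqr_sqrtr; first by apply: eq_bigr => p _; rewrite mxE sqrrN expr2.
  by apply: sumr_ge0 => p _; rewrite -expr2 sqr_ge0.
set r := enorm h; have r0 : 0 <= r by exact: sqrtr_ge0.
set A := dual_pot id _; set B := dual_conj Kc _ => HB.
have C : cos (Num.min r pi) <= expR (- (r ^+ 2 / 2 + r ^+ 4 / 12)).
  have [rp|rp] := leP r pi; first by apply: cos_le_exp; rewrite r0 rp.
  by rewrite cospi (le_trans _ (expR_ge0 _)) // lerN10.
have C2 : cos (Num.min r pi) <= expR (- A / 2) * expR (- B / 2).
  rewrite -expRD; apply: le_trans C _; rewrite ler_expR.
  rewrite (exprM r 2 2) in HB *; lra.
have -> : expR (- A) = expR (- A / 2) ^+ 2 by rewrite -expRM_natl -[2%:R]/(2 : R) mulrC divfK.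
have -> : expR (- B) = expR (- B / 2) ^+ 2 by rewrite -expRM_natl -[2%:R]/(2 : R) mulrC divfK.
have ab : 0 <= 2 * a * b by rewrite !mulr_ge0.
apply: (le_trans (ler_wpM2l ab C2)).
have := sqr_ge0 (expR (- A / 2) * a - expR (- B / 2) * b).
set u := expR _; set v := expR _; lra.
Qed.

End DualPotentials.

(** * The coupling against the dual potentials *)

Section DualityGap.
Context {R : realType} {n : nat}.
Notation I := (R * R * torus R n)%type.
Notation trig := (seq (R * 'rV[int]_n * R)).
Variables (F G K : trig) (w : 'I_n -> trig).
Notation s i := (i.1.1). Notation t i := (i.1.2).
Hypothesis wE : forall p x, tev (w p) x = (\sum_q (tev (tD q (tD p G)) x * tev (tD q F) x
  - tev (tD q (tD p F)) x * tev (tD q G) x) - tev (tD p K) x) / 2.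
Hypothesis divw : forall x, dw w x = - 2 * tev K x.

Definition end0 (i : I) := torus_exp i.2 (\row_p edisp ps F px i p).
Definition disp1 (i : I) : 'rV[R]_n := fd w i + \row_p edisp pt G (Eta w) i p.
Definition end1 (i : I) := torus_exp i.2 (disp1 i).

Lemma end1E i : end1 i = torus_exp (Eta w i) (\row_p edisp pt G (Eta w) i p).
Proof. by rewrite /Eta torus_expD. Qed.

Lemma end0E i : end0 i = torus_exp (end1 i) (\row_p disp_diff F G w i p).
Proof.
rewrite torus_expD; congr torus_exp; apply/rowP => p; rewrite !mxE /disp_diff; ring.
Qed.

Let Hs : isO 1 (@ps R n). Proof. exact: isO_s. Qed.
Let Ht : isO 1 (@pt R n). Proof. exact: isO_t. Qed.

Lemma isO_Eta T : isO 2 (fun i => tev T (Eta w i) - tev T i.2).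
Proof. exact: (isO_taylor1 T (fun i : I => i.2) (isO_fd1 w)). Qed.

Lemma isO_edispG p : isO 3 (fun i => edisp pt G (Eta w) i p -
  (t i * tev (tD p G) i.2 - 2 * t i ^+ 2 * tev G i.2 * tev (tD p G) i.2)).
Proof.
have H := isO_edisp2 G (Eta w) Ht p; have E1 := isO_Eta G; have E2 := isO_Eta (tD p G).
asO (fun i : I => (edisp pt G (Eta w) i p -
    (ev_ pt G (Eta w) i p - 2 * pt i * tev G (Eta w i) * ev_ pt G (Eta w) i p))
  + t i * (tev (tD p G) (Eta w i) - tev (tD p G) i.2)
  - 2 * t i ^+ 2 * ((tev G (Eta w i) - tev G i.2) * tev (tD p G) (Eta w i)
     + tev G i.2 * (tev (tD p G) (Eta w i) - tev (tD p G) i.2))).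
by move=> i; rewrite /ev_ /pt; ring.
Qed.

Lemma isO_disp_diff p : isO 3 (fun i => disp_diff F G w i p -
  (s i * tev (tD p F) i.2 - t i * tev (tD p G) i.2 - 2 * s i ^+ 2 * tev F i.2 * tev (tD p F) i.2
   + 2 * t i ^+ 2 * tev G i.2 * tev (tD p G) i.2 - s i * t i * tev (w p) i.2)).
Proof.
have H1 := isO_edispG p; have H2 := isO_edisp2 F px Hs p; have H3 := isO_fd w p.
asO (fun i : I => (edisp ps F px i p -
    (ev_ ps F px i p - 2 * ps i * tev F (px i) * ev_ ps F px i p))
  - (edisp pt G (Eta w) i p -
  (t i * tev (tD p G) i.2 - 2 * t i ^+ 2 * tev G i.2 * tev (tD p G) i.2))
  - (fd w i 0 p - s i * t i * tev (w p) i.2)).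
by move=> i; rewrite /disp_diff /ev_ /ps /px; ring.
Qed.

Lemma isO_disp_diff2 p : isO 2 (fun i => disp_diff F G w i p - (s i * tev (tD p F) i.2 - t i * tev (tD p G) i.2)).
Proof.
have H := isO_disp_diff p.
asO (fun i : I => (disp_diff F G w i p -
  (s i * tev (tD p F) i.2 - t i * tev (tD p G) i.2 - 2 * s i ^+ 2 * tev F i.2 * tev (tD p F) i.2
   + 2 * t i ^+ 2 * tev G i.2 * tev (tD p G) i.2 - s i * t i * tev (w p) i.2)) +
   (- 2 * s i ^+ 2 * tev F i.2 * tev (tD p F) i.2
   + 2 * t i ^+ 2 * tev G i.2 * tev (tD p G) i.2 - s i * t i * tev (w p) i.2)).
by move=> i; ring.
Qed.

Lemma isO_disp_diff1 p : isO 1 (fun i => disp_diff F G w i p).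
Proof.
have H := isO_disp_diff2 p.
asO (fun i : I => (disp_diff F G w i p - (s i * tev (tD p F) i.2 - t i * tev (tD p G) i.2))
   + (s i * tev (tD p F) i.2 - t i * tev (tD p G) i.2)).
by move=> i; ring.
Qed.

Lemma isO_disp2 : isO 2 (fun i => disp2 F G w i).
Proof. by apply: isO_sum => p; have H := isO_disp_diff1 p; bigO. Qed.

Lemma isO_zd2 p : isO 2 (fun i => disp1 i 0 p - t i * tev (tD p G) i.2).
Proof.
have H1 := isO_edispG p; have H3 := isO_fd1 w p.
asO (fun i : I => fd w i 0 p + (edisp pt G (Eta w) i p -
  (t i * tev (tD p G) i.2 - 2 * t i ^+ 2 * tev G i.2 * tev (tD p G) i.2))
   - 2 * t i ^+ 2 * tev G i.2 * tev (tD p G) i.2).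
by move=> i; rewrite !mxE; ring.
Qed.

Lemma isO_disp1 p : isO 1 (fun i => disp1 i 0 p).
Proof.
have H := isO_zd2 p.
by asO (fun i : I => (disp1 i 0 p - t i * tev (tD p G) i.2) + t i * tev (tD p G) i.2); move=> i; ring.
Qed.

Notation chi2 i p q := (s i * tev (tD q (tD p F)) i.2 - t i * tev (tD q (tD p G)) i.2).
Notation chi1 i q := (s i * tev (tD q F) i.2 - t i * tev (tD q G) i.2).

(** Moves the expansion of [dual_disp] from the end point back to x, where all other quantities are
    expanded. *)
Lemma isO_dual_disp_end1 p : isO 3 (fun i => dual_disp F G K (i.1, end1 i) 0 p -
  (dual_pot F G K (tD p) i / 2 + t i * (\sum_q chi2 i p q * tev (tD q G) i.2) + \sum_q chi2 i p q * chi1 i q)).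
Proof.
have H := isO_dual_pot_taylor2 F G K (tD p) (fun i : I => i.2) isO_disp1.
have H1 : isO 3 (fun i : I => \sum_q (dual_pot F G K (fun T => tD q (tD p T)) (i.1, i.2) - 2 * chi2 i p q) * disp1 i 0 q).
  by apply: isO_sum => q; have A := isO_disp1 q; have B := isO_alc1 F G K (fun T => tD q (tD p T)) (fun i : I => i.2); bigO.
have H2 : isO 3 (fun i : I => \sum_q chi2 i p q * (disp1 i 0 q - t i * tev (tD q G) i.2)).
  by apply: isO_sum => q; have A := isO_zd2 q; bigO.
have H3 : isO 3 (fun i : I => \sum_q ((s i * (tev (tD q (tD p F)) (end1 i) - tev (tD q (tD p F)) i.2)
    - t i * (tev (tD q (tD p G)) (end1 i) - tev (tD q (tD p G)) i.2)) * (s i * tev (tD q F) (end1 i) - t i * tev (tD q G) (end1 i))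
  + chi2 i p q * (s i * (tev (tD q F) (end1 i) - tev (tD q F) i.2) - t i * (tev (tD q G) (end1 i) - tev (tD q G) i.2)))).
  apply: isO_sum => q; have A T := isO_taylor1 T (fun i : I => i.2) isO_disp1.
  have A1 := A (tD q (tD p F)); have A2 := A (tD q (tD p G)); have A3 := A (tD q F); have A4 := A (tD q G).
  by rewrite /end1; bigO.
asO (fun i : I => (dual_pot F G K (tD p) (i.1, torus_exp i.2 (disp1 i)) - dual_pot F G K (tD p) (i.1, i.2)
    - \sum_q dual_pot F G K (fun T => tD q (tD p T)) (i.1, i.2) * disp1 i 0 q) / 2
  + (\sum_q (dual_pot F G K (fun T => tD q (tD p T)) (i.1, i.2) - 2 * chi2 i p q) * disp1 i 0 q) / 2
  + (\sum_q chi2 i p q * (disp1 i 0 q - t i * tev (tD q G) i.2))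
  + \sum_q ((s i * (tev (tD q (tD p F)) (end1 i) - tev (tD q (tD p F)) i.2)
    - t i * (tev (tD q (tD p G)) (end1 i) - tev (tD q (tD p G)) i.2)) * (s i * tev (tD q F) (end1 i) - t i * tev (tD q G) (end1 i))
  + chi2 i p q * (s i * (tev (tD q F) (end1 i) - tev (tD q F) i.2) - t i * (tev (tD q G) (end1 i) - tev (tD q G) i.2)))).
move=> i; rewrite mxE -/(end1 i) -surjective_pairing.
have -> : (\sum_q (dual_pot F G K (fun T => tD q (tD p T)) i - 2 * chi2 i p q) * disp1 i 0 q) =
  \sum_q dual_pot F G K (fun T => tD q (tD p T)) i * disp1 i 0 q - 2 * \sum_q chi2 i p q * disp1 i 0 q.
  rewrite mulr_sumF -sumrB; apply: eq_bigr => q _; ring.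
have -> : \sum_q chi2 i p q * (disp1 i 0 q - t i * tev (tD q G) i.2) =
  \sum_q chi2 i p q * disp1 i 0 q - t i * \sum_q chi2 i p q * tev (tD q G) i.2.
  rewrite mulr_sumF -sumrB; apply: eq_bigr => q _; ring.
set X := \sum_q ((s i * (tev (tD q (tD p F)) (end1 i) - tev (tD q (tD p F)) i.2)
    - t i * (tev (tD q (tD p G)) (end1 i) - tev (tD q (tD p G)) i.2)) * _ + _).
have -> : X = \sum_q (s i * tev (tD q (tD p F)) (end1 i) - t i * tev (tD q (tD p G)) (end1 i)) *
   (s i * tev (tD q F) (end1 i) - t i * tev (tD q G) (end1 i)) - \sum_q chi2 i p q * chi1 i q.
  rewrite /X -sumrB; apply: eq_bigr => q _; ring.
by rewrite /=; field.
Qed.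

Lemma dual_pot_tD p i : dual_pot F G K (tD p) i = 2 * chi1 i p + s i * t i * (tev (tD p K) i.2 +
    \sum_q (tev (tD q (tD p F)) i.2 * tev (tD q G) i.2 + tev (tD q F) i.2 * tev (tD q (tD p G)) i.2))
  - s i ^+ 2 * (4 * tev F i.2 * tev (tD p F) i.2 + 2 * \sum_q tev (tD q (tD p F)) i.2 * tev (tD q F) i.2)
  + t i ^+ 2 * (4 * tev G i.2 * tev (tD p G) i.2).
Proof.
have E3 : tev (tD p (pot_st F G K)) i.2 = tev (tD p K) i.2 +
    \sum_q (tev (tD q (tD p F)) i.2 * tev (tD q G) i.2 + tev (tD q F) i.2 * tev (tD q (tD p G)) i.2).
  rewrite /tev tD_cat teval_cat tevalD_sum; congr (_ + _); apply: eq_bigr => q _.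
  by rewrite tevalD_mul tevalDC (tevalDC p q G).
have E4 : tev (tD p (pot_ss F)) i.2 = - 4 * tev F i.2 * tev (tD p F) i.2 - 2 * \sum_q tev (tD q (tD p F)) i.2 * tev (tD q F) i.2.
  rewrite /tev tD_cat teval_cat !tevalD_scale tevalD_sum tevalD_mul mulN1r mulr_sumF; congr (_ - _).
    by ring.
  by apply: eq_bigr => q _; rewrite tevalD_mul tevalDC; ring.
have E5 : tev (tD p (pot_tt G)) i.2 = 4 * tev G i.2 * tev (tD p G) i.2.
  by rewrite /tev tevalD_scale tevalD_mul; ring.
by rewrite /dual_pot E3 E4 E5; ring.
Qed.

(** Second-order optimality: the coupling moves its end points along the displacement that the dual
    potential selects. The s t coefficients agree by [wE]; in s^2 and t^2 the Hessian terms cancel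
    and leave - 2 F grad F and 2 G grad G on both sides. *)
Lemma isO_disp_dual_disp p : isO 3 (fun i => disp_diff F G w i p - dual_disp F G K (i.1, end1 i) 0 p).
Proof.
have H1 := isO_disp_diff p; have H2 := isO_dual_disp_end1 p.
asO (fun i : I => (disp_diff F G w i p -
  (s i * tev (tD p F) i.2 - t i * tev (tD p G) i.2 - 2 * s i ^+ 2 * tev F i.2 * tev (tD p F) i.2
   + 2 * t i ^+ 2 * tev G i.2 * tev (tD p G) i.2 - s i * t i * tev (w p) i.2))
  - (dual_disp F G K (i.1, end1 i) 0 p -
  (dual_pot F G K (tD p) i / 2 + t i * (\sum_q chi2 i p q * tev (tD q G) i.2) + \sum_q chi2 i p q * chi1 i q))).
move=> i; rewrite wE dual_pot_tD.
have -> : \sum_q (tev (tD q (tD p F)) i.2 * tev (tD q G) i.2 + tev (tD q F) i.2 * tev (tD q (tD p G)) i.2) =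
  \sum_q tev (tD q (tD p F)) i.2 * tev (tD q G) i.2 + \sum_q tev (tD q (tD p G)) i.2 * tev (tD q F) i.2.
  by rewrite -big_split /=; apply: eq_bigr => q _; ring.
have -> : \sum_q (tev (tD q (tD p G)) i.2 * tev (tD q F) i.2 - tev (tD q (tD p F)) i.2 * tev (tD q G) i.2) =
  \sum_q tev (tD q (tD p G)) i.2 * tev (tD q F) i.2 - \sum_q tev (tD q (tD p F)) i.2 * tev (tD q G) i.2.
  by rewrite sumrB.
have -> : \sum_q chi2 i p q * tev (tD q G) i.2 = s i * (\sum_q tev (tD q (tD p F)) i.2 * tev (tD q G) i.2)
   - t i * (\sum_q tev (tD q (tD p G)) i.2 * tev (tD q G) i.2).
  by rewrite !mulr_sumF -sumrB; apply: eq_bigr => q _; ring.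
have -> : \sum_q chi2 i p q * chi1 i q =
    s i ^+ 2 * (\sum_q tev (tD q (tD p F)) i.2 * tev (tD q F) i.2)
  - s i * t i * (\sum_q tev (tD q (tD p F)) i.2 * tev (tD q G) i.2)
  - s i * t i * (\sum_q tev (tD q (tD p G)) i.2 * tev (tD q F) i.2)
  + t i ^+ 2 * (\sum_q tev (tD q (tD p G)) i.2 * tev (tD q G) i.2).
  by rewrite !mulr_sumF -!sumrB -big_split /=; apply: eq_bigr => q _; ring.
by field.
Qed.

End DualityGap.

Section DualityGap2.
Context {R : realType} {n : nat}.
Notation I := (R * R * torus R n)%type.
Notation trig := (seq (R * 'rV[int]_n * R)).
Variables (F G K : trig) (w : 'I_n -> trig).
Notation s i := (i.1.1). Notation t i := (i.1.2).
Hypothesis wE : forall p x, tev (w p) x = (\sum_q (tev (tD q (tD p G)) x * tev (tD q F) x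
  - tev (tD q (tD p F)) x * tev (tD q G) x) - tev (tD p K) x) / 2.
Hypothesis divw : forall x, dw w x = - 2 * tev K x.
Notation end0 := (end0 F). Notation end1 := (end1 G w). Notation disp_diff := (disp_diff F G w).
Notation disp2 := (disp2 F G w). Notation dual_disp := (dual_disp F G K). Notation dual_pot := (dual_pot F G K).

Let Hs : isO 1 (@ps R n). Proof. exact: isO_s. Qed.
Let Ht : isO 1 (@pt R n). Proof. exact: isO_t. Qed.

Let hz (i : I) := dual_disp (i.1, end1 i).
Let Hh p : isO 1 (fun i => hz i 0 p).
Proof. exact: (isO_comp end1 (isO_dual_disp F G K p)). Qed.
Let Hd p : isO 3 (fun i => disp_diff i p - hz i 0 p).
Proof. exact: isO_disp_dual_disp. Qed.

(** The conjugate is computed at [dual_disp], the coupling uses [disp_diff]. Their difference [del],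
    of order 3, enters through its products with the small stationarity defect, with itself, or with
    the quartic part of the cost. *)
Lemma isO_dual_pot_dual_conj Kc : isO 5 (fun i => dual_pot id (i.1, end0 i) + dual_conj F G K Kc (i.1, end1 i)
  - (disp2 i + disp2 i ^+ 2 / 6)).
Proof.
pose del i : 'rV[R]_n := \row_p (disp_diff i p - hz i 0 p).
pose zh i := torus_exp (end1 i) (hz i).
have Hdel p : isO 3 (fun i => del i 0 p).
  by apply: isO_eq (Hd p) => i; rewrite mxE.
have H1 := isO_dual_pot_taylor2 F G K id zh Hdel.
have H2 : isO 5 (fun i => \sum_p dual_defect F G K p (i.1, end1 i) * del i 0 p).
  apply: isO_sum => p; have A := Hdel p; have B := isO_comp end1 (isO_dual_defect F G K p); bigO.
have H3 : isO 5 (fun i => \sum_p del i 0 p ^+ 2).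
  by apply: isO_sum => p; have A := Hdel p; bigO.
have H4 : isO 4 (fun i => \sum_p del i 0 p * (2 * hz i 0 p + del i 0 p)).
  by apply: isO_sum => p; have A := Hdel p; have B := Hh p; bigO.
have H5 : isO 2 (fun i => disp2 i) by exact: isO_disp2.
have H6 : isO 2 (fun i => dual_disp2 F G K (i.1, end1 i)) by exact: (isO_comp end1 (isO_dual_disp2 F G K)).
have E i : disp2 i = dual_disp2 F G K (i.1, end1 i) + \sum_p del i 0 p * (2 * hz i 0 p + del i 0 p).
  rewrite /dual_disp2 -big_split /=; apply: eq_bigr => p _; rewrite !mxE -/(hz i); ring.
asO (fun i : I => (dual_pot id (i.1, torus_exp (zh i) (del i)) - dual_pot id (i.1, zh i)
    - \sum_p dual_pot (fun T => tD p (id T)) (i.1, zh i) * del i 0 p)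
  - (\sum_p dual_defect F G K p (i.1, end1 i) * del i 0 p) - (\sum_p del i 0 p ^+ 2)
  - (\sum_p del i 0 p * (2 * hz i 0 p + del i 0 p)) * (disp2 i + dual_disp2 F G K (i.1, end1 i)) / 6
  - Kc * (s i + t i) ^+ 6).
move=> i; have -> : torus_exp (zh i) (del i) = end0 i.
  rewrite (end0E F G w) /zh torus_expD; congr torus_exp; apply/rowP => p; rewrite !mxE -/(hz i); ring.
have -> : \sum_p dual_defect F G K p (i.1, end1 i) * del i 0 p = \sum_p del i 0 p * (2 * hz i 0 p + del i 0 p)
   - \sum_p del i 0 p ^+ 2 - \sum_p dual_pot (fun T => tD p (id T)) (i.1, zh i) * del i 0 p.
  by rewrite -!sumrB; apply: eq_bigr => p _; rewrite /dual_defect /= -/(hz i) -/(zh i); ring.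
rewrite /dual_conj /stsize -/(hz i) -/(zh i) E /= -/(zh i).
by field.
Qed.

Notation f i := (tev F i.2). Notation g i := (tev G i.2).
Notation chi1 i q := (s i * tev (tD q F) i.2 - t i * tev (tD q G) i.2).

(** The second-order part of alpha at [end0], with K eliminated by [divw] and <grad F, grad G> by
    polarization. *)
Let a2 (i : I) : R := - 2 * (s i * f i) ^+ 2 + 2 * (t i * g i) ^+ 2 + s i ^+ 2 * sff F i.2 / 2
  - t i ^+ 2 * sgg G i.2 / 2 + (\sum_q chi1 i q ^+ 2) / 2 - s i * t i * dw w i.2 / 2.

Let Hsff : isO 0 (fun i : I => sff F i.2). Proof. by rewrite /sff; bigO. Qed.
Let Hsgg : isO 0 (fun i : I => sgg G i.2). Proof. by rewrite /sgg; bigO. Qed.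
Let Hdw : isO 0 (fun i : I => dw w i.2). Proof. by rewrite /dw; bigO. Qed.
Let HN : isO 2 (fun i : I => \sum_q chi1 i q ^+ 2).
Proof. by apply: isO_sum => q; bigO. Qed.

Lemma isO_dual_pot_end0 : isO 3 (fun i => dual_pot id (i.1, end0 i) - (2 * (s i * f i - t i * g i) + a2 i)).
Proof.
have Hed p : isO 1 (fun i => (\row_p edisp ps F px i p : 'rV[R]_n) 0 p).
  by apply: isO_eq (isO_edisp F px Hs p) => i; rewrite mxE.
have Hed2 p : isO 2 (fun i => (\row_p edisp ps F px i p : 'rV[R]_n) 0 p - s i * tev (tD p F) i.2).
  have H := isO_edisp2 F px Hs p.
  asO (fun i : I => (edisp ps F px i p -
    (ev_ ps F px i p - 2 * ps i * tev F (px i) * ev_ ps F px i p)) - 2 * s i * f i * s i * tev (tD p F) i.2).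
  by move=> i; rewrite mxE /ev_ /ps /px; ring.
have H := isO_dual_pot_taylor2 F G K id (fun i : I => i.2) Hed.
have H1 : isO 3 (fun i : I => \sum_q (dual_pot (fun T => tD q (id T)) (i.1, i.2) - 2 * chi1 i q) *
    (\row_p edisp ps F px i p : 'rV[R]_n) 0 q).
  by apply: isO_sum => q; have A := Hed q; have B := isO_alc1 F G K (fun T => tD q (id T)) (fun i : I => i.2); bigO.
have H2 : isO 3 (fun i : I => \sum_q chi1 i q * ((\row_p edisp ps F px i p : 'rV[R]_n) 0 q - s i * tev (tD q F) i.2)).
  by apply: isO_sum => q; have A := Hed2 q; bigO.
asO (fun i : I => (dual_pot id (i.1, torus_exp i.2 (\row_p edisp ps F px i p)) - dual_pot id (i.1, i.2)
    - \sum_q dual_pot (fun T => tD q (id T)) (i.1, i.2) * (\row_p edisp ps F px i p : 'rV[R]_n) 0 q)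
  + (\sum_q (dual_pot (fun T => tD q (id T)) (i.1, i.2) - 2 * chi1 i q) *
    (\row_p edisp ps F px i p : 'rV[R]_n) 0 q)
  + 2 * \sum_q chi1 i q * ((\row_p edisp ps F px i p : 'rV[R]_n) 0 q - s i * tev (tD q F) i.2)).
move=> i; rewrite -/(end0 i) -surjective_pairing.
set S := \sum_q dual_pot _ i * _.
have -> : \sum_q (dual_pot (fun T => tD q (id T)) i - 2 * chi1 i q) * (\row_p edisp ps F px i p : 'rV[R]_n) 0 q =
   S - 2 * \sum_q chi1 i q * (\row_p edisp ps F px i p : 'rV[R]_n) 0 q.
  by rewrite mulr_sumF -sumrB; apply: eq_bigr => q _; ring.
set S' := \sum_q chi1 i q * ((\row_p edisp ps F px i p : 'rV[R]_n) 0 q - _).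
have -> : S' = \sum_q chi1 i q * (\row_p edisp ps F px i p : 'rV[R]_n) 0 q
   - (s i ^+ 2 * sff F i.2 - s i * t i * sfg F G i.2).
  by rewrite /S' /sff /sfg !mulr_sumF -!sumrB; apply: eq_bigr => q _; ring.
have -> : dual_pot id i = 2 * s i * f i - 2 * t i * g i + s i * t i * (tev K i.2 + sfg F G i.2)
   - s i ^+ 2 * (2 * f i ^+ 2 + sff F i.2) + t i ^+ 2 * (2 * g i ^+ 2).
  have E3 : tev (pot_st F G K) i.2 = tev K i.2 + sfg F G i.2.
    by rewrite /tev teval_cat teval_sum; congr (_ + _); apply: eq_bigr => q _; rewrite teval_mul.
  have E4 : tev (pot_ss F) i.2 = - 2 * f i ^+ 2 - sff F i.2.
    rewrite /tev teval_cat !teval_scale teval_sum teval_mul mulN1r; congr (_ - _).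
    by apply: eq_bigr => q _; rewrite teval_mul -expr2.
  by rewrite /dual_pot /= E3 E4 /tev teval_scale teval_mul; ring.
rewrite /a2 divw.
have -> : \sum_q chi1 i q ^+ 2 = s i ^+ 2 * sff F i.2 - 2 * s i * t i * sfg F G i.2 + t i ^+ 2 * sgg G i.2.
  by rewrite /sff /sfg /sgg !mulr_sumF -sumrB -big_split /=; apply: eq_bigr => q _; ring.
by field.
Qed.

Lemma isO_disp2_chi : isO 3 (fun i => disp2 i - \sum_q chi1 i q ^+ 2).
Proof.
have -> : (fun i => disp2 i - \sum_q chi1 i q ^+ 2) =
  (fun i => \sum_q (disp_diff i q - chi1 i q) * ((disp_diff i q - chi1 i q) + 2 * chi1 i q)).
  by apply/funext => i; rewrite -sumrB; apply: eq_bigr => q _; ring.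
by apply: isO_sum => q; have A := isO_disp_diff2 F G w q; bigO.
Qed.

Lemma isO_dual_conj_end1 Kc : isO 3 (fun i => dual_conj F G K Kc (i.1, end1 i)
  - (\sum_q chi1 i q ^+ 2 - (2 * (s i * f i - t i * g i) + a2 i))).
Proof.
have H1 := isO_dual_pot_dual_conj Kc; have H2 := isO_dual_pot_end0; have H3 := isO_disp2_chi; have H4 := isO_disp2 F G w.
asO (fun i : I => (dual_pot id (i.1, end0 i) + dual_conj F G K Kc (i.1, end1 i)
  - (disp2 i + disp2 i ^+ 2 / 6)) - (dual_pot id (i.1, end0 i) - (2 * (s i * f i - t i * g i) + a2 i))
  + (disp2 i - \sum_q chi1 i q ^+ 2) + disp2 i ^+ 2 / 6).
by move=> i; ring.
Qed.

Let r0 (i : I) : R := erad ps F px i.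
Let r1 (i : I) : R := erad pt G (Eta w) i.
Let lam (i : I) : R := Num.sqrt (fJ w i).

Lemma isO_fJ1 : isO 2 (fun i => fJ w i - 1).
Proof.
have H := isO_fJ w; have H0 := Hdw.
by asO (fun i => (fJ w i - 1 - s i * t i * \sum_p tev (tD p (w p)) i.2) + s i * t i * dw w i.2); move=> i; rewrite /dw; ring.
Qed.

Lemma isO_lam : isO 3 (fun i => lam i - (1 + s i * t i * dw w i.2 / 2)).
Proof.
have H := isO_sqrt1D (k := 2) isT isO_fJ1; have H1 := isO_fJ w; have H2 := isO_fJ1; have H3 := Hdw.
asO (fun i => (Num.sqrt (1 + (fJ w i - 1)) - (1 + (fJ w i - 1) / 2 - (fJ w i - 1) ^+ 2 / 8))
  + (fJ w i - 1 - s i * t i * \sum_p tev (tD p (w p)) i.2) / 2 - (fJ w i - 1) ^+ 2 / 8).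
move=> i; have -> : 1 + (fJ w i - 1) = fJ w i by ring.
by rewrite /lam /dw; field.
Qed.

Lemma isO_r0 : isO 3 (fun i => r0 i - (1 + 2 * (s i * f i) + s i ^+ 2 * sff F i.2 / 2)).
Proof.
apply: isO_eq (isO_erad2 F px Hs) => i; congr (_ - _).
have -> : \sum_p ev_ ps F px i p ^+ 2 = s i ^+ 2 * sff F i.2.
  by rewrite /sff mulr_sumF; apply: eq_bigr => p _; rewrite /ev_ /ps /px; ring.
by rewrite /ps /px; ring.
Qed.

Lemma isO_lam_r1 : isO 3 (fun i => lam i * r1 i -
  (1 + 2 * (t i * g i) + (t i ^+ 2 * sgg G i.2 / 2 + s i * t i * dw w i.2 / 2))).
Proof.
have H := isO_erad2 G (Eta w) Ht; have H1 := isO_lam; have H2 := Hdw; have H3 := isO_erad G (Eta w) Ht.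
have A1 := isO_Eta w G.
have K1 : isO 2 (fun i : I => \sum_p (tev (tD p G) (Eta w i) ^+ 2 - tev (tD p G) i.2 ^+ 2)).
  apply: isO_sum => p; have A := isO_Eta w (tD p G).
  asO (fun i : I => (tev (tD p G) (Eta w i) - tev (tD p G) i.2) * (tev (tD p G) (Eta w i) + tev (tD p G) i.2)).
  by move=> i; ring.
have H5 : isO 3 (fun i => r1 i - (1 + 2 * t i * g i + t i ^+ 2 * sgg G i.2 / 2)).
  asO (fun i : I => (erad pt G (Eta w) i - (1 + 2 * pt i * tev G (Eta w i) + (\sum_p ev_ pt G (Eta w) i p ^+ 2) / 2))
    + 2 * t i * (tev G (Eta w i) - g i) + t i ^+ 2 * (\sum_p (tev (tD p G) (Eta w i) ^+ 2 - tev (tD p G) i.2 ^+ 2)) / 2).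
  move=> i; have -> : \sum_p ev_ pt G (Eta w) i p ^+ 2 = t i ^+ 2 *
     (sgg G i.2 + \sum_p (tev (tD p G) (Eta w i) ^+ 2 - tev (tD p G) i.2 ^+ 2)).
    by rewrite /sgg -big_split /= mulr_sumF; apply: eq_bigr => p _; rewrite /ev_ /pt; ring.
  by rewrite /r1 /pt; field.
have H6 := Hsgg.
asO (fun i : I => (lam i - (1 + s i * t i * dw w i.2 / 2)) * erad pt G (Eta w) i
  + (1 + s i * t i * dw w i.2 / 2) * (r1 i - (1 + 2 * t i * g i + t i ^+ 2 * sgg G i.2 / 2))
  + s i * t i * dw w i.2 / 2 * (2 * t i * g i + t i ^+ 2 * sgg G i.2 / 2)).
by move=> i; rewrite /r1; ring.
Qed.

Let al (i : I) := dual_pot id (i.1, end0 i).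
Let bz Kc (i : I) := dual_conj F G K Kc (i.1, end1 i).

Lemma isO_potential_exp (A A1 A2 : I -> R) : isO 1 (fun i => A1 i) -> isO 2 (fun i => A2 i) ->
  isO 3 (fun i => A i - (A1 i + A2 i)) ->
  isO 3 (fun i => expR (- A i / 2) - (1 - A1 i / 2 - A2 i / 2 + A1 i ^+ 2 / 8)).
Proof.
move=> H1 H2 H3.
have H : isO 1 (fun i => - A i / 2).
  by asO (fun i => - (A i - (A1 i + A2 i)) / 2 - (A1 i + A2 i) / 2); move=> i; ring.
have E := isO_exp (k := 1) isT H.
asO (fun i => (expR (- A i / 2) - (1 + - A i / 2 + (- A i / 2) ^+ 2 / 2))
  - (A i - (A1 i + A2 i)) / 2 + (A i - (A1 i + A2 i)) * ((A i - (A1 i + A2 i)) + 2 * (A1 i + A2 i)) / 8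
  + (2 * A1 i * A2 i + A2 i ^+ 2) / 8).
by move=> i; field.
Qed.

(** The equality case of 2 u v <= u^2 + v^2 in the dual inequality. At second order it is the
    relation div w = - 2 K that makes it hold. *)
Lemma isO_balance Kc : isO 3 (fun i => expR (- al i / 2) * r0 i - expR (- bz Kc i / 2) * (lam i * r1 i)).
Proof.
have Ha2 : isO 2 (fun i => a2 i) by have := Hsff; have := Hsgg; have := Hdw; have := HN => ? ? ? ?; rewrite /a2; bigO.
have Ha1 : isO 1 (fun i : I => 2 * (s i * f i - t i * g i)) by bigO.
have H1 := isO_potential_exp Ha1 Ha2 isO_dual_pot_end0.
have Ha2' : isO 2 (fun i => \sum_q chi1 i q ^+ 2 - a2 i) by have := HN => ?; bigO.
have Ha1' : isO 1 (fun i : I => - (2 * (s i * f i - t i * g i))) by bigO.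
have H3 : isO 3 (fun i => bz Kc i - (- (2 * (s i * f i - t i * g i)) + (\sum_q chi1 i q ^+ 2 - a2 i))).
  by apply: isO_eq (isO_dual_conj_end1 Kc) => i; rewrite /bz; ring.
have H2 := isO_potential_exp Ha1' Ha2' H3.
have K1 := isO_r0; have K2 := isO_lam_r1.
have K3 : isO 0 (fun i => r0 i) by exact: isO_erad.
have K4 : isO 0 (fun i => lam i * r1 i).
  have B := Hsgg; have C := Hdw.
  asO (fun i => (lam i * r1 i - (1 + 2 * (t i * g i) + (t i ^+ 2 * sgg G i.2 / 2 + s i * t i * dw w i.2 / 2)))
    + (1 + 2 * (t i * g i) + (t i ^+ 2 * sgg G i.2 / 2 + s i * t i * dw w i.2 / 2))).
  by move=> i; ring.
(* Both products are 1 + u + v to first order. With [d2] and [d2'] the second-order parts of the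
   exponentials, the quadratic terms cancel because a2 = - 2 u^2 + 2 v^2 + P - Q + N / 2. *)
pose u (i : I) : R := s i * f i; pose v (i : I) : R := t i * g i.
pose P (i : I) : R := s i ^+ 2 * sff F i.2 / 2; pose Q (i : I) : R := t i ^+ 2 * sgg G i.2 / 2 + s i * t i * dw w i.2 / 2.
pose N (i : I) : R := \sum_q chi1 i q ^+ 2.
have Hu : isO 1 u by rewrite /u; bigO.
have Hv : isO 1 v by rewrite /v; bigO.
have HP : isO 2 P by have := Hsff => ?; rewrite /P; bigO.
have HQ : isO 2 Q by have := Hsgg; have := Hdw => ? ?; rewrite /Q; bigO.
have HN' : isO 2 N := HN.
pose d2 (i : I) : R := - a2 i / 2 + (u i - v i) ^+ 2 / 2.
pose d2' (i : I) : R := (a2 i - N i) / 2 + (u i - v i) ^+ 2 / 2.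
have Hd2 : isO 2 d2 by rewrite /d2; bigO.
have Hd2' : isO 2 d2' by rewrite /d2'; bigO.
asO (fun i => (expR (- al i / 2) - (1 - 2 * (s i * f i - t i * g i) / 2 - a2 i / 2 + (2 * (s i * f i - t i * g i)) ^+ 2 / 8)) * r0 i
  + (1 - (u i - v i) + d2 i) * (r0 i - (1 + 2 * (s i * f i) + s i ^+ 2 * sff F i.2 / 2))
  - (expR (- bz Kc i / 2) - (1 - - (2 * (s i * f i - t i * g i)) / 2 - (\sum_q chi1 i q ^+ 2 - a2 i) / 2
       + (- (2 * (s i * f i - t i * g i))) ^+ 2 / 8)) * (lam i * r1 i)
  - (1 + (u i - v i) + d2' i) * (lam i * r1 i -
      (1 + 2 * (t i * g i) + (t i ^+ 2 * sgg G i.2 / 2 + s i * t i * dw w i.2 / 2)))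
  + (- (u i - v i) * P i + 2 * u i * d2 i + d2 i * P i - (u i - v i) * Q i - 2 * v i * d2' i - d2' i * Q i)).
move=> i; rewrite /d2 /d2' /N /u /v /P /Q /a2; move: (expR _) (expR _) (\sum_q _) => e1 e2 S.
by field.
Qed.

(* What the dual potentials leave on the coupling: a square of [isO_balance] plus 2 r0 r1 times the
   difference between exp (- (alpha + beta) / 2) and the cosine. *)
Definition gap Kc (i : I) := expR (- dual_pot id (i.1, end0 i)) * erad ps F px i ^+ 2
  + fJ w i * (expR (- dual_conj F G K Kc (i.1, end1 i)) * erad pt G (Eta w) i ^+ 2) - 2 * gam F G w i.

Lemma isO_gap Kc : isO 5 (gap Kc).
Proof.
have H1 := isO_balance Kc; have H2 := isO_dual_pot_dual_conj Kc; have H3 := isO_disp2 F G w.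
have D0 i : 0 <= disp2 i by apply: sumr_ge0 => p _; exact: sqr_ge0.
have HC := isO_cos_sqrt D0 H3.
have Hx : isO 2 (fun i => - (al i + bz Kc i) / 2).
  asO (fun i => - (dual_pot id (i.1, end0 i) + dual_conj F G K Kc (i.1, end1 i) - (disp2 i + disp2 i ^+ 2 / 6)) / 2
    - (disp2 i + disp2 i ^+ 2 / 6) / 2); by move=> i; rewrite /al /bz; field.
have HE := isO_exp (k := 2) isT Hx.
(* With d^2 = [disp2], the exponential of - (d^2 + d^4 / 6) / 2 has quartic coefficient - 1/12 + 1/8
   = 1/24, that of the cosine; this is why the cost carries r^4 / 6. *)
have H4 : isO 5 (fun i => expR (- (al i + bz Kc i) / 2) - cos (Num.sqrt (disp2 i))).
  asO (fun i => (expR (- (al i + bz Kc i) / 2) - (1 + - (al i + bz Kc i) / 2 + (- (al i + bz Kc i) / 2) ^+ 2 / 2))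
    - (dual_pot id (i.1, end0 i) + dual_conj F G K Kc (i.1, end1 i) - (disp2 i + disp2 i ^+ 2 / 6)) / 2
    + (dual_pot id (i.1, end0 i) + dual_conj F G K Kc (i.1, end1 i) - (disp2 i + disp2 i ^+ 2 / 6))
       * ((dual_pot id (i.1, end0 i) + dual_conj F G K Kc (i.1, end1 i) - (disp2 i + disp2 i ^+ 2 / 6)) + 2 * (disp2 i + disp2 i ^+ 2 / 6)) / 8
    + (disp2 i ^+ 2 * disp2 i / 3 + disp2 i ^+ 4 / 36) / 8
    - (cos (Num.sqrt (disp2 i)) - (1 - disp2 i / 2 + disp2 i ^+ 2 / 24))).
  by move=> i; rewrite /al /bz; field.
have K3 : isO 0 (fun i => r0 i) by exact: isO_erad.
have K4 : isO 0 (fun i => r1 i) by exact: isO_erad.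
have K5 : isO 0 (fun i => lam i).
  have H := isO_lam; have H' := Hdw.
  by asO (fun i => (lam i - (1 + s i * t i * dw w i.2 / 2)) + (1 + s i * t i * dw w i.2 / 2)); move=> i; ring.
apply: (isO_near (g := fun i => (expR (- al i / 2) * r0 i - expR (- bz Kc i / 2) * (lam i * r1 i)) ^+ 2
  + 2 * (lam i * (r0 i * r1 i)) * (expR (- (al i + bz Kc i) / 2) - cos (Num.sqrt (disp2 i))))); last by bigO.
have h : 0 < 1 / 2 :> R by lra.
apply: ev_imp (isO_small _ h isO_fJ1) => // i; rewrite ler_norml => /andP[J1 _].
have J0 : 0 <= fJ w i by lra.
have -> : expR (- (al i + bz Kc i) / 2) = expR (- al i / 2) * expR (- bz Kc i / 2).
  by rewrite -expRD; congr expR; ring.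
have sq a : expR (- a) = expR (- a / 2) ^+ 2 :> R.
  by rewrite -expRM_natl -[2%:R]/(2 : R) mulrC divfK.
rewrite /gap !sq -/(al i) -/(bz Kc i) -/(r0 i) -/(r1 i) /gam -/(lam i) -/(r0 i) -/(r1 i).
have <- : lam i ^+ 2 = fJ w i by rewrite sqr_sqrtr.
by ring.
Qed.

End DualityGap2.

(** * The fourth-order estimate *)

Lemma integral_preimage_comp d (T : measurableType d) (R : realType) (m : {measure set T -> \bar R})
    d' (U : measurableType d') (e : T -> T) (J r : T -> R) (h : T -> U) (A : set U) :
  (forall f, measurable_fun setT f -> (forall x, (0 <= f x)%E) ->
    (\int[m]_x (f (e x) * (J x)%:E) = \int[m]_x f x)%E) ->
  measurable_fun setT h -> measurable_fun setT r -> (forall x, 0 <= r x) -> measurable A ->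
  (\int[m]_(x in h @^-1` A) (r x)%:E = \int[m]_(x in (h \o e) @^-1` A) (J x * r (e x))%:E)%E.
Proof.
move=> eJ mh mr r0 mA; rewrite integral_mkcond [RHS]integral_mkcond.
have mfe : measurable_fun setT ((fun x => (r x)%:E) \_ (h @^-1` A)).
  apply: measurable_funT_restrict; last exact/measurable_EFinP.
  by rewrite -[X in measurable X]setTI; exact: mh.
rewrite -(eJ _ mfe); last by move=> x; rewrite patchE; case: ifP => // _; rewrite lee_fin.
apply: eq_integral => x _; rewrite !patchE /=.
have -> : (e x \in h @^-1` A) = (x \in (h \o e) @^-1` A) by apply/idP/idP; rewrite !inE.
by case: ifP => _; rewrite ?mul0e // EFinM muleC.
Qed.

Section HKEstimate.
Context {R : realType} {n : nat}.
Notation I := (R * R * torus R n)%type.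
Notation trig := (seq (R * 'rV[int]_n * R)).
Notation mu := (torus_volume R n).
Variables (F G K : trig) (w : 'I_n -> trig).
Hypothesis wE : forall p x, tev (w p) x = (\sum_q (tev (tD q (tD p G)) x * tev (tD q F) x
  - tev (tD q (tD p F)) x * tev (tD q G) x) - tev (tD p K) x) / 2.
Hypothesis divw : forall x, dw w x = - 2 * tev K x.

Lemma bm_comp (f : torus R n -> R) (h : torus R n -> torus R n) : bm f -> measurable_fun setT h -> bm (fun x => f (h x)).
Proof.
by move=> [mf [C fC]] mh; split; [exact: measurableT_comp mf mh|exists C => x].
Qed.

Lemma bm_sqrt (f : torus R n -> R) : bm f -> bm (fun x => Num.sqrt (f x)).
Proof.
move=> [mf [C fC]]; split; first exact: measurable_fun_sqrt.
exists (Num.sqrt C) => x; rewrite ger0_norm ?sqrtr_ge0 // ler_wsqrtr //.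
exact: le_trans (ler_norm _) (fC x).
Qed.

Lemma bm_expRN (f : torus R n -> R) : bm f -> bm (fun x => expR (- f x)).
Proof.
move=> [mf [C fC]]; split.
  by apply: measurable_fun_continuous; [exact: continuous_expR|exact: measurableT_comp mf].
exists (expR C) => x; rewrite gtr0_norm ?expR_gt0 // ler_expR.
by rewrite (le_trans (ler_norm _)) // normrN.
Qed.

Section At.
Variables (s t : R).
Notation at_ x := ((s, t, x) : I).
Notation phi := (fun x => s * tev F x).
Notation psi := (fun x => t * tev G x).
Notation h0 := (exp_base phi). Notation h1 := (exp_base psi).
Notation m0 := (exp_mass phi). Notation m1 := (exp_mass psi).
Notation eta := (fun x => Eta w (at_ x)).
Notation J := (fun x => fJ w (at_ x)).

Lemma scaled_tev (a : R) (T : trig) : (fun x => a * tev T x) = tev (tscale a T).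
Proof. by apply/funext => x; rewrite /tev teval_scale. Qed.

Lemma measurable_grad_tev T p : measurable_fun setT (fun x : torus R n => grad (tev T) x 0 p).
Proof.
rewrite (_ : (fun x => _) = tev (tD p T)); first exact: measurable_tev.
by apply/funext => x; rewrite grad_tev mxE.
Qed.

Lemma bm_exp_mass_tev (T : trig) : bm (exp_mass (tev T)).
Proof.
have B1 : bm (fun x : torus R n => (1 + 2 * tev T x) ^+ 2).
  by apply: bm_X; apply: bm_add (bm_cst 1) _; apply: bm_mul (bm_cst 2) (bm_tev T).
have B2 : bm (fun x : torus R n => \sum_p tev (tD p T) x ^+ 2).
  by apply: bm_sum => p; apply: bm_X; exact: bm_tev.
have := bm_add B1 B2; congr bm; apply/funext => x; rewrite /exp_mass; congr (_ + _).
rewrite /enorm sqr_sqrtr; last by apply: sumr_ge0 => p _; rewrite -expr2 sqr_ge0.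
by apply: eq_bigr => p _; rewrite grad_tev !mxE expr2.
Qed.

Let mh0 : measurable_fun setT h0.
Proof.
rewrite scaled_tev; apply: measurable_exp_base; first exact: measurable_tev.
by move=> p; exact: measurable_grad_tev.
Qed.
Let mh1 : measurable_fun setT h1.
Proof.
rewrite scaled_tev; apply: measurable_exp_base; first exact: measurable_tev.
by move=> p; exact: measurable_grad_tev.
Qed.
Let bm0 : bm m0. Proof. by rewrite scaled_tev; exact: bm_exp_mass_tev. Qed.
Let bm1 : bm m1. Proof. by rewrite scaled_tev; exact: bm_exp_mass_tev. Qed.

Let E0 A : measurable A -> (exp_mu mu phi A = \int[mu]_(x in h0 @^-1` A) (m0 x)%:E)%E.
Proof.
rewrite scaled_tev; apply: exp_muE; first exact: measurable_tev.
by move=> p; exact: measurable_grad_tev.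
Qed.
Let E1 A : measurable A -> (exp_mu mu psi A = \int[mu]_(x in h1 @^-1` A) (m1 x)%:E)%E.
Proof.
rewrite scaled_tev; apply: exp_muE; first exact: measurable_tev.
by move=> p; exact: measurable_grad_tev.
Qed.

Let erad0 x : erad ps F px (at_ x) ^+ 2 = m0 x.
Proof. exact: esym (exp_mass_erad (@ps R n) F (@px R n) (at_ x)). Qed.
Let erad1 x : erad pt G (Eta w) (at_ x) ^+ 2 = m1 (eta x).
Proof. exact: esym (exp_mass_erad (@pt R n) G (Eta w) (at_ x)). Qed.
Let base0 x : end0 F (at_ x) = h0 x.
Proof. exact: esym (exp_base_edisp (@ps R n) F (@px R n) (at_ x)). Qed.
Let base1 x : end1 G w (at_ x) = h1 (eta x).
Proof. by rewrite end1E; exact: esym (exp_base_edisp (@pt R n) G (Eta w) (at_ x)). Qed.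

Hypotheses (small1 : forall p, `|s * t| * tbound (w p) <= 1)
  (small2 : forall p, `|s * t| * tbound (tD p (w p)) <= 1 / 2).
Hypothesis J1 : forall x, `|J x - 1| <= 1 / 2.
Hypothesis d1 : forall x p, `|disp_diff F G w (at_ x) p| <= 1.
Hypothesis d2 : forall x, disp2 F G w (at_ x) <= 1.

Let meta : measurable_fun setT eta.
Proof. exact: (@measurable_flow R n w (s * t) (index_enum _)). Qed.
Let J0 x : 0 <= J x.
Proof. by have := J1 x; rewrite ler_norml => /andP[]; lra. Qed.
Let bJ : bm J.
Proof.
split; first exact: (@measurable_flow_jac R n w (s * t) (index_enum _)).
exists 2 => x; rewrite ger0_norm //.
by have := J1 x; rewrite ler_norml => /andP[]; lra.
Qed.

Let flowE (f : torus R n -> \bar R) : measurable_fun setT f -> (forall x, (0 <= f x)%E) ->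
  (\int[mu]_x (f (eta x) * (J x)%:E) = \int[mu]_x f x)%E.
Proof. exact: (@ge0_integral_flow R n w (s * t) small1 small2 (index_enum _)). Qed.

Let expect_flow f : bm f -> (forall x, 0 <= f x) -> expect (fun x => J x * f (eta x)) = expect f.
Proof.
move=> bf f0; apply/EFin_inj.
have bfe := bm_comp bf meta.
rewrite !EFin_expect //; last exact: bm_mul.
have mfe : measurable_fun setT (fun x => (f x)%:E) by case: bf => mf _; exact/measurable_EFinP.
rewrite -(flowE mfe) //.
by apply: eq_integral => x _; rewrite EFinM muleC.
Qed.

Let expect_J : expect J = 1.
Proof.
have := expect_flow (bm_cst 1) (fun=> ler01); rewrite expect_cst => <-.
by congr expect; apply/funext => x; rewrite mulr1.
Qed.

Let Efl A : measurable A ->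
  (exp_mu mu psi A = \int[mu]_(x in (h1 \o eta) @^-1` A) (J x * m1 (eta x))%:E)%E.
Proof.
move=> mA; rewrite E1 //; apply: integral_preimage_comp => //; first exact: bm1.1.
by move=> x; exact: exp_mass_ge0.
Qed.

(** Each component of the displacement is at most 1 < pi, so the straight segment realizes the
    distance on the torus. *)
Let distE x : torus_dist (h0 x) (h1 (eta x)) = Num.sqrt (disp2 F G w (at_ x)).
Proof.
rewrite -base0 -base1 /end0 /end1 torus_dist_exp.
  rewrite /enorm /edot; congr Num.sqrt; apply: eq_bigr => p _.
  rewrite !mxE -expr2 /disp_diff; congr (_ ^+ 2); ring.
move=> p; have := d1 x p; have := @pi_ge2 R => p2 h.
have -> : (\row_p0 edisp ps F px (at_ x) p0 : 'rV[R]_n) 0 p - disp1 G w (at_ x) 0 p = disp_diff F G w (at_ x) p.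
  by rewrite !mxE /disp_diff; ring.
by apply: le_trans h _; lra.
Qed.

(** The radii are packed with their defining equation, so that later proofs see nothing else of
    them. *)
Let s0P : {r : torus R n -> half_line R | forall x, (r x)%:num = Num.sqrt (m0 x)}.
Proof. by exists (fun x => sqrt_nng (m0 x)). Qed.
Let s1P : {r : torus R n -> half_line R | forall x, (r x)%:num = Num.sqrt (J x * m1 (eta x))}.
Proof. by exists (fun x => sqrt_nng (J x * m1 (eta x))). Qed.
Let s0 := sval s0P.
Let s1 := sval s1P.

Let s0E x : (s0 x)%:num = erad ps F px (at_ x).
Proof.
by rewrite (svalP s0P) -erad0 sqrtr_sqr ger0_norm // sqrtr_ge0.
Qed.
Let s1E x : (s1 x)%:num = Num.sqrt (J x) * erad pt G (Eta w) (at_ x).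
Proof.
by rewrite (svalP s1P) sqrtrM // -erad1 sqrtr_sqr ger0_norm // sqrtr_ge0.
Qed.

Let costE x : cone_dist (cone_pi (h0 x, s0 x)) (cone_pi (h1 (eta x), s1 x)) ^+ 2 =
  m0 x + J x * m1 (eta x) - 2 * gam F G w (at_ x).
Proof.
rewrite cone_dist2_pi distE.
have -> : Num.min (Num.sqrt (disp2 F G w (at_ x))) pi = Num.sqrt (disp2 F G w (at_ x)).
  apply/min_idPl; have := @pi_ge2 R; have : Num.sqrt (disp2 F G w (at_ x)) <= 1.
    by rewrite -[leRHS]sqrtr1 ler_wsqrtr.
  lra.
have sJ : Num.sqrt (J x) ^+ 2 = J x by rewrite sqr_sqrtr.
have key (a b r q u v c l j : R) : a = r -> b = l * q -> r ^+ 2 = u -> q ^+ 2 = v -> l ^+ 2 = j ->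
    a ^+ 2 + b ^+ 2 - 2 * a * b * c = u + j * v - 2 * (l * (r * q * c)).
  by move=> -> -> <- <- <-; ring.
exact: (key _ _ _ _ _ _ _ _ _ (s0E x) (s1E x) (erad0 x) (erad1 x) sJ).
Qed.

Let bm1e : bm (fun x => m1 (eta x)). Proof. exact: bm_comp bm1 meta. Qed.

Let bs0 : bm (fun x => (s0 x)%:num).
Proof. by rewrite (funext (svalP s0P)); exact: bm_sqrt. Qed.
Let bs1 : bm (fun x => (s1 x)%:num).
Proof. by rewrite (funext (svalP s1P)); apply: bm_sqrt; exact: bm_mul. Qed.

Let bcost : bm (fun x => cone_dist (cone_pi (h0 x, s0 x)) (cone_pi (h1 (eta x), s1 x)) ^+ 2).
Proof.
have [ms0 [C0 hC0]] := bs0; have [ms1 [C1 hC1]] := bs1.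
split.
  have mc0 := measurable_cone_pi mh0 ms0; have mc1 := measurable_cone_pi (measurableT_comp mh1 meta) ms1.
  exact: measurableT_comp measurable_cone_dist2 (measurable_fun_pair mc0 mc1).
exists (C0 ^+ 2 + C1 ^+ 2 + 2 * (C0 * C1)) => x.
have a0 : 0 <= (s0 x)%:num by rewrite s0E sqrtr_ge0.
have b0 : 0 <= (s1 x)%:num by rewrite (svalP s1P) sqrtr_ge0.
have h0x := hC0 x; rewrite (ger0_norm a0) in h0x.
have h1x := hC1 x; rewrite (ger0_norm b0) in h1x.
rewrite ger0_norm ?sqr_ge0 // cone_dist2_pi.
have c1 := cos_geN1 (Num.min (torus_dist (h0 x) (h1 (eta x))) pi).
have ab : 0 <= (s0 x)%:num * (s1 x)%:num by rewrite mulr_ge0.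
have ab2 : (s0 x)%:num * (s1 x)%:num <= C0 * C1 by exact: ler_pM.
have aa : (s0 x)%:num ^+ 2 <= C0 ^+ 2 by rewrite lerXn2r // nnegrE // (le_trans a0).
have bb : (s1 x)%:num ^+ 2 <= C1 ^+ 2 by rewrite lerXn2r // nnegrE // (le_trans b0).
have : (s0 x)%:num * (s1 x)%:num * (-1) <= (s0 x)%:num * (s1 x)%:num * cos (Num.min (torus_dist (h0 x) (h1 (eta x))) pi).
  by rewrite ler_wpM2l.
move: (cos _) => c; lra.
Qed.

Let bgam : bm (fun x => gam F G w (at_ x)).
Proof.
rewrite (_ : (fun x => _) = fun x => 1 / 2 * (m0 x + J x * m1 (eta x) -
   cone_dist (cone_pi (h0 x, s0 x)) (cone_pi (h1 (eta x), s1 x)) ^+ 2)).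
  apply: bm_mul (bm_cst _) _; apply: bm_sub => //; apply: bm_add => //.
  exact: bm_mul.
have key (a b c d : R) : c = a + b - 2 * d -> d = 1 / 2 * (a + b - c) by move=> ->; field.
by apply/funext => x; exact: key (costE x).
Qed.

Let cost := expect m0 + expect m1 - 2 * expect (fun x => gam F G w (at_ x)).

Let upper : exists2 q, HK_coupling (exp_mu mu phi) (exp_mu mu psi) q &
  (\int[q]_p (cone_dist p.1 p.2 ^+ 2)%:E = cost%:E)%E.
Proof.
have D0 A : measurable A -> (exp_mu mu phi A = \int[mu]_(x in h0 @^-1` A) ((s0 x)%:num ^+ 2)%:E)%E.
  by move=> mA; rewrite E0 //; apply: eq_integral => x _; rewrite s0E erad0.
have D1 A : measurable A -> (exp_mu mu psi A = \int[mu]_(x in (h1 \o eta) @^-1` A) ((s1 x)%:num ^+ 2)%:E)%E.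
  move=> mA; rewrite Efl //; apply: eq_integral => x _.
  by rewrite (svalP s1P) sqr_sqrtr // mulr_ge0 // exp_mass_ge0.
have [q hq qE] := HK_coupling_upper mh0 (measurableT_comp mh1 meta) bs0 bs1 D0 D1.
exists q => //; rewrite qE -EFin_expect //; congr EFin.
under eq_fun do rewrite costE.
have b1 : bm (fun x => m0 x + J x * m1 (eta x)) by apply: bm_add => //; exact: bm_mul.
have b2 : bm (fun x => 2 * gam F G w (at_ x)) by exact: bm_mul (bm_cst 2) bgam.
rewrite (expectB b1 b2) (expectZ 2 bgam) expectD //; last exact: bm_mul.
by rewrite expect_flow // => x; exact: exp_mass_ge0.
Qed.

Variables (Kc B1 B2 : R).
Hypothesis dual : forall y z (a b : R), 0 <= a -> 0 <= b ->
   2 * a * b * cos (Num.min (torus_dist y z) pi) <=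
     expR (- dual_pot F G K id (at_ y)) * a ^+ 2 + expR (- dual_conj F G K Kc (at_ z)) * b ^+ 2.
Hypothesis gapB : forall x, `|gap F G K w Kc (at_ x)| <= B2.
Hypothesis gamB : forall x, `|gam F G w (at_ x) - ((J x - 1) / 2 + gpoly F G w (at_ x))| <= B1.

Lemma bm_dual_pot op : bm (fun y => dual_pot F G K op (at_ y)).
Proof.
rewrite /dual_pot /=; apply: bm_add; last by apply: bm_mul (bm_cst _) (bm_tev _).
apply: bm_add; last by apply: bm_mul (bm_cst _) (bm_tev _).
apply: bm_add; last by apply: bm_mul (bm_cst _) (bm_tev _).
by apply: bm_sub; apply: bm_mul (bm_cst _) (bm_tev _).
Qed.

Lemma bm_dual_disp p : bm (fun y => dual_disp F G K (at_ y) 0 p).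
Proof.
under eq_fun do rewrite mxE.
apply: bm_add; first by apply: bm_mul (bm_dual_pot _) (bm_cst _).
by apply: bm_sum => q; apply: bm_mul; apply: bm_sub; apply: bm_mul (bm_cst _) (bm_tev _).
Qed.

Lemma bm_dual_conj : bm (fun y => dual_conj F G K Kc (at_ y)).
Proof.
have mh : measurable_fun setT (fun y => torus_exp y (dual_disp F G K (at_ y))).
  by apply: measurable_torus_exp => // p; have [] := bm_dual_disp p.
have bh : bm (fun y => dual_disp2 F G K (at_ y)).
  by apply: bm_sum => p; apply: bm_X; exact: bm_dual_disp.
rewrite /dual_conj /stsize /=; apply: bm_sub; last exact: bm_cst.
apply: bm_sub; last exact: (bm_comp (bm_dual_pot id) mh).
by apply: bm_add => //; apply: bm_mul _ (bm_cst _); exact: bm_X.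
Qed.

Let P y := expR (- dual_pot F G K id (at_ y)).
Let Q y := expR (- dual_conj F G K Kc (at_ y)).
Let bP : bm P. Proof. exact: bm_expRN (bm_dual_pot id). Qed.
Let bQ : bm Q. Proof. exact: bm_expRN bm_dual_conj. Qed.

Let gapE x : gap F G K w Kc (at_ x) =
  P (h0 x) * m0 x + J x * (Q (h1 (eta x)) * m1 (eta x)) - 2 * gam F G w (at_ x).
Proof. by rewrite /gap /= base0 base1 erad0 erad1. Qed.

(** The dual value is exactly the cost of the coupling minus the expectation of [gap]. *)
Let lower q : HK_coupling (exp_mu mu phi) (exp_mu mu psi) q ->
  ((cost - B2)%:E <= \int[q]_p (cone_dist p.1 p.2 ^+ 2)%:E)%E.
Proof.
have key (a b p r g e B : R) : e <= B -> e = p + r - 2 * g -> a + b - 2 * g - B <= a + b - p - r by lra.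
move=> hq; apply: le_trans (HK_coupling_lower mh0 mh1 E0 E1 (exp_mass_ge0 _) (exp_mass_ge0 _)
  bm0 bm1 (bm_comp bP mh0) (bm_comp bQ mh1) bP.1 bQ.1
  (fun y => expR_ge0 _) (fun y => expR_ge0 _) dual hq); rewrite lee_fin.
have bPm : bm (fun x => P (h0 x) * m0 x) by exact: bm_mul (bm_comp bP mh0) bm0.
have bQm : bm (fun x => Q (h1 x) * m1 x) by exact: bm_mul (bm_comp bQ mh1) bm1.
have bQm' := bm_mul bJ (bm_comp bQm meta).
have b2 : bm (fun x => 2 * gam F G w (at_ x)) by exact: bm_mul (bm_cst 2) bgam.
have bg : bm (fun x => gap F G K w Kc (at_ x)).
  under eq_fun do rewrite gapE; exact: bm_sub (bm_add bPm bQm') b2.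
have Eg := le_trans (ler_norm _) (expect_le_norm bg gapB).
have gE : expect (fun x => gap F G K w Kc (at_ x)) =
   expect (fun x => P (h0 x) * m0 x) + expect (fun x => Q (h1 x) * m1 x) - 2 * expect (fun x => gam F G w (at_ x)).
  under eq_fun do rewrite gapE.
  rewrite (expectB (bm_add bPm bQm') b2) (expectZ 2 bgam) (expectD bPm bQm').
  rewrite (expect_flow bQm) // => x; rewrite mulr_ge0 ?expR_ge0 //; exact: exp_mass_ge0.
exact: key Eg gE.
Qed.

(* Its divergence is the part of [gpoly] that has mean zero. *)
Definition null_field q : trig := tscale (s * t ^+ 2) (tmul G (w q)) ++ (tscale (s ^+ 2 * t) (tmul F (w q))
  ++ (tscale (2 * s ^+ 2 * t ^+ 2) (tmul (tmul F G) (w q)) ++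
  (tscale (s ^+ 2 * t ^+ 2 / 2) (tmul (tsum (fun p => tmul (tD p F) (tD p G))) (w q)) ++
   tscale (s ^+ 2 * t ^+ 2 / 2) (tmul K (w q))))).

Lemma tev_div_null_field x : \sum_q tev (tD q (null_field q)) x =
   s * t ^+ 2 * (sgw G w x + tev G x * dw w x) + s ^+ 2 * t * (sfw F w x + tev F x * dw w x)
   + 2 * s ^+ 2 * t ^+ 2 * (tev G x * sfw F w x + tev F x * sgw G w x + tev F x * tev G x * dw w x)
   + s ^+ 2 * t ^+ 2 / 2 * ((\sum_q (\sum_p (tev (tD q (tD p F)) x * tev (tD p G) x + tev (tD p F) x * tev (tD q (tD p G)) x)) * tev (w q) x)
       + sfg F G x * dw w x)
   + s ^+ 2 * t ^+ 2 / 2 * (\sum_q tev (tD q K) x * tev (w q) x + tev K x * dw w x).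
Proof.
rewrite /sgw /sfw /dw !mulr_sumF -!big_split /= !mulr_sumF -!big_split /=.
apply: eq_bigr => q _; rewrite /tev !tD_cat !teval_cat !tevalD_scale !tevalD_mul !teval_mul tevalD_sum teval_sum.
have -> : \sum_p teval (tD q (tmul (tD p F) (tD p G))) (tlift x) = 
   \sum_p (teval (tD q (tD p F)) (tlift x) * teval (tD p G) (tlift x) + teval (tD p F) (tlift x) * teval (tD q (tD p G)) (tlift x)).
  by apply: eq_bigr => p _; rewrite tevalD_mul.
have -> : \sum_p teval (tmul (tD p F) (tD p G)) (tlift x) = sfg F G x.
  by apply: eq_bigr => p _; rewrite teval_mul.
by ring.
Qed.

(** Its expectation is kappa. *)
Definition curv x := sww w x + tev K x ^+ 2 - (sff F x * sgg G x - sfg F G x ^+ 2) / 3.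

Lemma gpolyE x : gpoly F G w (at_ x) =
  1 + 2 * s * tev F x + 2 * t * tev G x + 4 * s * t * tev F x * tev G x + s * t * sfg F G x
  + \sum_q tev (tD q (null_field q)) x + s ^+ 2 * t ^+ 2 * curv x / 2.
Proof.
rewrite /gpoly /gamma_poly tev_div_null_field /curv /=.
set Y := \sum_q (\sum_p _) * _; set Kw := \sum_q tev (tD q K) x * tev (w q) x.
(* This is [wE] paired with w: 2 |w|^2 = <Z, w> - <grad K, w>, where <Z, w> = 2 [sfgw] - Y by the
   product rule for the gradient of <grad F, grad G>. *)
have HY : 2 * sww w x = 2 * sfgw F G w x - Y - Kw.
  have -> : sfgw F G w x = \sum_q (\sum_p tev (tD p F) x * tev (tD q (tD p G)) x) * tev (w q) x.
    by rewrite /sfgw exchange_big /=; apply: eq_bigr => q _; rewrite mulr_suml; apply: eq_bigr => p _.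
  rewrite /Y /Kw /sww !mulr_sumF -!sumrB; apply: eq_bigr => q _.
  have -> : 2 * tev (w q) x ^+ 2 = (2 * tev (w q) x) * tev (w q) x by ring.
  rewrite mulrA -!mulrBl; congr (_ * _); rewrite wE mulr_sumF -sumrB.
  have -> : forall a b : R, 2 * ((a - b) / 2) = a - b by move=> a b; field.
  congr (_ - _); apply: eq_bigr => p _; rewrite /tev (tevalDC p q) (tevalDC p q F); ring.
have HX : sfgw F G w x = (2 * sww w x + Y + Kw) / 2 by rewrite HY; field.
by rewrite HX divw; field.
Qed.

Definition dens x := \sum_p (s * tev (tD p F) x - t * tev (tD p G) x) ^+ 2
  + 4 * (s * tev F x - t * tev G x) ^+ 2 - s ^+ 2 * t ^+ 2 * curv x.

Lemma masses_gpoly x : m0 x + m1 x - 2 * gpoly F G w (at_ x) =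
  dens x - 2 * \sum_q tev (tD q (null_field q)) x.
Proof.
rewrite gpolyE /dens -erad0 -(exp_mass_erad (@ps R n) F (@px R n) (at_ x)) exp_mass_eA /eA /ev_ /ps /px /=.
have -> : m1 x = (1 + 2 * t * tev G x) ^+ 2 + t ^+ 2 * sgg G x.
  rewrite [LHS](exp_mass_eA (@pt R n) G (@px R n) (at_ x)) /eA /ev_ /pt /px /=; congr (_ + _).
  by rewrite /sgg mulr_sumF; apply: eq_bigr => p _; rewrite exprMn.
have -> : \sum_p (s * tev (tD p F) x) ^+ 2 = s ^+ 2 * sff F x.
  by rewrite /sff mulr_sumF; apply: eq_bigr => p _; rewrite exprMn.
have -> : \sum_p (s * tev (tD p F) x - t * tev (tD p G) x) ^+ 2 =
   s ^+ 2 * sff F x - 2 * s * t * sfg F G x + t ^+ 2 * sgg G x.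
  by rewrite /sff /sgg /sfg !mulr_sumF -sumrB -big_split /=; apply: eq_bigr => p _; ring.
by field.
Qed.

Lemma bm_curv : bm curv.
Proof.
have bs (A B : 'I_n -> trig) : bm (fun x => \sum_p tev (A p) x * tev (B p) x).
  by apply: bm_sum => p; apply: bm_mul (bm_tev _) (bm_tev _).
have bsq (A : 'I_n -> trig) : bm (fun x => \sum_p tev (A p) x ^+ 2).
  by apply: bm_sum => p; apply: bm_X (bm_tev _).
rewrite /curv; apply: bm_sub; first by apply: bm_add; [exact: bsq|exact: bm_X (bm_tev _)].
apply: bm_mul _ (bm_cst _); apply: bm_sub; first by apply: bm_mul; exact: bsq.
by apply: bm_X; exact: bs.
Qed.

Lemma bm_dens : bm dens.
Proof.
have bsub (A B : trig) : bm (fun x => s * tev A x - t * tev B x).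
  by apply: bm_sub; apply: bm_mul (bm_cst _) (bm_tev _).
apply: bm_sub; last by apply: bm_mul (bm_cst _) bm_curv.
apply: bm_add; first by apply: bm_sum => p; apply: bm_X; exact: bsub.
by apply: bm_mul (bm_cst _) _; apply: bm_X; exact: bsub.
Qed.

Lemma HK_estimate_at : exists2 v : R,
  (HK (exp_mu mu phi) (exp_mu mu psi) ^+ 2 = v%:E)%E & `|v - expect dens| <= 2 * B1 + B2.
Proof.
have key3 (a b g D : R) : a + b - 2 * g + (1 - 1) - (D - 2 * 0) = a + b - 2 * g - D by ring.
have key2 (a j g gp B : R) : `|g - (j / 2 + gp)| <= B -> `|a - 2 * g + j - (a - 2 * gp)| <= 2 * B.
  by rewrite !ler_norml => /andP[? ?]; apply/andP; split; lra.
have key (a b c B B' : R) : a - B' <= c -> c <= a -> `|a - b| <= B -> `|c - b| <= B + B'.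
  by move=> ? ?; rewrite !ler_norml => /andP[? ?]; apply/andP; split; lra.
have [v vE /andP[v1 v2]] := HK_bounds lower upper.
exists v => //.
have bdiv : bm (fun x => \sum_q tev (tD q (null_field q)) x) by apply: bm_sum => q; exact: bm_tev.
have b2g : bm (fun x => 2 * gam F G w (at_ x)) by exact: bm_mul (bm_cst 2) bgam.
(* Adding J - 1, of mean zero, cancels the term (J - 1) / 2 kept unexpanded in [gam]; masses are
   compared at x because eta preserves their means. *)
pose err x := m0 x + m1 x - 2 * gam F G w (at_ x) + (J x - 1) - (dens x - 2 * \sum_q tev (tD q (null_field q)) x).
have errB x : `|err x| <= 2 * B1.
  rewrite /err -masses_gpoly.
  exact: key2 (gamB x).
have bmm : bm (fun x => m0 x + m1 x) by exact: bm_add.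
have bmg := bm_sub bmm b2g.
have bJ1 := bm_sub bJ (bm_cst 1).
have b2d : bm (fun x => 2 * \sum_q tev (tD q (null_field q)) x) by exact: bm_mul (bm_cst 2) bdiv.
have bdd := bm_sub bm_dens b2d.
have berr : bm err by exact: bm_sub (bm_add bmg bJ1) bdd.
have : expect err = cost - expect dens.
  rewrite /err (expectB (bm_add bmg bJ1) bdd) (expectD bmg bJ1) (expectB bmm b2g) (expectB bJ (bm_cst 1)).
  rewrite (expectB bm_dens b2d) (expectZ 2 bdiv) (expectZ 2 bgam) (expectD bm0 bm1) expect_J expect_cst.
  rewrite expect_sum => [|q]; last exact: bm_tev.
  rewrite big1 => [|q _]; last exact: expect_tD.
  exact: key3.
move=> errE; have := expect_le_norm berr errB; rewrite errE.
exact: key v1 v2.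
Qed.

End At.
End HKEstimate.

(** * The correction field, and the estimate for small s and t *)

Section HKEstimateNear.
Context {R : realType} {n : nat}.
Notation I := (R * R * torus R n)%type.
Notation trig := (seq (R * 'rV[int]_n * R)).
Notation mu := (torus_volume R n).
Variables (F G : trig).

(** The Lie bracket of the gradient fields of F and G, which is the field Z; [corr_pot] and
    [corr_field] are K and w. *)
Definition commutator_field p : trig := tsum (fun q => tmul (tD q (tD p G)) (tD q F) ++ tscale (-1) (tmul (tD q (tD p F)) (tD q G))).
Definition corr_pot : trig := tscale (-1) (tresolvent (tsum (fun p => tD p (commutator_field p)))).
Definition corr_field p : trig := tscale (1 / 2) (commutator_field p ++ tscale (-1) (tD p corr_pot)).

Lemma tev_commutator_field p x : tev (commutator_field p) x = \sum_q (tev (tD q (tD p G)) x * tev (tD q F) x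
  - tev (tD q (tD p F)) x * tev (tD q G) x).
Proof.
rewrite /tev teval_sum; apply: eq_bigr => q _.
by rewrite teval_cat teval_scale !teval_mul mulN1r.
Qed.

Lemma corr_fieldE p x : tev (corr_field p) x = (\sum_q (tev (tD q (tD p G)) x * tev (tD q F) x
  - tev (tD q (tD p F)) x * tev (tD q G) x) - tev (tD p corr_pot) x) / 2.
Proof.
by rewrite -tev_commutator_field /tev teval_scale teval_cat teval_scale; field.
Qed.

(** By construction div w = (div Z - Laplacian K) / 2, and the resolvent equation reads 4 K -
    Laplacian K = - div Z. *)
Lemma div_corr_field x : dw corr_field x = - 2 * tev corr_pot x.
Proof.
have E := tresolventE (tsum (fun p => tD p (commutator_field p))) (tlift x).
have -> : dw corr_field x = (\sum_p teval (tD p (commutator_field p)) (tlift x) + \sum_p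
   teval (tD p (tD p (tresolvent (tsum (fun p => tD p (commutator_field p)))))) (tlift x)) / 2.
  rewrite -big_split mulr_suml; apply: eq_bigr => p _ /=.
  rewrite /tev tevalD_scale tD_cat teval_cat tevalD_scale.
  have -> : teval (tD p (tD p corr_pot)) (tlift x) =
     - teval (tD p (tD p (tresolvent (tsum (fun p => tD p (commutator_field p)))))) (tlift x).
    rewrite tevalDD [RHS]/= tevalDD /corr_pot big_map -sumrN; apply: eq_bigr => c _ /=; ring.
  by field.
move: E; by rewrite teval_sum /tev teval_scale => <-; field.
Qed.

Lemma near_smaller (b c : R) : 0 < c -> ev (fun i : I => `|i.1.1 * i.1.2| * b <= c).
Proof.
move=> c0; have H : isO 2 (fun i : I => i.1.1 * i.1.2 * b) by bigO.
apply: ev_imp (isO_small _ c0 H) => // i h; apply: le_trans h.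
by rewrite [leRHS]normrM ler_wpM2l // ler_norm.
Qed.

Lemma HK_estimate : exists C e : R, 0 < e /\
  forall s t : R, 0 < s -> 0 < t -> s + t <= e ->
  exists2 v : R, (HK (exp_mu mu (fun x => (s * tev F x)%R)) (exp_mu mu (fun x => (t * tev G x)%R)) ^+ 2 = v%:E)%E &
   `|v - expect (dens F G corr_pot corr_field s t)| <= C * (s + t) ^+ 5.
Proof.
have [Kc Kc0 [e1 e10 dual]] := dual_inequality F G corr_pot.
have [Cg Cg0 Hg] := isO_gap corr_fieldE div_corr_field Kc.
have [Cm Cm0 Hm] := isO_gam F G corr_field.
have h : 0 < 1 / 2 :> R by lra.
have S1 := ev_all (fun p => near_smaller (tbound (corr_field p)) ltr01).
have S2 := ev_all (fun p => near_smaller (tbound (tD p (corr_field p))) h).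
have S3 := isO_small (isT : (0 < 2)%N) h (isO_fJ1 corr_field).
have S4 := ev_all (fun p => isO_small (isT : (0 < 1)%N) ltr01 (isO_disp_diff1 F G corr_field p)).
have S5 := isO_small (isT : (0 < 2)%N) ltr01 (isO_disp2 F G corr_field).
have [e e0 He] := ev_and (ev_and Hg Hm) (ev_and (ev_and S1 S2) (ev_and S3 (ev_and S4 S5))).
exists (2 * Cm + Cg), (Num.min e e1); split; first by rewrite lt_min e0.
move=> s t s0 t0; rewrite le_min => /andP[ste ste1].
have H x := He (s, t, x) s0 t0 ste.
have H1 x := proj1 (proj1 (H x)); have H2 x := proj2 (proj1 (H x)).
(* These smallness conditions involve s and t alone, so any point of the torus serves. *)
have H3 := proj1 (proj1 (proj2 (H point))); have H4 := proj2 (proj1 (proj2 (H point))).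
have H5 x := proj1 (proj2 (proj2 (H x))); have H6 x := proj1 (proj2 (proj2 (proj2 (H x)))).
have H7 x := le_trans (ler_norm _) (proj2 (proj2 (proj2 (proj2 (H x))))).
have [v vE vB] := @HK_estimate_at R n F G corr_pot corr_field corr_fieldE div_corr_field s t H3 H4 H5 H6 H7 Kc (Cm * (s + t) ^+ 5) (Cg * (s + t) ^+ 5)
  (dual s t s0 t0 ste1) H1 H2.
by exists v => //; rewrite mulrDl -mulrA.
Qed.

End HKEstimateNear.

(** * Fourier modes *)

Section MeanValue.
Context {R : realType} {n : nat}.
Notation trig := (seq (R * 'rV[int]_n * R)).
Implicit Types (T : trig) (x : torus R n) (m : 'rV[int]_n).

Definition tmean T : R := \sum_(c <- T) (if c.1.2 == 0 then c.1.1 * cos c.2 else 0).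

(** A mode with nonzero p-th frequency is the derivative in direction p of another mode, hence has
    mean zero by [expect_tD]; the other modes are constants. *)
Lemma expect_tev T : expect (tev T) = tmean T.
Proof.
elim: T => [|c T IH].
  rewrite /tmean big_nil (_ : tev [::] = fun=> 0) ?expect_cst //.
  by apply/funext => x; rewrite /tev teval_nil.
rewrite /tmean big_cons -/(tmean T) -IH.
rewrite (_ : tev (c :: T) = fun x => tev [:: c] x + tev T x); last first.
  by apply/funext => x; rewrite /tev !teval_cons teval_nil addr0.
rewrite expectD; [|exact: bm_tev|exact: bm_tev]; congr (_ + _).
case: eqP => [m0|/eqP m0].
  rewrite (_ : tev [:: c] = fun=> c.1.1 * cos c.2) ?expect_cst //.
  by apply/funext => x; rewrite /tev teval_cons teval_nil m0 phase0l add0r addr0.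
have [p mp] : exists p, c.1.2 0 p != 0.
  apply/existsP; rewrite -negb_forall; apply: contra m0 => /forallP h.
  by apply/eqP/rowP => p; rewrite mxE; exact/eqP.
have mpR : (c.1.2 0 p)%:~R != 0 :> R by rewrite intr_eq0.
rewrite -[RHS](expect_tD p [:: (c.1.1 / (c.1.2 0 p)%:~R, c.1.2, c.2 - pi / 2)]).
congr expect; apply/funext => x; rewrite /tev !teval_cons teval_nil /= divfK //.
by rewrite !addr0 subrK.
Qed.

(** In other words, T depends only on the coordinates outside A. *)
Definition tvanish (A : pred 'I_n) T := forall c p, c \in T -> A p -> c.1.2 0 p = 0.

(** Independence of disjoint sets of coordinates, read off frequencies: c + d or c - d vanishes only
    if both c and d do, as their supports are disjoint. *)
Lemma tmean_mul (A : pred 'I_n) T T' : tvanish A T -> tvanish (predC A) T' ->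
  tmean (tmul T T') = tmean T * tmean T'.
Proof.
move=> hT hT'; rewrite /tmean /tmul big_flatten big_map mulr_suml big_seq [RHS]big_seq.
apply: eq_bigr => c cT; rewrite big_flatten big_map mulr_sumr big_seq [RHS]big_seq.
apply: eq_bigr => d dT'; rewrite /tmul1 !big_cons big_nil /=.
have V0 (m : 'rV[int]_n) : (m == 0) = [forall p, m 0 p == 0].
  apply/eqP/forallP => [-> p|h]; first by rewrite mxE.
  by apply/rowP => p; rewrite mxE; exact/eqP.
have E (m : 'rV[int]_n) : (forall p, (m 0 p == 0) = (c.1.2 0 p == 0) && (d.1.2 0 p == 0)) ->
    (m == 0) = (c.1.2 == 0) && (d.1.2 == 0).
  move=> h; rewrite !V0; apply/forallP/andP => [m0|[/forallP c0 /forallP d0] p]; last by rewrite h c0 d0.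
  by split; apply/forallP => p; have := m0 p; rewrite h => /andP[].
have Z p : (c.1.2 0 p = 0) \/ (d.1.2 0 p = 0).
  by have [Ap|Ap] := boolP (A p); [left; exact: hT|right; exact: hT'].
have E1 : (c.1.2 + d.1.2 == 0) = (c.1.2 == 0) && (d.1.2 == 0).
  by apply: E => p; rewrite mxE; have [->|->] := Z p; rewrite ?add0r ?addr0 eqxx ?andbT.
have E2 : (c.1.2 - d.1.2 == 0) = (c.1.2 == 0) && (d.1.2 == 0).
  by apply: E => p; rewrite !mxE; have [->|->] := Z p; rewrite ?sub0r ?subr0 ?oppr_eq0 eqxx ?andbT.
rewrite E1 E2; case: eqP => _; case: eqP => _ /=; rewrite ?mulr0 ?mul0r ?addr0 //.
by rewrite cosD cosB; field.
Qed.

Lemma tvanish_mul (A : pred 'I_n) T T' : tvanish A T -> tvanish A T' -> tvanish A (tmul T T').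
Proof.
move=> h h' c p /flatten_mapP[d dT] /flatten_mapP[d' dT'].
by rewrite !inE => /orP[] /eqP -> Ap /=; rewrite !mxE (h _ _ dT Ap) (h' _ _ dT' Ap) ?subr0 ?addr0.
Qed.

Definition tprodl (U : 'I_n -> trig) (r : seq 'I_n) : trig :=
  foldr (fun p T => tmul (U p) T) [:: (1, 0, 0)] r.
Definition tprod U := tprodl U (index_enum 'I_n).

Lemma teval_prodl U r (x : 'rV[R]_n) : teval (tprodl U r) x = \prod_(p <- r) teval (U p) x.
Proof.
elim: r => [|p r IH] /=; last by rewrite teval_mul IH big_cons.
by rewrite big_nil teval_cons teval_nil /= phase0l !addr0 cos0 mulr1.
Qed.

Lemma tev_prod U x : tev (tprod U) x = \prod_p tev (U p) x.
Proof. exact: teval_prodl. Qed.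

Lemma tmean_prod U : (forall p, tvanish (predC1 p) (U p)) -> tmean (tprod U) = \prod_p tmean (U p).
Proof.
move=> hU; rewrite /tprod.
have V r : tvanish [pred q | q \notin r] (tprodl U r).
  elim: r => [|p r IH] /=; first by move=> c q; rewrite mem_seq1 => /eqP -> _; rewrite mxE.
  apply: tvanish_mul => c q cT /=; rewrite inE negb_or => /andP[qp qr].
    exact: (hU p c q).
  exact: IH.
elim: (index_enum _) (index_enum_uniq 'I_n) => [|p r IH] /=.
  by rewrite /tmean big_cons !big_nil /= eqxx cos0 mulr1 addr0.
move=> /andP[pr ur]; rewrite big_cons -IH //; apply: (tmean_mul (A := predC1 p)) => //.
by move=> c q cT /negPn /= /eqP ->; exact: (V r c p).
Qed.

Lemma expect_prod U : (forall p, tvanish (predC1 p) (U p)) ->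
  expect (fun x => \prod_p tev (U p) x) = \prod_p tmean (U p).
Proof.
by move=> hU; rewrite -tmean_prod // -expect_tev; congr expect; apply/funext => x; rewrite tev_prod.
Qed.

Lemma phase_scale_delta (z : int) p (x : 'rV[R]_n) : phase (z *: delta_mx 0 p) x = z%:~R * x 0 p.
Proof.
rewrite /phase (bigD1 p) //= big1 ?addr0; first by rewrite !mxE !eqxx mulr1.
by move=> q qp; rewrite !mxE /= (negPf qp) mulr0 mul0r.
Qed.

Section Wave.
Implicit Types (a c : 'I_n -> R) (j : 'I_n -> int).

Definition tcos a j c (p : 'I_n) : trig := [:: (a p, j p *: delta_mx 0 p, c p)].

Lemma tvanish_cos a j c p : tvanish (predC1 p) (tcos a j c p).
Proof. by move=> d q; rewrite inE => /eqP -> /= qp; rewrite !mxE /= (negPf qp) mulr0. Qed.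

(** Differentiating a product of cosines in direction p gives another one: the p-th factor gains its
    frequency and, in [wave_phase], a quarter turn. *)
Definition wave_amp a j p q : R := if q == p then a q * (j q)%:~R else a q.
Definition wave_phase c p q : R := if q == p then c q + pi / 2 else c q.

Lemma tevalD_prodl a j c p r (x : 'rV[R]_n) : uniq r -> teval (tD p (tprodl (tcos a j c) r)) x =
  if p \in r then \prod_(q <- r) teval (tcos (wave_amp a j p) j (wave_phase c p) q) x else 0.
Proof.
elim: r => [|q r IH] /=; first by rewrite teval_cons teval_nil /= mxE mulr0 mul0r addr0.
move=> /andP[qr ur]; rewrite tevalD_mul IH // inE big_cons.
have [pq|pq] := eqVneq p q; last first.
  rewrite (_ : teval (tD p _) x = 0) ?mul0r ?add0r; last first.
    by rewrite teval_cons teval_nil /= !mxE /= (negPf pq) !mulr0 mul0r addr0.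
  case: ifP => _ /=; rewrite ?mulr0 //; congr (_ * _).
  by rewrite /tcos /wave_amp /wave_phase eq_sym (negPf pq).
rewrite -pq in qr *; rewrite (negPf qr) mulr0 addr0 teval_prodl; congr (_ * _).
  by rewrite !teval_cons !teval_nil /= !mxE /= !eqxx /wave_amp /wave_phase eqxx mulr1.
apply: eq_big_seq => q' q'r; rewrite /tcos /wave_amp /wave_phase.
by rewrite (_ : q' == p = false) //; apply: contraNF qr => /eqP <-.
Qed.

Lemma tevD_prod a j c p x : tev (tD p (tprod (tcos a j c))) x =
  tev (tprod (tcos (wave_amp a j p) j (wave_phase c p))) x.
Proof.
by rewrite /tev tevalD_prodl ?index_enum_uniq // mem_index_enum teval_prodl.
Qed.

Lemma tev_cos_le a j c p x : `|tev (tcos a j c p) x| <= `|a p|.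
Proof. by rewrite (le_trans (tev_le _ _)) // /tbound big_cons big_nil /= addr0. Qed.

Lemma tev_prod_le a j c x : `|tev (tprod (tcos a j c)) x| <= \prod_p `|a p|.
Proof.
rewrite tev_prod normr_prod; apply: ler_prod => p _.
by rewrite normr_ge0 tev_cos_le.
Qed.

Lemma scale_delta_eq0 (z : int) (p : 'I_n) : (z *: delta_mx 0 p == 0 :> 'rV[int]_n) = (z == 0).
Proof.
apply/eqP/eqP => [/rowP/(_ p)|->]; last by rewrite scale0r.
by rewrite !mxE !eqxx mulr1.
Qed.

Lemma tmean_cos2 a j c a' j' c' p : tmean (tmul (tcos a j c p) (tcos a' j' c' p)) =
  a p * a' p / 2 * ((j p == - j' p)%:R * cos (c p + c' p) + (j p == j' p)%:R * cos (c p - c' p)).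
Proof.
rewrite /tmean /tmul /= /tmul1 !big_cons big_nil /= -scalerDl -scalerBl !scale_delta_eq0.
rewrite subr_eq0 addr_eq0.
by case: eqP => _; case: eqP => _ /=; rewrite ?mul0r ?mul1r; ring.
Qed.

Definition energy a j c p : R := tmean (tmul (tcos a j c p) (tcos a j c p)).

Lemma energyE a j c p : energy a j c p = a p ^+ 2 / 2 * (1 + (j p == 0)%:R * cos (c p + c p)).
Proof.
rewrite /energy tmean_cos2 eqxx subrr cos0.
have -> : (j p == - j p) = (j p == 0) by lia.
by rewrite /=; ring.
Qed.

Lemma energy_ge0 a j c p : 0 <= energy a j c p.
Proof.
rewrite energyE mulr_ge0 ?divr_ge0 ?sqr_ge0 //.
have := cos_geN1 (c p + c p); case: eqP => _ /=; rewrite ?mul0r ?mul1r; lra.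
Qed.

(** The constant 3/2 = (3/8) / (1/2)^2 is the ratio of the mean of cos^4 to the squared mean of
    cos^2, the worst case for equal or opposite nonzero frequencies. A zero frequency makes one
    factor constant and the ratio 1. *)
Lemma tmean_cos4 a j c a' j' c' p :
  tmean (tmul (tmul (tcos a j c p) (tcos a j c p)) (tmul (tcos a' j' c' p) (tcos a' j' c' p)))
  <= 3 / 2 * (energy a j c p * energy a' j' c' p).
Proof.
set LHS := tmean _.
have -> : LHS = a p ^+ 2 * a' p ^+ 2 / 8 * ((j p == - j' p)%:R * cos ((c p + c p) + (c' p + c' p))
   + (j p == j' p)%:R * cos ((c p + c p) - (c' p + c' p)) + 2 * (j p == 0)%:R * cos (c p + c p)
   + 2 * (j' p == 0)%:R * cos (c' p + c' p) + 2).
  rewrite /LHS /tmean /tmul /= /tmul1 !big_cons big_nil /=.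
  rewrite -!(scalerDl, scalerBl) !scale_delta_eq0 !subrr !(addr0, add0r, subr0, sub0r) cos0 eqxx cosN.
  have -> : (j p + j p + (j' p + j' p) == 0) = (j p == - j' p) by lia.
  have -> : (j p + j p - (j' p + j' p) == 0) = (j p == j' p) by lia.
  have -> : (j p + j p == 0) = (j p == 0) by lia.
  have -> : (- (j' p + j' p) == 0) = (j' p == 0) by lia.
  have -> : (j' p + j' p == 0) = (j' p == 0) by lia.
  by do 4! case: eqP => _ /=; field.
have a0 := sqr_ge0 (a p); have a0' := sqr_ge0 (a' p).
have aa := mulr_ge0 a0 a0'.
have := mulr_ge0 (energy_ge0 a j c p) (energy_ge0 a' j' c' p).
rewrite !energyE.
have k2 (X Y : R) : 0 <= X -> Y = X -> Y <= 3 / 2 * X by move=> ? ->; lra.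
have [j0|j0] := eqVneq (j p) 0.
  have -> : (j p == - j' p) = (j' p == 0) by lia.
  have -> : (j p == j' p) = (j' p == 0) by lia.
  move=> X0; apply: (k2 _ _ X0).
  by rewrite cosD cosB /=; case: eqP => _ /=; field.
have [j0'|j0'] := eqVneq (j' p) 0.
  have -> : (j p == - j' p) = false by lia.
  have -> : (j p == j' p) = false by lia.
  by move=> X0; apply: (k2 _ _ X0); rewrite /=; field.
have key b : b <= 1 -> a p ^+ 2 * a' p ^+ 2 / 8 * (b + 2) <= 3 / 2 * (a p ^+ 2 / 2 * 1 * (a' p ^+ 2 / 2 * 1)) :> R.
  move=> b1; have := mulr_ge0 aa (_ : 0 <= 1 - b); rewrite subr_ge0 => /(_ b1); lra.
move=> _; rewrite !mul0r !addr0 !mulr0 !mul0r !addr0; apply: key.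
have c1 := cos_le1 (c p + c p + (c' p + c' p)); have c2 := cos_le1 (c p + c p - (c' p + c' p)).
(* At most one of the two resonances occurs, since j p is not zero. *)
have [e1|e1] := eqVneq (j p) (- j' p); have [e2|e2] := eqVneq (j p) (j' p); rewrite /= ?mul1r ?mul0r ?add0r ?addr0 //.
by exfalso; move: j0; lia.
Qed.

Lemma expect_wave2 a j c a' j' c' :
  expect (fun x => tev (tprod (tcos a j c)) x * tev (tprod (tcos a' j' c')) x) =
  \prod_p tmean (tmul (tcos a j c p) (tcos a' j' c' p)).
Proof.
rewrite -expect_prod => [|p]; last by apply: tvanish_mul; exact: tvanish_cos.
congr expect; apply/funext => x; rewrite !tev_prod -big_split /=.
by apply: eq_bigr => p _; rewrite /tev teval_mul.
Qed.

(** The mean factors over coordinates, and each coordinate costs one factor 3/2. *)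
Lemma expect_wave4 a j c a' j' c' :
  expect (fun x => tev (tprod (tcos a j c)) x ^+ 2 * tev (tprod (tcos a' j' c')) x ^+ 2) <=
  (3 / 2) ^+ n * ((\prod_p energy a j c p) * \prod_p energy a' j' c' p).
Proof.
have -> : (fun x => tev (tprod (tcos a j c)) x ^+ 2 * tev (tprod (tcos a' j' c')) x ^+ 2) =
  (fun x => \prod_p tev (tmul (tmul (tcos a j c p) (tcos a j c p)) (tmul (tcos a' j' c' p) (tcos a' j' c' p))) x).
  apply/funext => x; rewrite !tev_prod -!prodrXl -big_split /=.
  by apply: eq_bigr => p _; rewrite /tev !teval_mul !expr2.
rewrite expect_prod => [|p]; last by do 2! apply: tvanish_mul; exact: tvanish_cos.
have -> : (3 / 2) ^+ n = \prod_(p < n) (3 / 2) :> R by rewrite prodr_const card_ord.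
rewrite -!big_split /=; apply: ler_prod => p _; rewrite tmean_cos4 andbT.
rewrite -expect_tev.
have B : bm (tev (tmul (tmul (tcos a j c p) (tcos a j c p)) (tmul (tcos a' j' c' p) (tcos a' j' c' p)))) by exact: bm_tev.
have := le_expect (bm_cst 0) B; rewrite expect_cst; apply => x.
by rewrite /tev !teval_mul -!expr2 -exprMn sqr_ge0.
Qed.

End Wave.

Section Fourier.
Implicit Types (k l : 'rV[int]_n).

Definition famp k (p : 'I_n) : R := if k 0 p == 0 then 1 else Num.sqrt 2.
Definition fphase k (p : 'I_n) : R := if k 0 p < 0 then - (pi / 2) else 0.
Definition ffreq k (p : 'I_n) : int := k 0 p.
Definition tfourier k : trig := tprod (tcos (famp k) (ffreq k) (fphase k)).
Definition tfourierD k p : trig := tprod (tcos (wave_amp (famp k) (ffreq k) p) (ffreq k) (wave_phase (fphase k) p)).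
Lemma fourierE k : fourier k = tev (tfourier k).
Proof.
apply/funext => x; rewrite tev_prod; apply: eq_bigr => p _.
rewrite /circle_fourier /tev teval_cons teval_nil /= phase_scale_delta /famp /fphase /ffreq mxE addr0.
case: ltrgt0P => h.
- by rewrite addr0.
- rewrite addrC cosD cosN sinN cos_pihalf sin_pihalf; ring.
- by rewrite h mul0r addr0 cos0 mulr1.
Qed.

End Fourier.
End MeanValue.

(** * Mean squares and sup bounds of Fourier modes, and the bounds on kappa *)

Section FourierBounds.
Context {R : realType} {n : nat}.
Notation trig := (seq (R * 'rV[int]_n * R)).
Notation mu := (torus_volume R n).
Implicit Types (k l : 'rV[int]_n) (x : torus R n) (T F G : trig).

(** Although [tD] acts on lists, its value is a partial derivative and so depends only on the
    function represented. *)
Lemma tevD_ext p T T' : tev T = tev T' -> tev (tD p T) = tev (tD p T').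
Proof.
move=> e; have E S x : tev (tD p S) x = grad (tev S) x 0 p by rewrite grad_tev mxE.
by apply/funext => x; rewrite !E e.
Qed.

Lemma prod_wave_amp (a : 'I_n -> R) j p :
  \prod_q `|wave_amp a j p q| = `|(j p)%:~R| * \prod_q `|a q|.
Proof.
rewrite (bigD1 p) //= [in RHS](bigD1 p) //= /wave_amp eqxx normrM mulrCA -mulrA; congr (_ * (_ * _)).
by apply: eq_bigr => q /negPf ->.
Qed.

Definition fsup k : R := \prod_q `|famp k q|.

Lemma fsup_ge0 k : 0 <= fsup k. Proof. by apply: prodr_ge0. Qed.

Lemma fsup_sqr k : fsup k ^+ 2 <= 2 ^+ n.
Proof.
rewrite /fsup -prodrXl -[X in _ ^+ X]card_ord -prodr_const; apply: ler_prod => q _.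
rewrite sqr_ge0 /= /famp; case: eqP => _; first by rewrite normr1 expr1n ler1n.
by rewrite real_normK ?num_real // sqr_sqrtr.
Qed.

Lemma tevD_fourier k p x : tev (tD p (tfourier k)) x = tev (tfourierD k p) x :> R.
Proof. exact: tevD_prod. Qed.

Lemma tevD_fourier_le k p x : `|tev (tD p (tfourier k)) x| <= `|(k 0 p)%:~R| * fsup k.
Proof. by rewrite tevD_fourier (le_trans (tev_prod_le _ _ _ _)) // prod_wave_amp. Qed.

Lemma tevDD_fourier_le k p q x :
  `|tev (tD q (tD p (tfourier k))) x| <= `|(k 0 q)%:~R| * (`|(k 0 p)%:~R| * fsup k).
Proof.
have e : tev (tD p (tfourier k)) = tev (tfourierD k p) :> (torus R n -> R).
  by apply/funext => y; exact: tevD_fourier.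
by rewrite (tevD_ext q e) tevD_prod (le_trans (tev_prod_le _ _ _ _)) // !prod_wave_amp.
Qed.

Lemma energy_fourier k q : energy (famp k) (ffreq k) (fphase k) q = 1 :> R.
Proof.
rewrite energyE /famp /ffreq /fphase; case: eqP => [->|_] /=.
  by rewrite ?ltxx addr0 cos0; field.
by rewrite sqr_sqrtr //; field.
Qed.

Lemma prod_energy_fourier k : \prod_q energy (famp k) (ffreq k) (fphase k) q = 1 :> R.
Proof. by rewrite big1 // => q _; exact: energy_fourier. Qed.

Lemma prod_energy_fourierD k p :
  \prod_q energy (wave_amp (famp k) (ffreq k) p) (ffreq k) (wave_phase (fphase k) p) q = (k 0 p)%:~R ^+ 2 :> R.
Proof.
rewrite (bigD1 p) //= big1 ?mulr1 => [|q qp]; last first.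
  by rewrite -[RHS](energy_fourier k q) !energyE /wave_amp /wave_phase (negPf qp).
rewrite energyE /wave_amp /wave_phase eqxx /famp /ffreq; case: eqP => [->|_] /=.
  by rewrite mulr0 expr0n /= !mul0r.
by rewrite exprMn sqr_sqrtr //; field.
Qed.

Lemma expect_fourierD_sqr k p : expect (fun x => tev (tD p (tfourier k)) x * tev (tD p (tfourier k)) x) = (k 0 p)%:~R ^+ 2 :> R.
Proof.
under eq_fun do rewrite tevD_fourier.
by rewrite expect_wave2; exact: prod_energy_fourierD.
Qed.

Lemma expect_fourier_sqr k : expect (fun x => tev (tfourier k) x * tev (tfourier k) x) = 1 :> R.
Proof. by rewrite expect_wave2; exact: prod_energy_fourier. Qed.

(** The frequencies are opposite and nonzero, so one factor is a sine and the other a cosine: the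
    phases add up to - pi / 2. *)
Lemma fourier_phase_orth k l p : k 0 p != l 0 p -> k 0 p = - l 0 p -> cos (fphase k p + fphase l p) = 0 :> R.
Proof.
rewrite /fphase => kl e; case: ltrP => h; case: ltrP => h'.
- by exfalso; move: h h' e; lia.
- by rewrite addr0 cosN cos_pihalf.
- by rewrite add0r cosN cos_pihalf.
- by exfalso; move: h h' e kl; lia.
Qed.

Lemma orth_factor k l : k <> l -> exists p, k 0 p != l 0 p.
Proof.
move=> kl; apply/existsP; rewrite -negb_forall; apply/negP => /forallP h.
by apply: kl; apply/rowP => p; exact/eqP.
Qed.

Lemma expect_fourier_orth k l : k <> l -> expect (fun x => tev (tfourier k) x * tev (tfourier l) x) = 0 :> R.
Proof.
move=> /orth_factor[p kl]; rewrite expect_wave2 (bigD1 p) //= tmean_cos2 /ffreq (negPf kl).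
case: eqP => [e|_]; last by rewrite !mul0r addr0 mulr0 mul0r.
by rewrite (fourier_phase_orth kl e) mulr0 mul0r addr0 mulr0 mul0r.
Qed.

Lemma expect_fourierD_orth k l q : k <> l ->
  expect (fun x => tev (tD q (tfourier k)) x * tev (tD q (tfourier l)) x) = 0 :> R.
Proof.
move=> /orth_factor[p kl]; under eq_fun do rewrite !tevD_fourier.
rewrite expect_wave2 (bigD1 p) //= tmean_cos2 /ffreq (negPf kl).
case: eqP => [e|_]; last by rewrite !mul0r addr0 mulr0 mul0r.
have -> : cos (wave_phase (fphase k) q p + wave_phase (fphase l) q p) = 0 :> R.
  rewrite /wave_phase; case: ifP => _; last exact: fourier_phase_orth kl e.
  have -> : fphase k p + pi / 2 + (fphase l p + pi / 2) = (fphase k p + fphase l p) + pi :> R by field.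
  by rewrite cosDpi (fourier_phase_orth kl e) oppr0.
by rewrite mulr0 mul0r addr0 mulr0 mul0r.
Qed.

Lemma H1_dot_tev T T' : H1_dot mu (tev T) (tev T') =
  \sum_p expect (fun x => tev (tD p T) x * tev (tD p T') x) + 4 * expect (fun x => tev T x * tev T' x).
Proof.
have b p : bm (fun x : torus R n => tev (tD p T) x * tev (tD p T') x) by apply: bm_mul; exact: bm_tev.
have b0 : bm (fun x : torus R n => tev T x * tev T' x) by apply: bm_mul; exact: bm_tev.
rewrite -expectZ // -expect_sum // -expectD //; last 2 first.
- exact: bm_sum.
- exact: bm_mul (bm_cst 4) b0.
congr expect; apply/funext => x; congr (_ + _); last by rewrite mulrA.
by apply: eq_bigr => p _; rewrite !grad_tev !mxE.
Qed.

Lemma H1_norm_sqr T : H1_norm mu (tev T) ^+ 2 = H1_dot mu (tev T) (tev T).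
Proof.
rewrite /H1_norm sqr_sqrtr // H1_dot_tev.
have e0 T' : 0 <= expect (fun x : torus R n => tev T' x * tev T' x).
  rewrite -(@expect_cst R n 0); apply: le_expect; first exact: bm_cst.
    by apply: bm_mul; exact: bm_tev.
  by move=> x; rewrite -expr2 sqr_ge0.
by rewrite addr_ge0 ?mulr_ge0 // sumr_ge0.
Qed.

Lemma enorm_map_intr k : enorm (map_mx intr k : 'rV[R]_n) ^+ 2 = fnorm2 k.
Proof.
rewrite /enorm sqr_sqrtr; first by apply: eq_bigr => p _; rewrite mxE -expr2.
by apply: sumr_ge0 => p _; rewrite -expr2 sqr_ge0.
Qed.

Lemma Lambda_fourier k l : k <> l ->
  Lambda mu (fourier k) (fourier l) = (fnorm2 k + 4) * (fnorm2 l + 4) :> R.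
Proof.
move=> kl; rewrite /Lambda !fourierE !H1_norm_sqr !H1_dot_tev.
rewrite !expect_fourier_sqr expect_fourier_orth // mulr0 addr0 !mulr1.
under eq_bigr do rewrite expect_fourierD_sqr.
under [X in _ * (X + 4)]eq_bigr do rewrite expect_fourierD_sqr.
by rewrite [X in _ - X ^+ 2]big1 ?expr0n ?subr0 // => p _; exact: expect_fourierD_orth.
Qed.

(** Each derivative of a mode is at most its frequencies times [fsup], and ([fsup k] [fsup l])^2 <=
    4^n. Summing over q gives S <= |k| |l| by Cauchy-Schwarz; the factor 2 comes from (a + b)^2 <= 2
    (a^2 + b^2). *)
Lemma commutator_field_bound k l x : \sum_p tev (commutator_field (tfourier k) (tfourier l) p) x ^+ 2 <=
  2 * 4 ^+ n * (fnorm2 k + fnorm2 l) * (fnorm2 k * fnorm2 l) :> R.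
Proof.
pose S : R := \sum_q `|(k 0 q)%:~R| * `|(l 0 q)%:~R|.
have S2 : S ^+ 2 <= fnorm2 k * fnorm2 l.
  have e (m : 'rV[int]_n) : \sum_q `|(m 0 q)%:~R| ^+ 2 = fnorm2 m :> R.
    by apply: eq_bigr => q _; rewrite real_normK ?num_real.
  rewrite -!e; exact: cauchy_schwarz_sum.
have S0 : 0 <= S by apply: sumr_ge0 => q _; rewrite mulr_ge0.
have A2 : (fsup k * fsup l) ^+ 2 <= 4 ^+ n.
  rewrite exprMn (_ : 4 = 2 * 2 :> R); last by ring.
  by rewrite exprMn; apply: ler_pM; rewrite ?sqr_ge0 ?fsup_sqr.
have A0 : 0 <= fsup k * fsup l by rewrite mulr_ge0 ?fsup_ge0.
have Zp p : `|tev (commutator_field (tfourier k) (tfourier l) p) x| <=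
    fsup k * fsup l * S * (`|(k 0 p)%:~R| + `|(l 0 p)%:~R|).
  rewrite tev_commutator_field (le_trans (ler_norm_sum _ _ _)) //.
  rewrite (_ : _ * _ * S * _ = \sum_q (fsup k * fsup l * (`|(k 0 q)%:~R| * `|(l 0 q)%:~R|) * (`|(k 0 p)%:~R| + `|(l 0 p)%:~R|))).
    apply: ler_sum => q _; rewrite (le_trans (ler_normB _ _)) // !normrM.
    have a := ler_pM (normr_ge0 _) (normr_ge0 _) (tevDD_fourier_le l p q x) (tevD_fourier_le k q x).
    have b := ler_pM (normr_ge0 _) (normr_ge0 _) (tevDD_fourier_le k p q x) (tevD_fourier_le l q x).
    by apply: (le_trans (lerD a b)); rewrite le_eqVlt; apply/orP; left; apply/eqP; ring.
  by rewrite /S mulr_sumr mulr_suml.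
have Zp2 p : tev (commutator_field (tfourier k) (tfourier l) p) x ^+ 2 <=
    4 ^+ n * (fnorm2 k * fnorm2 l) * (2 * ((k 0 p)%:~R ^+ 2 + (l 0 p)%:~R ^+ 2)).
  rewrite -real_normK ?num_real //.
  apply: (@le_trans _ _ ((fsup k * fsup l * S * (`|(k 0 p)%:~R| + `|(l 0 p)%:~R|)) ^+ 2)).
    by rewrite lerXn2r ?nnegrE ?normr_ge0 ?Zp // mulr_ge0 ?addr_ge0 // mulr_ge0.
  rewrite exprMn [(_ * S) ^+ 2]exprMn; apply: ler_pM.
  - by apply: mulr_ge0; exact: sqr_ge0.
  - exact: sqr_ge0.
  - by apply: ler_pM => //; exact: sqr_ge0.
  rewrite -(real_normK (num_real (k 0 p)%:~R)) -(real_normK (num_real (l 0 p)%:~R)).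
  have := sqr_ge0 (`|(k 0 p)%:~R : R| - `|(l 0 p)%:~R|); lra.
apply: (le_trans (ler_sum _ (fun p _ => Zp2 p))).
rewrite -mulr_sumr -mulr_sumr big_split /= -/(fnorm2 k) -/(fnorm2 l) le_eqVlt; apply/orP; left; apply/eqP; ring.
Qed.

Section Curvature.
Variables (k l : 'rV[int]_n).
Notation F := (tfourier k : trig). Notation G := (tfourier l : trig).
Notation K := (corr_pot F G). Notation w := (corr_field F G).

Let bs (A B : 'I_n -> trig) : bm (fun x : torus R n => \sum_p tev (A p) x * tev (B p) x).
Proof. by apply: bm_sum => p; apply: bm_mul (bm_tev _) (bm_tev _). Qed.
Let bsq (A : 'I_n -> trig) : bm (fun x : torus R n => \sum_p tev (A p) x ^+ 2).
Proof. by apply: bm_sum => p; apply: bm_X (bm_tev _). Qed.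

(** From Z = 2 w + grad K and div w = - 2 K one gets 4 (|w|^2 + K^2) + 4 div (K w) = |Z|^2 - |grad
    K|^2 - 4 K^2, and the divergence has mean zero. *)
Lemma corr_field_energy : expect (fun x => sww w x + tev K x ^+ 2) <=
  4 ^+ n / 2 * (fnorm2 k + fnorm2 l) * (fnorm2 k * fnorm2 l).
Proof.
have b1 : bm (fun x => sww w x + tev K x ^+ 2) by apply: bm_add; [exact: bsq|exact: bm_X (bm_tev _)].
have bd : bm (fun x => \sum_q tev (tD q (tmul K (w q))) x) by apply: bm_sum => q; exact: bm_tev.
have bZ : bm (fun x => \sum_p tev (commutator_field F G p) x ^+ 2) by exact: bsq.
have key x : 4 * (sww w x + tev K x ^+ 2) + 4 * \sum_q tev (tD q (tmul K (w q))) x <= \sum_p tev (commutator_field F G p) x ^+ 2.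
  have dE : \sum_q tev (tD q (tmul K (w q))) x = \sum_q tev (tD q K) x * tev (w q) x - 2 * tev K x ^+ 2.
    have -> : 2 * tev K x ^+ 2 = - (tev K x * dw w x) by rewrite div_corr_field; ring.
    rewrite opprK /dw mulr_sumF -big_split /=; apply: eq_bigr => q _.
    by rewrite /tev tevalD_mul.
  have ZE : \sum_p tev (commutator_field F G p) x ^+ 2 = 4 * sww w x + 4 * (\sum_q tev (tD q K) x * tev (w q) x) + \sum_p tev (tD p K) x ^+ 2.
    rewrite /sww !mulr_sumF -!big_split /=; apply: eq_bigr => p _.
    have -> : tev (commutator_field F G p) x = 2 * tev (w p) x + tev (tD p K) x by rewrite corr_fieldE tev_commutator_field; field.
    ring.
  have K0 : 0 <= \sum_p tev (tD p K) x ^+ 2 by apply: sumr_ge0 => p _; exact: sqr_ge0.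
  rewrite dE ZE; have := sqr_ge0 (tev K x); lra.
have := le_expect (bm_add (bm_mul (bm_cst 4) b1) (bm_mul (bm_cst 4) bd)) bZ key.
rewrite (expectD (bm_mul (bm_cst 4) b1) (bm_mul (bm_cst 4) bd)) (expectZ 4 b1) (expectZ 4 bd).
rewrite (expect_sum (fun q => bm_tev _)) big1 => [|q _]; last exact: expect_tD.
have := le_expect bZ (bm_cst _) (commutator_field_bound k l); rewrite expect_cst; lra.
Qed.

(** The term subtracted in [curv] is nonnegative by Cauchy-Schwarz, so it may be dropped. *)
Lemma curv_upper : expect (curv F G K w) <= 4 ^+ n / 2 * (fnorm2 k + fnorm2 l) * (fnorm2 k * fnorm2 l).
Proof.
apply: le_trans corr_field_energy; apply: le_expect; first exact: bm_curv.
  by apply: bm_add; [exact: bsq|exact: bm_X (bm_tev _)].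
move=> x; rewrite /curv; have : sfg F G x ^+ 2 <= sff F x * sgg G x by exact: cauchy_schwarz_sum.
lra.
Qed.

(** Only - |grad F|^2 |grad G|^2 / 3 is kept; the other terms of [curv] are nonnegative. *)
Lemma curv_lower : - ((3 / 2) ^+ n / 3 * (fnorm2 k * fnorm2 l)) <= expect (curv F G K w).
Proof.
pose X x := \sum_p \sum_q tev (tD p F) x ^+ 2 * tev (tD q G) x ^+ 2.
have b p q : bm (fun x : torus R n => tev (tD p F) x ^+ 2 * tev (tD q G) x ^+ 2).
  by apply: bm_mul; apply: bm_X (bm_tev _).
have bX : bm X by apply: bm_sum => p; apply: bm_sum => q.
have EX : expect X <= (3 / 2) ^+ n * (fnorm2 k * fnorm2 l).
  rewrite /X expect_sum => [|p]; last exact: bm_sum.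
  rewrite /fnorm2 mulr_suml mulr_sumr; apply: ler_sum => p _.
  rewrite expect_sum // !mulr_sumr; apply: ler_sum => q _.
  under eq_fun do rewrite !tevD_fourier.
  by rewrite (le_trans (expect_wave4 _ _ _ _ _ _)) // !prod_energy_fourierD.
have h := le_expect (bm_mul (bm_cst (- 1 / 3)) bX) (bm_curv F G K w).
rewrite (expectZ _ bX) in h.
have := h _; move=> {}h; apply: (le_trans _ (h _)); first lra.
move=> x; rewrite /curv.
have -> : X x = sff F x * sgg G x.
  by rewrite /X /sff /sgg mulr_suml; apply: eq_bigr => p _; rewrite mulr_sumF.
have s0 : 0 <= sww w x by apply: sumr_ge0 => p _; exact: sqr_ge0.
have := sqr_ge0 (tev K x); have := sqr_ge0 (sfg F G x); lra.
Qed.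

End Curvature.
End FourierBounds.

(** * The limit and the bounds *)

Section Sec.
Context {R : realType} {n : nat}.
Notation trig := (seq (R * 'rV[int]_n * R)).
Notation mu := (torus_volume R n).
Variables (F G : trig).

Lemma H1_norm_sub (s t : R) : H1_norm mu (fun x => s * tev F x - t * tev G x) ^+ 2 =
  expect (fun x => \sum_p (s * tev (tD p F) x - t * tev (tD p G) x) ^+ 2
    + 4 * (s * tev F x - t * tev G x) ^+ 2).
Proof.
have b (A B : trig) : bm (fun x => s * tev A x - t * tev B x).
  by apply: bm_sub; apply: bm_mul (bm_cst _) (bm_tev _).
rewrite (_ : (fun x => s * _ - _) = tev (tscale s F ++ tscale (- t) G)); last first.
  by apply/funext => x; rewrite /tev teval_cat !teval_scale mulNr.
rewrite H1_norm_sqr H1_dot_tev expectD; last 2 first.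
- by apply: bm_sum => p; exact: bm_X.
- by apply: bm_mul (bm_cst 4) _; exact: bm_X.
rewrite expectZ; last exact: bm_X.
rewrite expect_sum => [|p]; last exact: bm_X.
have e T T' x : tev (tscale s T ++ tscale (- t) T') x = s * tev T x - t * tev T' x.
  by rewrite /tev teval_cat !teval_scale mulNr.
congr (_ + 4 * _); last by congr expect; apply/funext => x; rewrite e expr2.
apply: eq_bigr => p _; congr expect; apply/funext => x.
by rewrite /tev tD_cat teval_cat !tevalD_scale -mulNr expr2.
Qed.

Lemma expect_dens (s t : R) : expect (dens F G (corr_pot F G) (corr_field F G) s t) =
  H1_norm mu (fun x => s * tev F x - t * tev G x) ^+ 2
  - s ^+ 2 * t ^+ 2 * expect (curv F G (corr_pot F G) (corr_field F G)).
Proof.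
have b (A B : trig) : bm (fun x => s * tev A x - t * tev B x).
  by apply: bm_sub; apply: bm_mul (bm_cst _) (bm_tev _).
rewrite H1_norm_sub -expectZ; last exact: bm_curv.
rewrite -expectB //; last by apply: bm_mul (bm_cst _) _; exact: bm_curv.
apply: bm_add; first by apply: bm_sum => p; exact: bm_X.
by apply: bm_mul (bm_cst 4) _; exact: bm_X.
Qed.

Lemma has_Sec_tev : 0 < Lambda mu (tev F) (tev G) ->
  has_Sec mu (tev F) (tev G) (3 * expect (curv F G (corr_pot F G) (corr_field F G)) / Lambda mu (tev F) (tev G)).
Proof.
set L := Lambda _ _ _; set kap := expect _ => L0 s t s0 t0 cs ct [M HM].
have [C [e [e0 HC]]] := HK_estimate F G.
(* The bounded ratio of s and t is used here: (a + b)^2 / (a b) = a / b + b / a + 2 <= M + 2. *)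
have pow5 a b : 0 < a -> 0 < b -> a / b + b / a <= M ->
    (a + b) ^+ 5 / (a ^+ 2 * b ^+ 2) <= (M + 2) ^+ 2 * (a + b).
  move=> a0 b0 hM; have ab0 : 0 < a * b by rewrite mulr_gt0.
  have sq : (a + b) ^+ 2 <= (M + 2) * (a * b).
    rewrite -ler_pdivrMr // (_ : _ / _ = a / b + b / a + 2); first by lra.
    by field; rewrite !gt_eqF.
  rewrite ler_pdivrMr ?mulr_gt0 ?exprn_gt0 //.
  have -> : (a + b) ^+ 5 = ((a + b) ^+ 2) ^+ 2 * (a + b) by ring.
  have -> : (M + 2) ^+ 2 * (a + b) * (a ^+ 2 * b ^+ 2) = ((M + 2) * (a * b)) ^+ 2 * (a + b) by ring.
  have ab1 : 0 <= a + b by rewrite addr_ge0 ?ltW.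
  rewrite ler_wpM2r // lerXn2r // nnegrE ?sqr_ge0 //.
  exact: le_trans (sqr_ge0 _) sq.
have C0 : 0 <= `|C| by [].
pose D := 3 / L * (`|C| * (M + 2) ^+ 2).
have D0 : 0 <= D by apply: mulr_ge0; [rewrite divr_ge0 // ltW|apply: mulr_ge0 => //; exact: sqr_ge0].
have near_e (d : R) : 0 < d -> \forall j \near \oo, s j + t j <= d.
  move=> d0; have cst : s j + t j @[j --> \oo] --> (0 : R).
    by rewrite -[0 in X in _ --> X]addr0; exact: cvgD.
  have /cvgrPdist_le/(_ d d0) := cst; apply: filterS => j.
  by rewrite sub0r normrN ger0_norm // addr_ge0 // ltW.
have main j : s j + t j <= e -> exists2 v : R,
    sec_quotient mu (tev F) (tev G) (s j) (t j) = v%:E & `|3 * kap / L - v| <= D * (s j + t j).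
  move=> je; have [v vE vB] := HC _ _ (s0 j) (t0 j) je.
  rewrite expect_dens -/kap in vB.
  set H := H1_norm mu _ ^+ 2 in vB.
  exists (3 / (L * s j ^+ 2 * t j ^+ 2) * (H - v)); first by rewrite /sec_quotient vE -/L -EFinB -EFinM.
  have st0 : 0 < s j ^+ 2 * t j ^+ 2 by rewrite mulr_gt0 ?exprn_gt0.
  have -> : 3 * kap / L - 3 / (L * s j ^+ 2 * t j ^+ 2) * (H - v) =
     3 / L * ((v - (H - s j ^+ 2 * t j ^+ 2 * kap)) / (s j ^+ 2 * t j ^+ 2)).
    by field; rewrite !gt_eqF.
  have L3 : 0 < 3 / L by rewrite divr_gt0.
  rewrite normrM (gtr0_norm L3) normf_div (gtr0_norm st0) /D -[leRHS]mulrA ler_wpM2l ?(ltW L3) // -[leRHS]mulrA.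
  apply: (@le_trans _ _ (`|C| * ((s j + t j) ^+ 5 / (s j ^+ 2 * t j ^+ 2)))).
    rewrite [leRHS]mulrA; apply: ler_wpM2r; first by rewrite invr_ge0 ltW.
    apply: le_trans vB _; apply: ler_wpM2r; last exact: ler_norm.
    by rewrite exprn_ge0 // addr_ge0 ?ltW.
  by rewrite ler_wpM2l // pow5.
apply/fine_cvgP; split.
  by have := near_e _ e0; apply: filterS => j /main[v -> _].
apply/cvgrPdist_le => eps eps0.
(* The 1 in D + 1 covers the case D = 0. *)
have d0 : 0 < eps / (D + 1) by rewrite divr_gt0 // ltr_wpDl.
near=> j; have je : s j + t j <= e by near: j; exact: near_e.
have jd : s j + t j <= eps / (D + 1) by near: j; exact: near_e.
have [v /= -> vB] := main j je; apply: (le_trans vB).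
rewrite ler_pdivlMr ?ltr_wpDl // in jd; rewrite (le_trans _ jd) // mulrC ler_wpM2l ?lerDl //.
by rewrite addr_ge0 ?ltW.
Unshelve. all: by end_near. Qed.

End Sec.

Theorem theorem6p11 (R : realType) (n : nat) (k l : 'rV[int]_n) (hkl : k <> l) :
  exists2 L : R,
    has_Sec (torus_volume R n) (fourier k) (fourier l) L &
    - (3 / 2) ^+ n <= L <=
      3 / 2 * 4 ^+ n *
        (enorm (map_mx intr k : 'rV[R]_n) ^+ 2 +
         enorm (map_mx intr l : 'rV[R]_n) ^+ 2).
Proof.
have LE := @Lambda_fourier R n k l hkl; rewrite !fourierE in LE *.
have k0 := @fnorm2_ge0 R n k; have l0 := @fnorm2_ge0 R n l.
have L0 : 0 < Lambda (torus_volume R n) (tev (tfourier k)) (tev (tfourier l)).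
  by rewrite LE mulr_gt0 // ltr_wpDl.
exists (3 * expect (curv (tfourier k) (tfourier l) (corr_pot (tfourier k) (tfourier l)) (corr_field (tfourier k) (tfourier l))) /
  Lambda (torus_volume R n) (tev (tfourier k)) (tev (tfourier l))); first exact: has_Sec_tev.
have up := @curv_upper R n k l; have lo := @curv_lower R n k l.
rewrite !enorm_map_intr LE; rewrite LE in L0.
(* The factor |k|^2 |l|^2 of both bounds on kappa is absorbed by Lambda; the constants left are 3 *
   4^n / 2 above and 3 * (3/2)^n / 3 below. *)
have kl : fnorm2 k * fnorm2 l <= (fnorm2 k + 4) * (fnorm2 l + 4) :> R by lra.
apply/andP; split.
- rewrite ler_pdivlMr // mulNr.
  have := ler_wpM2l (exprn_ge0 n (divr_ge0 (ler0n R 3) (ler0n R 2))) kl; lra.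
- rewrite ler_pdivrMr //.
  have h : 0 <= 3 / 2 * 4 ^+ n * (fnorm2 k + fnorm2 l) :> R by rewrite !mulr_ge0 ?addr_ge0 ?exprn_ge0.
  have := ler_wpM2l h kl; lra.
Qed.
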